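(* Let $p_0$ be a pmf on $\mathbb{N}$ which is convex on $\mathbb{N}$ and supported on $\{0,\dots,S\}$ for some integer $S>0$, and let $X_1,\dots,X_n$ be i.i.d. with pmf $p_0$. Let $(v_n)$ be positive numbers with $v_n\to0$ and $\sqrt n\,v_n\to\infty$, let $\alpha\in(0,1)$, and let $t_{\alpha,n}$ be the conditional $(1-\alpha)$-quantile of $\hat T_n$ given $X_1,\dots,X_n$. Then $$\limsup_{n\to\infty}P\big(n\|p_n-\hat p_n\|^2>t_{\alpha,n}\big)\le\alpha .$$
   Context: $p_n(j)=n^{-1}\sum_{i=1}^n\mathbb{1}_{\{X_i=j\}}$ is the empirical pmf, $S_n=\max\{X_1,\dots,X_n\}$, and $\|q\|^2=\sum_{j\in\mathbb{N}}q(j)^2$. For a sequence or vector $p$ and interior index $k\ge1$, $\Delta p(k)=p(k+1)-2p(k)+p(k-1)$; a pmf $p$ is convex on $\mathbb{N}$ iff $\Delta p(k)\ge0$ for all $k\ge1$. $\hat p_n$ is the (unique) minimizer of $\|p_n-p\|^2$ over all convex pmfs $p$ on $\mathbb{N}$. Conditionally on $X_1,\dots,X_n$, $g_n=(g_n(0),\dots,g_n(S_n+1))$ is a centered Gaussian vector in $\mathbb{R}^{S_n+2}$ with covariance entries $\mathbb{1}_{\{i=j\}}p_n(i)-p_n(i)p_n(j)$, $i,j=0,\dots,S_n+1$. $\mathcal K_n$ is the set of all $g\in\mathbb{R}^{S_n+2}$ with $\Delta g(x)\ge0$ for all $x\in\{1,\dots,S_n\}$ such that $\Delta\hat p_n(x)\le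 v_n$; $\hat g_n$ is the unique minimizer of $\sum_{k=0}^{S_n+1}(g(k)-g_n(k))^2$ over $g\in\mathcal K_n$, and $\hat T_n=\sum_{k=0}^{S_n+1}(\hat g_n(k)-g_n(k))^2$. *)

(* Defs.v *)
From HB Require Import structures.
From mathcomp Require Import all_boot all_order all_algebra.
From mathcomp Require Import all_classical all_reals all_analysis.
Set Implicit Arguments. Unset Strict Implicit. Unset Printing Implicit Defensive.
Import Order.TTheory GRing.Theory Num.Theory.
Import numFieldNormedType.Exports.
Local Open Scope classical_set_scope.
Local Open Scope ring_scope.

Section Defs.
Context {R : realType}.

(* the sample (X_1,...,X_n), indexed here from 0 *)
Definition sample {T : Type} (X : nat -> T -> nat) (n : nat) (w : T) : seq nat :=
  [seq X i w | i <- iota 0 n].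

Definition emp (s : seq nat) (j : nat) : R := (count_mem j s)%:R / (size s)%:R.

Definition smax (s : seq nat) : nat := \max_(i <- s) i.

(* dimension S_n + 2 of the Gaussian vector g_n = (g_n(0),...,g_n(S_n+1)) *)
Definition gdim (s : seq nat) : nat := (smax s).+2.

(* second difference, used at interior indices k >= 1 *)
Definition D2 (p : nat -> R) (k : nat) : R := p k.+1 - 2 * p k + p k.-1.

Definition is_pmf (p : nat -> R) : Prop :=
  (forall j, 0 <= p j) /\ ((fun N => \sum_(0 <= k < N) p k) @ \oo --> (1 : R)).

Definition convex_pmf (p : nat -> R) : Prop :=
  is_pmf p /\ forall k, (0 < k)%N -> 0 <= D2 p k.

Definition sqnorm (q : nat -> R) : \bar R := (\sum_(0 <= j <oo) (((q j) ^+ 2)%R)%:E)%E.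

Definition is_convex_lse (s : seq nat) (p : nat -> R) : Prop :=
  convex_pmf p /\
  forall q, convex_pmf q -> (sqnorm (fun j => (emp s j - p j)%R) <= sqnorm (fun j => (emp s j - q j)%R))%E.

(* hat p_n : the (unique) minimizer *)
Definition phat (s : seq nat) : nat -> R := xget (fun _ => 0) [set p | is_convex_lse s p].

(* covariance of g_n given the data *)
Definition Sigma (s : seq nat) (i j : nat) : R :=
  (i == j)%:R * emp s i - emp s i * emp s j.

(* the cone K_n (coordinates >= gdim s are irrelevant) *)
Definition Kcone (vn : R) (s : seq nat) : set (nat -> R) :=
  [set g | forall x, (1 <= x <= smax s)%N -> D2 (phat s) x <= vn -> 0 <= D2 g x].

Definition sqdist (dm : nat) (g h : nat -> R) : R := \sum_(k < dm) (g k - h k) ^+ 2.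

(* hat T_n = sum_k (hat g_n(k) - g_n(k))^2 = min over K_n of the squared distance *)
Definition That (vn : R) (s : seq nat) (gn : nat -> R) : R :=
  inf [set sqdist (gdim s) g gn | g in Kcone vn s].

Definition is_centered_normal {d : measure_display} {T : measurableType d}
  (Q : probability T R) (Y : T -> R) (sigma2 : R) : Prop :=
  measurable_fun setT Y /\
  (if sigma2 == 0 then Q [set w | Y w = 0] = 1%E
   else forall A : set R, measurable A ->
        Q (Y @^-1` A) = normal_prob 0 (Num.sqrt sigma2) A).

Definition gaussian_vector {d : measure_display} {T : measurableType d}
  (Q : probability T R) (dm : nat) (G : nat -> T -> R) (Sig : nat -> nat -> R) : Prop :=
  forall u : nat -> R,
    is_centered_normal Q (fun w => \sum_(k < dm) u k * G k w)
      (\sum_(i < dm) \sum_(j < dm) u i * u j * Sig i j).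

Definition quantile {d : measure_display} {T : measurableType d}
  (Q : probability T R) (Y : T -> R) (beta : R) : R :=
  inf [set t : R | (beta%:E <= Q [set w | (Y w <= t)%R])%E].

End Defs.

(* Main.v *)
(** Let [m] be the last point of the support of [p0], and let K be the cone of
    the vectors indexed by 0, ..., m + 1 that are convex at the points of
    {1, ..., m} where the second difference of [p0] vanishes.  Put
    y = sqrt n (p_n - p0), and call a sample good when |p_n - p0| <= v_n / 8;
    by Chebyshev's inequality this has probability tending to 1.

    On a good sample, hat p_n is so close to [p0] that K_n is contained in K,
    hence hat T_n >= dist(g_n, K)^2.  Moreover, if g is a point of K close to y,
    then p0 + g / sqrt n, once recentered into a pmf, is still convex, hence
    n |p_n - hat p_n|^2 <= dist(y, K)^2.  Let q be the smallest conditional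
    quantile over the good samples, attained at a sample s.  Rejection then
    forces dist(y, K) > sqrt q, whereas dist(g_s, K) > sqrt q has conditional
    probability at most alpha.

    It remains to compare the laws of dist(y, K) and dist(g_s, K), uniformly in
    the threshold and in the good sample s.  Indicators are bounded by Lipschitz
    functions, and these are approximated by Bernstein polynomials in the
    variables sin (a y_k).  The latter combine finitely many trigonometric
    monomials which do not depend on the function, and Lindeberg's argument
    handles each monomial.  No anti-concentration estimate is needed to undo
    the smoothing: there is a direction e which is interior to K and in the
    range of the covariance of g_s.  Shifting by t e lowers a positive distance
    to K by at least t / 2, and by Gaussian integration by parts it changes the
    Gaussian expectation of a bounded function by O(t) only. *)

Require Import Defs.
From HB Require Import structures.
From mathcomp Require Import all_boot all_order all_algebra.
From mathcomp Require Import all_classical all_reals all_analysis.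
From mathcomp Require Import measurable_realfun zify ring lra.
Set Implicit Arguments. Unset Strict Implicit. Unset Printing Implicit Defensive.
Import Order.TTheory GRing.Theory Num.Theory.
Import numFieldNormedType.Exports.
Local Open Scope classical_set_scope.
Local Open Scope ring_scope.

(** * Analytic preliminaries *)

(** The hypothesis on the Gaussian vectors describes linear forms only, so means of cosines of
    linear forms are what can be computed directly; second moments and integration by parts are
    derived from these means. The threshold is a conditional quantile that moves with n and with the
    sample, and the distance to K may have an atom at 0, so convergence in law at a fixed continuity
    point would not do: the comparison must be uniform in the threshold. Hence the Bernstein
    parameters are chosen from the width and the accuracy of the smoothing alone, and the cost of a
    shift involves a function through its bound only. The sines bring unbounded variables into
    [-1, 1], where Bernstein polynomials live; the price is an error quadratic in y, which second
    moments absorb. In v_n / 8, a factor 2 comes from passing from p_n to hat p_n, and a factor 4 is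
    the sum of the absolute coefficients 1, 2, 1 of a second difference. The growth of sqrt n v_n
    feeds Chebyshev's inequality; v_n -> 0 makes the good samples concentrate at p0. *)

Section trigo_bounds.
Context {R : realType}.
Implicit Types x y b : R.

Lemma mean_value_bound (f f' : R -> R) (M x : R) :
  (forall y, is_derive y 1 f (f' y)) ->
  (forall y, `|y| <= `|x| -> `|f' y| <= M) -> `|f x - f 0| <= M * `|x|.
Proof.
move=> df Mf'.
have cf y : {for y, continuous f}.
  by apply: differentiable_continuous; apply/derivable1_diffP; apply: ex_derive.
have [x0|x0|->] := ltgtP x 0; last by rewrite subrr normr0 mulr0.
- have [y yI] := MVT x0 (fun z _ => df z) (continuous_subspaceT cf).
  rewrite sub0r => e; rewrite distrC e normrM normrN ler_wpM2r//.
  apply: Mf'; move: yI; rewrite in_itv/= => /andP[xy y0].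
  by rewrite !ltr0_norm// lerN2 ltW.
- have [y yI] := MVT x0 (fun z _ => df z) (continuous_subspaceT cf).
  rewrite subr0 => ->; rewrite normrM ler_wpM2r//.
  apply: Mf'; move: yI; rewrite in_itv/= => /andP[y0 yx].
  by rewrite !gtr0_norm// ltW.
Qed.

Lemma normr_sin_le x : `|sin x| <= `|x|.
Proof.
have := @mean_value_bound sin cos 1 x (fun y => is_derive_sin y).
rewrite sin0 subr0 mul1r; apply => y _.
by rewrite ler_norml cos_geN1 cos_le1.
Qed.

Lemma cos_sub1_le x : `|cos x - 1| <= x ^+ 2 / 2.
Proof.
have -> : cos x - 1 = - (2 * sin (x / 2) ^+ 2).
  have := cosD (x / 2) (x / 2); rewrite -splitr => ->.
  have := cos2Dsin2 (x / 2); rewrite !expr2; lra.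
rewrite normrN ger0_norm; last by rewrite mulr_ge0// sqr_ge0.
have : sin (x / 2) ^+ 2 <= (x / 2) ^+ 2.
  rewrite -(real_normK (num_real (sin _))) -(real_normK (num_real (x / 2))).
  by rewrite ler_sqr ?nnegrE// normr_sin_le.
rewrite !expr2; lra.
Qed.

Lemma sin_sub_le3 x : `|sin x - x| <= `|x| ^+ 3 / 2.
Proof.
have := @mean_value_bound (fun z => sin z - z) (fun z => cos z - 1) (x ^+ 2 / 2) x.
rewrite sin0 !subr0 => H; apply: le_trans (H _ _) _.
- move=> y yx; apply: le_trans (cos_sub1_le y) _.
  by rewrite ler_wpM2r// -(real_normK (num_real y)) -(real_normK (num_real x)) ler_sqr// nnegrE.
- rewrite -(real_normK (num_real x)); rewrite !exprS !expr0; lra.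
Qed.

(** The cubic bound gives this for [|x| <= 2], the triangle inequality beyond. A quadratic error is
    one that second moments can integrate. *)
Lemma sin_sub_le2 x : `|sin x - x| <= x ^+ 2.
Proof.
have [x2|x2] := leP `|x| 2.
  apply: le_trans (sin_sub_le3 x) _.
  rewrite -(real_normK (num_real x)) exprS -mulrA mulrC -mulrA ler_piMr ?sqr_ge0//.
  by rewrite mulrC ler_pdivrMr// mul1r.
apply: le_trans (ler_normB _ _) _.
apply: (@le_trans _ _ (2 * `|x|)).
  by rewrite mulr_natl mulr2n lerD2r normr_sin_le.
by rewrite -(real_normK (num_real x)) expr2 ler_wpM2r// ltW.
Qed.

Lemma cos_taylor2 x : `|cos x - 1 + x ^+ 2 / 2| <= x ^+ 4 / 2.
Proof.
have := @mean_value_bound (fun z => cos z - 1 + z ^+ 2 / 2) (fun z => z - sin z)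
  (`|x| ^+ 3 / 2) x.
rewrite cos0 subrr expr0n mul0r addr0 subr0 => H; apply: le_trans (H _ _) _.
- move=> y; apply: is_derive_eq; rewrite /= /GRing.scale /=.
  rewrite !(subr0, expr1, mulr1, mulr0, addr0, add0r); lra.
- move=> y yx; rewrite distrC; apply: le_trans (sin_sub_le3 y) _.
  by rewrite ler_wpM2r// lerXn2r// nnegrE.
- have -> : x ^+ 4 = `|x| ^+ 4.
    by rewrite -[4%N]/(2 * 2)%N !exprM real_normK ?num_real.
  rewrite !exprS expr0; lra.
Qed.

Lemma cos_taylor1_le b x : `|cos (b + x) - cos b + x * sin b| <= 2 * x ^+ 2.
Proof.
rewrite cosD.
have -> : cos b * cos x - sin b * sin x - cos b + x * sin b =
  cos b * (cos x - 1) - sin b * (sin x - x) by ring.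
apply: le_trans (ler_normB _ _) _; rewrite !normrM.
have cb : `|cos b| <= 1 by rewrite ler_norml cos_geN1 cos_le1.
have sb : `|sin b| <= 1 by rewrite ler_norml sin_geN1 sin_le1.
have := cos_sub1_le x; have := sin_sub_le2 x => h1 h2.
have := ler_pM (normr_ge0 _) (normr_ge0 _) cb h2.
have := ler_pM (normr_ge0 _) (normr_ge0 _) sb h1.
have := sqr_ge0 x; lra.
Qed.

Lemma cos_taylor2_le b x :
  `|cos (b + x) - cos b + x * sin b + x ^+ 2 / 2 * cos b| <= `|x| ^+ 3 / 2 + x ^+ 4 / 2.
Proof.
rewrite cosD.
have -> : cos b * cos x - sin b * sin x - cos b + x * sin b + x ^+ 2 / 2 * cos b =
  cos b * (cos x - 1 + x ^+ 2 / 2) - sin b * (sin x - x) by ring.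
apply: le_trans (ler_normB _ _) _; rewrite !normrM.
have cb : `|cos b| <= 1 by rewrite ler_norml cos_geN1 cos_le1.
have sb : `|sin b| <= 1 by rewrite ler_norml sin_geN1 sin_le1.
have := cos_taylor2 x; have := sin_sub_le3 x => h1 h2.
have := ler_pM (normr_ge0 _) (normr_ge0 _) cb h2.
have := ler_pM (normr_ge0 _) (normr_ge0 _) sb h1.
lra.
Qed.

Lemma expRN_taylor1 x : 0 <= x -> `|expR (- x) - 1 + x| <= x ^+ 2.
Proof.
move=> x0; have h1 := expR_ge1Dx (- x).
have h2 : expR (- x) <= 1 - x + x ^+ 2.
  rewrite expRN -div1r ler_pdivrMr ?expR_gt0//.
  (* The product equals 1 + x^3, and 1 + x bounds the exponential from below. *)
  apply: (@le_trans _ _ ((1 - x + x ^+ 2) * (1 + x))).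
    by have := exprn_ge0 3 x0; rewrite !exprS expr0; lra.
  apply: ler_wpM2l; last exact: expR_ge1Dx.
  by have := sqr_ge0 (x - 1); rewrite !expr2; lra.
by rewrite ger0_norm; lra.
Qed.

(** Serves to differentiate under an integral sign: a Taylor bound on the integrand, once
    integrated, is exactly this hypothesis, with a second moment as [C]. *)
Lemma is_derive_quadratic_bound (f : R -> R) (x l C : R) :
  (forall t, `|f (x + t) - f x - t * l| <= C * t ^+ 2) -> is_derive x 1 f l.
Proof.
move=> H.
have C0 : 0 <= C by have := H 1; rewrite expr1n mulr1; apply: le_trans.
have cv : (fun t => t^-1 *: (f (t *: 1 + x) - f x)) @ 0^' --> l.
  apply/cvgrPdist_le => /= e e0; near=> t.
  have t0 : t != 0 by near: t; exact: nbhs_dnbhs_neq.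
  have te : `|t| <= e / (C + 1).
    near: t; apply: dnbhs0_le; rewrite divr_gt0//; lra.
  have := H t; rewrite (addrC x t).
  have -> : f (t + x) - f x - t * l = - t * (l - t^-1 * (f (t + x) - f x)).
    by field.
  rewrite normrM normrN -(real_normK (num_real t)) => Ht.
  rewrite /GRing.scale/= mulr1.
  have Ct : `|l - t^-1 * (f (t + x) - f x)| <= C * `|t|.
    rewrite -(@ler_pM2l _ `|t|) ?normr_gt0//; apply: le_trans Ht _.
    by rewrite expr2 mulrCA.
  apply: le_trans Ct _; apply: (@le_trans _ _ ((C + 1) * `|t|)).
    by rewrite ler_wpM2r//; lra.
  by rewrite mulrC -ler_pdivlMr//; lra.
apply: DeriveDef; last by rewrite /derive; exact: cvg_lim.
by apply/cvg_ex; exists l.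
Unshelve. all: by end_near.
Qed.

End trigo_bounds.

(** * Integrals of real-valued functions *)

Section real_integrable.
Context {R : realType} {d : measure_display} {T : measurableType d}.
Variable m : {measure set T -> \bar R}.
Local Notation Rintegrable f := (m.-integrable setT (EFin \o f)).

Lemma RintegrableD (f g : T -> R) : Rintegrable f -> Rintegrable g ->
  Rintegrable (fun x => f x + g x).
Proof.
move=> fi gi.
by rewrite (_ : _ \o _ = (EFin \o f) \+ (EFin \o g)); [exact: integrableD|apply/funext].
Qed.

Lemma RintegrableB (f g : T -> R) : Rintegrable f -> Rintegrable g ->
  Rintegrable (fun x => f x - g x).
Proof.
move=> fi gi.
rewrite (_ : _ \o _ = ((EFin \o f) \- (EFin \o g))%E); [exact: integrableB|exact/funext].
Qed.

Lemma RintegrableZl (c : R) (f : T -> R) : Rintegrable f ->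
  Rintegrable (fun x => c * f x).
Proof.
move=> fi; rewrite (_ : _ \o _ = (fun x => c%:E * (EFin \o f) x)%E); last exact/funext.
exact: integrableZl.
Qed.

Lemma Rintegrable_norm (f : T -> R) : Rintegrable f -> Rintegrable (fun x => `|f x|).
Proof.
by move=> fi; rewrite (_ : _ \o _ = abse \o (EFin \o f)); [exact: integrable_abse|apply/funext].
Qed.

Lemma Rintegral_dist (f g h : T -> R) : Rintegrable f -> Rintegrable g -> Rintegrable h ->
  (forall x, `|f x - g x| <= h x) ->
  `|\int[m]_x f x - \int[m]_x g x| <= \int[m]_x h x.
Proof.
move=> fi gi hi fgh; rewrite -RintegralB//.
apply: le_trans (le_normr_Rintegral _ _) _ => //; first exact: RintegrableB.
by apply: le_Rintegral => //; apply: Rintegrable_norm; exact: RintegrableB.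
Qed.

Lemma Rintegrable_sum (I : Type) (l : seq I) (F : I -> T -> R) :
  (forall i, Rintegrable (F i)) ->
  Rintegrable (fun x => \sum_(i <- l) F i x).
Proof.
move=> iF; rewrite (_ : _ \o _ = (fun x => \sum_(i <- l) (F i x)%:E)%E).
  by apply: integrable_sum => // i _; exact: iF.
by apply/funext => x /=; rewrite sumEFin.
Qed.

Lemma Rintegral_sum (I : Type) (l : seq I) (F : I -> T -> R) :
  (forall i, Rintegrable (F i)) ->
  \int[m]_x (\sum_(i <- l) F i x) = \sum_(i <- l) \int[m]_x F i x.
Proof.
move=> iF; elim: l => [|i l IH].
  by rewrite big_nil /Rintegral; under eq_integral do rewrite big_nil; rewrite integral0.
under eq_Rintegral do rewrite big_cons.
by rewrite big_cons RintegralD ?IH//; exact: Rintegrable_sum.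
Qed.

End real_integrable.

(** * Integration by parts and characteristic function of the centered normal law *)

Section normal_law.
Context {R : realType}.
Local Notation mu := (@lebesgue_measure R).
Variable s : R.
Hypothesis s0 : s != 0.
Local Notation phi := (normal_pdf 0 s).

Let phiE x : phi x = normal_peak s * expR (- x ^+ 2 / (s ^+ 2 *+ 2)).
Proof. by rewrite normal_pdfE// /normal_fun subr0. Qed.

Let s2_gt0 : 0 < s ^+ 2. Proof. by rewrite exprn_even_gt0. Qed.

Lemma is_derive_normal_pdf (x : R) : is_derive x 1 phi (- (x / s ^+ 2) * phi x).
Proof.
have -> : phi = (fun x => normal_peak s * expR (- x ^+ 2 / (s ^+ 2 *+ 2))).
  by apply/funext => y; exact: phiE.
apply: is_derive_eq; rewrite /= /GRing.scale /=.
rewrite !(mulr0, add0r, addr0, expr1, mulr1) -mulr_natl.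
by set E := expR _; field.
Qed.

(** The square is absorbed by a normal density of doubled variance, whose integrability is known:
    with u = x^2 / (4 s^2) it comes down to u e^(-u) <= 1. *)
Lemma sqr_normal_pdf_le : exists2 C : R, 0 <= C &
  forall x, x ^+ 2 * phi x <= C * normal_pdf 0 (s * Num.sqrt 2) x.
Proof.
have s20 : s * Num.sqrt 2 != 0 by rewrite mulf_neq0// sqrtr_eq0 -ltNge.
exists (4 * s ^+ 2 * normal_peak s / normal_peak (s * Num.sqrt 2)).
  apply: divr_ge0; last exact: normal_peak_ge0.
  by apply: mulr_ge0; [apply: mulr_ge0 => //; exact: ltW|exact: normal_peak_ge0].
move=> x; rewrite phiE normal_pdfE// /normal_fun subr0 exprMn sqr_sqrtr//.
set pk := normal_peak (s * _).
have pk0 : 0 < pk by exact: normal_peak_gt0.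
set u := x ^+ 2 / (4 * s ^+ 2).
have -> : - x ^+ 2 / (s ^+ 2 *+ 2) = - u + - u.
  by rewrite /u -mulr_natl; field.
have -> : - x ^+ 2 / (s ^+ 2 * 2 *+ 2) = - u.
  by rewrite /u -mulr_natl; field.
have -> : x ^+ 2 = 4 * s ^+ 2 * u by rewrite /u; field.
rewrite expRD.
have -> : 4 * s ^+ 2 * normal_peak s / pk * (pk * expR (- u)) =
  4 * s ^+ 2 * normal_peak s * expR (- u).
  by field; rewrite gt_eqF.
have -> : 4 * s ^+ 2 * u * (normal_peak s * (expR (- u) * expR (- u))) =
  (4 * s ^+ 2 * normal_peak s * expR (- u)) * (u * expR (- u)) by ring.
apply: ler_piMr.
  apply: mulr_ge0; last exact: expR_ge0.
  by apply: mulr_ge0; [apply: mulr_ge0 => //; exact: ltW|exact: normal_peak_ge0].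
rewrite expRN ler_pdivrMr ?expR_gt0// mul1r.
by apply: le_trans (expR_ge1Dx u); rewrite lerDr.
Qed.

Lemma integrable_quadratic_normal_pdf (g : R -> R) (A B : R) :
  measurable_fun setT g -> (forall x, `|g x| <= A + B * x ^+ 2) ->
  mu.-integrable setT (EFin \o (fun x => g x * phi x)).
Proof.
move=> mg gAB; have [C C0 HC] := sqr_normal_pdf_le.
have B0 : forall x, `|g x * phi x| <=
    `|A * phi x + `|B| * C * normal_pdf 0 (s * Num.sqrt 2) x|.
  move=> x; rewrite normrM (ger0_norm (normal_pdf_ge0 _ _ _)).
  apply: le_trans (ler_norm _).
  apply: le_trans (ler_wpM2r (normal_pdf_ge0 _ _ _) (gAB x)) _.
  rewrite mulrDl lerD2l -(mulrA B) -(mulrA `|B|).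
  apply: (@le_trans _ _ (`|B| * (x ^+ 2 * phi x))).
    apply: ler_wpM2r; last exact: ler_norm.
    by rewrite mulr_ge0 ?sqr_ge0 ?normal_pdf_ge0.
  by rewrite ler_wpM2l.
apply: (@le_integrable _ _ _ mu setT measurableT _
  (EFin \o (fun x => A * phi x + `|B| * C * normal_pdf 0 (s * Num.sqrt 2) x))).
- apply/measurable_EFinP; apply: measurable_funM => //.
  exact: measurable_normal_pdf.
- by move=> x _ /=; rewrite lee_fin.
- have -> : (EFin \o (fun x => A * phi x + `|B| * C * normal_pdf 0 (s * Num.sqrt 2) x)) =
    (fun x => A%:E * (phi x)%:E + (`|B| * C)%:E * (normal_pdf 0 (s * Num.sqrt 2) x)%:E)%E.
    by apply/funext => x /=.
  by apply: integrableD => //; apply: integrableZl => //; exact: integrable_normal_pdf.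
Qed.

(** The difference of the two integrands is the derivative of [g x * phi x], which decays like 1 /
    x^2. Its integral over growing symmetric intervals therefore tends to 0, and by dominated
    convergence also to the full integral. *)
Lemma normal_stein (g g' : R -> R) (A B : R) :
  (forall x : R, is_derive x 1 g (g' x)) -> continuous g' ->
  (forall x, `|g x| <= A) -> (forall x, `|g' x| <= B) ->
  (\int[mu]_x (g' x * phi x) = \int[mu]_x (g x * x / s ^+ 2 * phi x))%R.
Proof.
move=> dg cg' gA g'B.
have A0 : 0 <= A by exact: le_trans (gA 0).
have cg : continuous g.
  move=> x; apply: differentiable_continuous; apply/derivable1_diffP.
  exact: ex_derive.
have mg : measurable_fun setT g by apply: continuous_measurable_fun.
have mg' : measurable_fun setT g' by apply: continuous_measurable_fun.
have cphi : continuous phi by exact: continuous_normal_pdf.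
have i1 : mu.-integrable setT (EFin \o (fun x => g' x * phi x)).
  by apply: (@integrable_quadratic_normal_pdf _ B 0) => // x; rewrite mul0r addr0.
have mgx : measurable_fun setT (fun x => g x * x / s ^+ 2).
  by apply: measurable_funM => //; apply: measurable_funM.
have i2 : mu.-integrable setT (EFin \o (fun x => g x * x / s ^+ 2 * phi x)).
  apply: (@integrable_quadratic_normal_pdf _ (A / s ^+ 2) (A / s ^+ 2)) => // x.
  rewrite !normrM normfV (ger0_norm (ltW s2_gt0)).
  rewrite mulrAC -[X in _ <= X + _]mulr1 -mulrDr; apply: ler_pM => //.
  - by apply: divr_ge0 => //; exact: ltW.
  - by apply: ler_wpM2r => //; rewrite invr_ge0 ltW.
  - rewrite -(real_normK (num_real x)).
    by have := sqr_ge0 (`|x| - 1); rewrite sqrrB1; have := sqr_ge0 `|x|; lra.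
apply/eqP; rewrite -subr_eq0 -RintegralB//; apply/eqP.
pose f x := g' x * phi x - g x * x / s ^+ 2 * phi x.
pose F x := g x * phi x.
have dF (x : R) : is_derive x 1 F (f x).
  have := is_deriveM (dg x) (is_derive_normal_pdf x).
  move=> h; apply: is_derive_eq; rewrite /f /GRing.scale/=; ring.
have cf : continuous f.
  move=> x; apply: cvgB; first by apply: cvgM; [exact: cg'|exact: cphi].
  apply: cvgM; last exact: cphi.
  apply: cvgM; last exact: cvg_cst.
  by apply: cvgM; [exact: cg|exact: cvg_id].
have intf : mu.-integrable setT (EFin \o f).
  have -> : EFin \o f = (fun x => (g' x * phi x)%:E - (g x * x / s ^+ 2 * phi x)%:E)%E.
    by apply/funext.
  exact: integrableB.
have mf : measurable_fun setT (EFin \o f) by exact: measurable_int intf.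
have FTC n : (\int[mu]_(x in `[(- n.+1%:R)%R, n.+1%:R%R]) (f x)%:E =
    (F n.+1%:R%R - F (- n.+1%:R)%R)%R%:E)%E.
  rewrite (@continuous_FTC2 _ f F)//.
  - by apply: (@lt_trans _ _ 0); rewrite ?oppr_lt0 ltr0Sn.
  - exact: continuous_subspaceT.
  - split.
    + by move=> x _; exact: ex_derive.
    + by apply: cvg_at_right_filter; apply: differentiable_continuous; apply/derivable1_diffP; exact: ex_derive.
    + by apply: cvg_at_left_filter; apply: differentiable_continuous; apply/derivable1_diffP; exact: ex_derive.
  - by move=> x _; rewrite derive1E derive_val.
have Fle : exists2 C : R, 0 <= C & forall x : R, x != 0 -> `|F x| <= C / x ^+ 2.
  have [C C0 HC] := sqr_normal_pdf_le.
  exists (A * (C * normal_peak (s * Num.sqrt 2))).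
    by rewrite !mulr_ge0// normal_peak_ge0.
  move=> x x0; rewrite ler_pdivlMr ?exprn_even_gt0//.
  rewrite /F normrM (ger0_norm (normal_pdf_ge0 _ _ _)) -mulrA ler_pM//.
    by rewrite mulr_ge0 ?normal_pdf_ge0 ?sqr_ge0.
  rewrite mulrC; apply: le_trans (HC x) _; rewrite ler_wpM2l//.
  by apply: normal_pdf_ub; rewrite mulf_neq0// sqrtr_eq0 -ltNge.
have [C C0 HC] := Fle.
have lim0 : (\int[mu]_(x in `[(- n.+1%:R)%R, n.+1%:R%R]) (f x)%:E)%E @[n --> \oo] --> 0%E.
  under eq_fun do rewrite FTC.
  apply: cvg_EFin; first by apply: nearW => n.
  apply/norm_cvg0P.
  apply: (@squeeze_cvgr _ _ _ _ (fun=> 0) (fun n => 2 * C * n.+1%:R^-1)).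
  - apply: nearW => n /=; rewrite normr_ge0 /=.
    apply: le_trans (ler_normB _ _) _.
    have n0 : (n.+1%:R : R) != 0 by [].
    have := HC _ n0; have := HC (- n.+1%:R); rewrite oppr_eq0 => /(_ n0).
    rewrite sqrrN => h1 h2; apply: le_trans (lerD h2 h1) _.
    have h3 : (n.+1%:R ^+ 2)^-1 <= n.+1%:R^-1 :> R.
      by rewrite lef_pV2 ?posrE ?exprn_gt0 ?ltr0Sn// expr2 ler_peMl ?ler1n ?ler0n.
    have h4 := ler_wpM2l C0 h3.
    by rewrite -(mulrA 2) [2 * _]mulr_natl mulr2n; exact: lerD.
  - exact: cvg_cst.
  - rewrite -[X in _ --> X](mulr0 (2 * C)); apply: cvgMr.
    exact: cvg_harmonic.
have limf : (\int[mu]_(x in `[(- n.+1%:R)%R, n.+1%:R%R]) (f x)%:E)%E @[n --> \oo] -->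
    (\int[mu]_x (f x)%:E)%E.
  under eq_fun do rewrite integral_mkcond.
  apply: (@dominated_cvg _ _ _ mu setT measurableT _ _ (fun x => `|(f x)%:E|)%E) => //.
  - move=> n; apply: (proj1 (measurable_restrictT _ _)) => //.
    exact: measurable_funS mf.
  - move=> x _; apply: cvg_near_cst.
    near=> n; rewrite patchE mem_set//= in_itv/=.
    rewrite -ler_norml; apply: le_trans (ltW (truncnS_gt _)) _.
    rewrite ler_nat; near: n; exists (Num.truncn `|x|) => // m /=.
  - exact: integrable_abse.
  - move=> n x _; rewrite patchE; case: ifP => // _; by rewrite abse0.
transitivity (fine (\int[mu]_x (f x)%:E)%E); first by [].
by rewrite (cvg_unique _ limf lim0).
Unshelve. all: by end_near.
Qed.

(** As a function of t, the left side psi satisfies psi' = - s^2 t psi, by [normal_stein] applied to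
    a sine; hence psi(t) exp(s^2 t^2 / 2) is constant. The phase [b] covers cosines and sines at
    once. *)
Lemma normal_cos_moment (t b : R) :
  (\int[mu]_x (cos (t * x + b) * phi x) = cos b * expR (- (s ^+ 2 * t ^+ 2 / 2)))%R.
Proof.
pose psi t := (\int[mu]_x (cos (t * x + b) * phi x))%R.
have mcos u c : measurable_fun setT (fun x : R => cos (u * x + c)).
  apply: continuous_measurable_fun => x.
  apply: continuous_comp; last exact: continuous_cos.
  by apply: cvgD; [apply: cvgM; [exact: cvg_cst|exact: cvg_id]|exact: cvg_cst].
have msin u c : measurable_fun setT (fun x : R => sin (u * x + c)).
  apply: continuous_measurable_fun => x.
  apply: continuous_comp; last exact: continuous_sin.
  by apply: cvgD; [apply: cvgM; [exact: cvg_cst|exact: cvg_id]|exact: cvg_cst].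
have icos u : mu.-integrable setT (EFin \o (fun x => cos (u * x + b) * phi x)).
  apply: (@integrable_quadratic_normal_pdf _ 1 0) => // x.
  by rewrite mul0r addr0 ler_norml cos_geN1 cos_le1.
have isin u : mu.-integrable setT (EFin \o (fun x => x * sin (u * x + b) * phi x)).
  apply: (@integrable_quadratic_normal_pdf _ 1 1); first exact: measurable_funM.
  move=> x; rewrite normrM mul1r.
  apply: (@le_trans _ _ `|x|).
    by rewrite ler_piMr// ler_norml sin_geN1 sin_le1.
  rewrite -(real_normK (num_real x)).
  by have := sqr_ge0 (`|x| - 1); rewrite sqrrB1; have := sqr_ge0 `|x|; lra.
have isq : mu.-integrable setT (EFin \o (fun x => x ^+ 2 * phi x)).
  apply: (@integrable_quadratic_normal_pdf _ 0 1); first exact: measurable_funX.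
  by move=> x; rewrite add0r mul1r ger0_norm// sqr_ge0.
have dpsi (u : R) : is_derive u 1 psi (- (s ^+ 2 * u) * psi u).
  have -> : - (s ^+ 2 * u) * psi u = - \int[mu]_x (x * sin (u * x + b) * phi x).
    rewrite mulNr; congr (- _).
    have HS : u * psi u = \int[mu]_x (sin (u * x + b) * x / s ^+ 2 * phi x).
      rewrite /psi -RintegralZl//; under eq_Rintegral do rewrite mulrA.
      apply: (@normal_stein _ _ 1 `|u|).
      - move=> x; apply: is_derive_eq; rewrite /GRing.scale/=; ring.
      - move=> x; apply: cvgM; first exact: cvg_cst.
        apply: continuous_comp; last exact: continuous_cos.
        by apply: cvgD; [apply: cvgM; [exact: cvg_cst|exact: cvg_id]|exact: cvg_cst].
      - by move=> x; rewrite ler_norml sin_geN1 sin_le1.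
      - by move=> x; rewrite normrM ler_piMr// ler_norml cos_geN1 cos_le1.
    rewrite -mulrA HS -RintegralZl//.
      by apply: eq_Rintegral => x _; field.
    apply: (@integrable_quadratic_normal_pdf _ (s ^+ 2)^-1 (s ^+ 2)^-1).
      by apply: measurable_funM => //; exact: measurable_funM.
    move=> x; rewrite !normrM normfV (ger0_norm (ltW s2_gt0)).
    rewrite -[X in _ <= X + _]mulr1 -mulrDr mulrC ler_wpM2l ?invr_ge0 ?(ltW s2_gt0)//.
    apply: (@le_trans _ _ `|x|).
      by rewrite ler_piMl// ler_norml sin_geN1 sin_le1.
    rewrite -(real_normK (num_real x)).
    by have := sqr_ge0 (`|x| - 1); rewrite sqrrB1; have := sqr_ge0 `|x|; lra.
  apply: (@is_derive_quadratic_bound _ _ _ _ (2 * \int[mu]_x (x ^+ 2 * phi x))).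
  move=> h; rewrite /psi mulrN opprK -RintegralZl// -RintegralB// -RintegralD//; last first.
  - exact: RintegrableZl.
  - exact: RintegrableB.
  rewrite mulrAC -RintegralZl//.
  have i1 : mu.-integrable setT (EFin \o (fun x =>
      cos ((u + h) * x + b) * phi x - cos (u * x + b) * phi x +
      h * (x * sin (u * x + b) * phi x))).
    by apply: RintegrableD; [exact: RintegrableB|exact: RintegrableZl].
  apply: le_trans (le_normr_Rintegral _ _) _ => //.
  apply: le_Rintegral => //.
  - exact: Rintegrable_norm.
  - exact: RintegrableZl.
  - move=> x _.
    have -> : cos ((u + h) * x + b) * phi x - cos (u * x + b) * phi x +
       h * (x * sin (u * x + b) * phi x) =
       (cos ((u * x + b) + h * x) - cos (u * x + b) + (h * x) * sin (u * x + b)) * phi x.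
      by rewrite (_ : (u + h) * x + b = u * x + b + h * x); ring.
    rewrite normrM (ger0_norm (normal_pdf_ge0 _ _ _)) mulrA ler_wpM2r ?normal_pdf_ge0//.
    by apply: le_trans (cos_taylor1_le _ _) _; rewrite exprMn mulrA.
pose E (u : R) := expR (s ^+ 2 * u ^+ 2 / 2).
have dE (u : R) : is_derive u 1 (fun u => psi u * E u) 0.
  have dE' : is_derive u 1 E (s ^+ 2 * u * E u).
    by apply: is_derive_eq; rewrite /E /GRing.scale/= !(mulr0, addr0, mulr1, expr1); field.
  have := is_deriveM (dpsi u) dE' => h.
  by apply: is_derive_eq; rewrite /GRing.scale/=; ring.
have := @mean_value_bound _ (fun u => psi u * E u) (fun=> 0) 0 t dE.
rewrite mul0r => H.
have {H} : `|psi t * E t - psi 0 * E 0| <= 0 by apply: H => y _; rewrite normr0.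
rewrite normr_le0 subr_eq0 => /eqP.
have -> : psi 0 * E 0 = cos b.
  rewrite /E expr0n mulr0 mul0r expR0 mulr1 /psi.
  under eq_Rintegral do rewrite mul0r add0r.
  rewrite RintegralZl//; last exact: integrable_normal_pdf.
  by rewrite /Rintegral integral_normal_pdf mulr1.
by move=> <-; rewrite -[RHS]mulrA /E -expRD subrr expR0 mulr1.
Qed.

Lemma Rintegral_normal_prob (f : R -> R) (M : R) :
  measurable_fun setT f -> (forall x, `|f x| <= M) ->
  (\int[normal_prob 0 s]_x f x = \int[mu]_x (f x * phi x))%R.
Proof.
move=> mf fM; rewrite /Rintegral; congr fine.
have iPf : (normal_prob 0 s).-integrable setT (EFin \o f).
  apply: (@measurable_bounded_integrable _ _ _ (normal_prob 0 s)) => //.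
  - by rewrite -ge0_fin_numE// fin_num_measure.
  - exists M; split; first exact: num_real.
    by move=> x Mx y _ /=; apply: le_trans (fM y) (ltW Mx).
have dom := normal_prob_dominates 0 s.
rewrite -(Radon_Nikodym_change_of_variables dom)//=.
have mphi : measurable_fun setT (EFin \o phi).
  by apply/measurable_EFinP; exact: measurable_normal_pdf.
have mef : measurable_fun setT (EFin \o f) by exact/measurable_EFinP.
apply: ae_eq_integral => //.
- apply: emeasurable_funM => //.
- by apply/measurable_EFinP; apply: measurable_funM => //; exact: measurable_normal_pdf.
- under [X in ae_eq _ _ _ X]eq_fun do rewrite EFinM.
  apply: ae_eqe_mul2l => /=.
  rewrite Radon_NikodymE//=.
  case: cid => /= h [h1 h2 h3].
  apply: integral_ae_eq => //=.
  by move=> E _ mE; rewrite -h3.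
Qed.

End normal_law.

Lemma limn_esup_le {R : realType} (u : (\bar R)^nat) (c : \bar R) :
  (\forall n \near \oo, (u n <= c)%E) -> (limn_esup u <= c)%E.
Proof.
move=> uc; apply: le_trans (ereal_inf_lbound _) _.
  by exists [set n | (u n <= c)%E].
by apply: ge_ereal_sup => _ [n /= un <-].
Qed.

(** * Centered normal variables on a probability space *)

Section centered_normal.
Context {R : realType} {d : measure_display} {T : measurableType d}.
Variable Q : probability T R.

Lemma bounded_integrable (f : T -> R) (M : R) :
  measurable_fun setT f -> (forall x, `|f x| <= M) ->
  Q.-integrable setT (EFin \o f).
Proof.
move=> mf fM; apply: (@measurable_bounded_integrable _ _ _ Q) => //.
- by rewrite -ge0_fin_numE// fin_num_measure.
- exists M; split; first exact: num_real.
  by move=> x Mx y _ /=; apply: le_trans (fM y) (ltW Mx).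
Qed.

Lemma centered_normal_cos (Y : T -> R) (sigma2 t b : R) : 0 <= sigma2 ->
  is_centered_normal Q Y sigma2 ->
  (\int[Q]_w cos (t * Y w + b) = cos b * expR (- (sigma2 * t ^+ 2 / 2)))%R.
Proof.
move=> s2 [mY]; have [->|sn0] := eqVneq sigma2 0.
  move=> Y0; rewrite mul0r mul0r oppr0 expR0 mulr1.
  transitivity (\int[Q]_w cos b)%R; last first.
    by rewrite Rintegral_cst// [X in fine X]probability_setT mulr1.
  rewrite /Rintegral; congr fine; apply: ae_eq_integral => //.
  - apply/measurable_EFinP.
    apply: (@measurableT_comp _ _ _ _ _ _ cos).
      by apply: continuous_measurable_fun; exact: continuous_cos.
    by apply: measurable_funD => //; exact: measurable_funM.
  - have mY0 : measurable [set w | Y w = 0].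
      have := mY measurableT [set 0] (measurable_set1 _); by rewrite setTI.
    exists (~` [set w | Y w = 0]); split.
    + exact: measurableC.
    + by rewrite [LHS](probability_setC Q mY0) Y0 subee.
    + by move=> w /= H Yw; apply: H => _; rewrite Yw mulr0 add0r.
move=> HQ.
pose sg := Num.sqrt sigma2.
have sg0 : sg != 0 by rewrite sqrtr_eq0 -ltNge lt_neqAle eq_sym sn0.
pose Y' : {RV Q >-> measurableTypeR R} :=
  HB.pack Y (isMeasurableFun.Build _ _ T (measurableTypeR R) Y mY).
have mc : measurable_fun setT (fun x : R => cos (t * x + b)).
  apply: (@measurableT_comp _ _ _ _ _ _ cos).
    by apply: continuous_measurable_fun; exact: continuous_cos.
  by apply: measurable_funD => //; exact: measurable_funM.
transitivity (\int[distribution Q Y']_x cos (t * x + b))%R.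
  rewrite /Rintegral; congr fine.
  rewrite (@integral_distribution _ _ _ _ _ _ Y' (fun x => (cos (t * x + b))%:E))//.
    exact/measurable_EFinP.
  apply: (@bounded_integrable (fun w => cos (t * Y w + b)) 1).
    exact: (measurableT_comp mc mY).
  by move=> x; rewrite ler_norml cos_geN1 cos_le1.
transitivity (\int[normal_prob 0 sg]_x cos (t * x + b))%R.
  have e := @eq_measure_integral _ (measurableTypeR R) R setT (normal_prob 0 sg)
    (distribution Q Y') (fun x => (cos (t * x + b))%:E).
  rewrite /Rintegral; congr fine; apply: e => A mA _.
  exact: HQ.
rewrite (@Rintegral_normal_prob R sg _ 1)//; last first.
  by move=> x; rewrite ler_norml cos_geN1 cos_le1.
by rewrite normal_cos_moment// sqr_sqrtr.
Qed.

(** The functions 2 k^2 (1 - cos (Y / k)) converge to Y^2. Their means are explicit and at most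
    [sigma2], because e^(-x) >= 1 - x; Fatou's lemma concludes. *)
Lemma centered_normal_sqr (Y : T -> R) (sigma2 : R) : 0 <= sigma2 ->
  is_centered_normal Q Y sigma2 ->
  Q.-integrable setT (EFin \o (fun w => Y w ^+ 2)) /\ \int[Q]_w (Y w ^+ 2) <= sigma2.
Proof.
move=> s2 nY; have mY : measurable_fun setT Y by case: nY.
have mcos t : measurable_fun setT (fun w => cos (t * Y w)).
  apply: (@measurableT_comp _ _ _ _ _ _ cos).
    by apply: continuous_measurable_fun; exact: continuous_cos.
  exact: measurable_funM.
pose f n w := 2 * n.+1%:R ^+ 2 * (1 - cos (n.+1%:R^-1 * Y w)).
have f0 n w : 0 <= f n w.
  by apply: mulr_ge0; [apply: mulr_ge0 => //; exact: sqr_ge0|rewrite subr_ge0 cos_le1].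
have mf n : measurable_fun setT (f n).
  by apply: measurable_funM => //; exact: measurable_funB.
have icos t : Q.-integrable setT (EFin \o (fun w => cos (t * Y w))).
  by apply: (@bounded_integrable _ 1) => // x; rewrite ler_norml cos_geN1 cos_le1.
have i1 : Q.-integrable setT (EFin \o (fun w : T => 1 : R)).
  by apply: (@bounded_integrable _ 1) => // x; rewrite normr1.
have intf n : (\int[Q]_w (f n w)%:E <= sigma2%:E)%E.
  have ifn : Q.-integrable setT (EFin \o f n).
    by apply: RintegrableZl; exact: RintegrableB.
  rewrite -[X in (X <= _)%E]fineK; last exact: integrable_fin_num.
  rewrite lee_fin -[leLHS]/(\int[Q]_w f n w)%R /f RintegralZl//; last exact: RintegrableB.
  rewrite RintegralB// Rintegral_cst// [X in fine X]probability_setT mulr1.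
  have := centered_normal_cos n.+1%:R^-1 0 s2 nY.
  under eq_Rintegral do rewrite addr0.
  move=> ->; rewrite cos0 mul1r.
  set x := sigma2 * _ / 2.
  have -> : sigma2 = 2 * n.+1%:R ^+ 2 * x.
    have n0 : n.+1%:R != 0 :> R by rewrite pnatr_eq0.
    by rewrite /x; move: (n.+1%:R : R) n0 => k k0; field.
  apply: ler_wpM2l; first by apply: mulr_ge0 => //; exact: sqr_ge0.
  by have := expR_ge1Dx (- x); lra.
have cvf w : (f n w)%:E @[n --> \oo] --> (Y w ^+ 2)%:E.
  apply: cvg_EFin; first by apply: nearW.
  apply/cvgrPdist_le => /= e e0.
  have : Y w ^+ 4 * n.+1%:R^-1 @[n --> \oo] --> (0 : R).
    by rewrite -[X in _ --> X](mulr0 (Y w ^+ 4)); apply: cvgMr; exact: cvg_harmonic.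
  move/cvgrPdist_le => /(_ _ e0); apply: filterS => n /=.
  rewrite sub0r normrN => /(le_trans (ler_norm _)); apply: le_trans.
  have n0 : n.+1%:R != 0 :> R by rewrite pnatr_eq0.
  rewrite /f; set x := n.+1%:R^-1 * Y w.
  have -> : Y w ^+ 2 - 2 * n.+1%:R ^+ 2 * (1 - cos x) =
     2 * n.+1%:R ^+ 2 * (cos x - 1 + x ^+ 2 / 2).
    by rewrite /x; field.
  have n2 : 0 <= 2 * n.+1%:R ^+ 2 :> R by apply: mulr_ge0 => //; exact: sqr_ge0.
  rewrite normrM (ger0_norm n2).
  apply: le_trans (ler_wpM2l n2 (cos_taylor2 x)) _.
  have -> : 2 * n.+1%:R ^+ 2 * (x ^+ 4 / 2) = Y w ^+ 4 * (n.+1%:R ^+ 2)^-1.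
    by rewrite /x; field.
  apply: ler_wpM2l; first by rewrite -[4%N]/(2 * 2)%N exprM sqr_ge0.
  by rewrite lef_pV2 ?posrE ?exprn_gt0 ?ltr0Sn// expr2 ler_peMl ?ler1n ?ler0n.
have fat : (\int[Q]_w (Y w ^+ 2)%:E <= sigma2%:E)%E.
  have := @fatou _ _ _ Q setT measurableT (fun n w => (f n w)%:E).
  have -> : (fun w => limn_einf ((fun n w => (f n w)%:E) ^~ w)) = (fun w => (Y w ^+ 2)%:E).
    apply/funext => w; rewrite is_cvg_limn_einfE; first exact: cvg_lim (cvf w).
    by apply/cvg_ex; exists (Y w ^+ 2)%:E; exact: cvf.
  move=> H; apply: le_trans (H _ _) _.
  - by move=> n; apply/measurable_EFinP; exact: mf.
  - by move=> n x _; rewrite lee_fin.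
  - apply: le_trans (limn_einf_sup _) _; apply: limn_esup_le.
    by apply: nearW => n; exact: intf.
have isq : Q.-integrable setT (EFin \o (fun w => Y w ^+ 2)).
  apply/integrableP; split.
    by apply/measurable_EFinP; exact: measurable_funX.
  apply: le_lt_trans (ltry sigma2).
  apply: le_trans fat; rewrite le_eqVlt; apply/orP; left; apply/eqP.
  by apply: eq_integral => w _ /=; rewrite ger0_norm// sqr_ge0.
split=> //; rewrite -lee_fin /Rintegral fineK//; exact: integrable_fin_num.
Qed.

End centered_normal.

(** * Trigonometric polynomials and Gaussian vectors *)

Section trigonometric_polynomials.
Context {R : realType}.

Definition dotp (D : nat) (u y : nat -> R) : R := \sum_(k < D) u k * y k.

Definition qform (D : nat) (Sig : nat -> nat -> R) (u : nat -> R) : R :=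
  \sum_(i < D) \sum_(j < D) u i * u j * Sig i j.

(** The linear span of cosines of affine forms, inductive so that a property stable under linear
    combinations need only be checked on a single cosine. By [trig_mul] the span is an algebra. *)
Inductive trig (D : nat) : ((nat -> R) -> R) -> Prop :=
| trig_cos u b : trig D (fun y => cos (dotp D u y + b))
| trig_add f g : trig D f -> trig D g -> trig D (fun y => f y + g y)
| trig_scale c f : trig D f -> trig D (fun y => c * f y).

Lemma dotpDl D u u' y : dotp D (fun k => u k + u' k) y = dotp D u y + dotp D u' y.
Proof. by rewrite /dotp -big_split/=; apply: eq_bigr => i _; rewrite mulrDl. Qed.

Lemma dotpZl D c u y : dotp D (fun k => c * u k) y = c * dotp D u y.
Proof. by rewrite /dotp mulr_sumr; apply: eq_bigr => i _; rewrite mulrA. Qed.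

Lemma dotpDr D u y y' : dotp D u (fun k => y k + y' k) = dotp D u y + dotp D u y'.
Proof. by rewrite /dotp -big_split/=; apply: eq_bigr => i _; rewrite mulrDr. Qed.

Lemma dotpZr D c u y : dotp D u (fun k => c * y k) = c * dotp D u y.
Proof. by rewrite /dotp mulr_sumr; apply: eq_bigr => i _; rewrite mulrCA. Qed.

Lemma trig_cst D c : trig D (fun=> c).
Proof.
rewrite (_ : (fun=> c) = (fun y => c * cos (dotp D (fun=> 0) y + 0))).
  by apply: trig_scale; exact: trig_cos.
apply/funext => y; rewrite /dotp big1 ?addr0 ?cos0 ?mulr1// => i _.
by rewrite mul0r.
Qed.

Lemma trig_sin_coord D (a : R) k : (k < D)%N -> trig D (fun y => sin (a * y k)).
Proof.
move=> kD.
rewrite (_ : (fun y => _) = (fun y : nat -> R =>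
   cos (dotp D (fun i => (i == k)%:R * a) y + - (pi / 2)))); first exact: trig_cos.
apply/funext => y; rewrite cosB cos_pihalf sin_pihalf mulr0 mulr1 add0r.
congr sin; rewrite /dotp (bigD1 (Ordinal kD))//= eqxx mul1r big1 ?addr0// => i ik.
rewrite (_ : (i == k :> nat) = false) ?mul0r//.
by apply/negbTE; apply: contra ik => /eqP ik; apply/eqP/val_inj.
Qed.

Lemma trig_mul D f g : trig D f -> trig D g -> trig D (fun y => f y * g y).
Proof.
move=> tf tg; elim: tf => [u b|f1 f2 _ IH1 _ IH2|c f1 _ IH].
- elim: tg => [u' b'|g1 g2 _ IH1 _ IH2|c g1 _ IH].
  + rewrite (_ : (fun y => _) = (fun y =>
      2^-1 * (cos (dotp D (fun k => u k + u' k) y + (b + b')) +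
              cos (dotp D (fun k => u k + -1 * u' k) y + (b - b'))))).
      by apply: trig_scale; apply: trig_add; exact: trig_cos.
    apply/funext => y; rewrite !dotpDl dotpZl.
    have -> : dotp D u y + dotp D u' y + (b + b') = (dotp D u y + b) + (dotp D u' y + b').
      by ring.
    have -> : dotp D u y + -1 * dotp D u' y + (b - b') = (dotp D u y + b) - (dotp D u' y + b').
      by ring.
    set A := dotp D u y + b; set B := dotp D u' y + b'.
    by rewrite [cos (A + B)]cosD [cos (A - B)]cosB; field.
  + rewrite (_ : (fun y => _) = (fun y => cos (dotp D u y + b) * g1 y +
      cos (dotp D u y + b) * g2 y)); first exact: trig_add.
    by apply/funext => y; rewrite mulrDr.
  + rewrite (_ : (fun y => _) = (fun y => c * (cos (dotp D u y + b) * g1 y))).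
      exact: trig_scale.
    by apply/funext => y; rewrite mulrCA.
- rewrite (_ : (fun y => _) = (fun y => f1 y * g y + f2 y * g y)); first exact: trig_add.
  by apply/funext => y; rewrite mulrDl.
- rewrite (_ : (fun y => _) = (fun y => c * (f1 y * g y))); first exact: trig_scale.
  by apply/funext => y; rewrite mulrA.
Qed.

Lemma trig_prod D (I : Type) (r : seq I) (F : I -> (nat -> R) -> R) :
  (forall i, trig D (F i)) -> trig D (fun y => \prod_(i <- r) F i y).
Proof.
move=> tF; elim: r => [|i r IH].
  by under eq_fun do rewrite big_nil; exact: trig_cst.
by under eq_fun do rewrite big_cons; exact: trig_mul.
Qed.

Lemma trig_sum D (I : Type) (r : seq I) (F : I -> (nat -> R) -> R) :
  (forall i, trig D (F i)) -> trig D (fun y => \sum_(i <- r) F i y).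
Proof.
move=> tF; elim: r => [|i r IH].
  by under eq_fun do rewrite big_nil; exact: trig_cst.
by under eq_fun do rewrite big_cons; exact: trig_add.
Qed.

Lemma trig_bounded D f : trig D f -> exists M, forall y, `|f y| <= M.
Proof.
elim=> [u b|f1 f2 _ [M1 H1] _ [M2 H2]|c f1 _ [M H]].
- by exists 1 => y; rewrite ler_norml cos_geN1 cos_le1.
- by exists (M1 + M2) => y; apply: le_trans (ler_normD _ _) _; exact: lerD.
- by exists (`|c| * M) => y; rewrite normrM ler_wpM2l.
Qed.

End trigonometric_polynomials.

(** * Gaussian vectors: second moments and shifts *)

Section gaussian_vectors.
Context {R : realType} {d : measure_display} {T : measurableType d}.
Variables (Q : probability T R) (D : nat) (g : nat -> T -> R) (Sig : nat -> nat -> R).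
Hypothesis gv : gaussian_vector Q D g Sig.
Hypothesis psd : forall u, 0 <= qform D Sig u.
Hypothesis symSig : forall i j, Sig i j = Sig j i.

Local Notation gw w := (g ^~ w).

Lemma gaussian_cos u b :
  \int[Q]_w cos (dotp D u (gw w) + b) = cos b * expR (- (qform D Sig u / 2)).
Proof.
have := centered_normal_cos 1 b (psd u) (gv u).
rewrite expr1n mulr1 => <-.
by apply: eq_Rintegral => w _; rewrite mul1r.
Qed.

Lemma gaussian_sqr u :
  Q.-integrable setT (EFin \o (fun w => dotp D u (gw w) ^+ 2)) /\
  \int[Q]_w (dotp D u (gw w) ^+ 2) <= qform D Sig u.
Proof. exact: centered_normal_sqr (psd u) (gv u). Qed.

Lemma gaussian_measurable_dotp u : measurable_fun setT (fun w => dotp D u (gw w)).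
Proof. by case: (gv u). Qed.

Lemma dotp_delta k (y : nat -> R) : (k < D)%N -> dotp D (fun i => (i == k)%:R) y = y k.
Proof.
move=> kD; rewrite /dotp (bigD1 (Ordinal kD))//= eqxx mul1r big1 ?addr0// => i ik.
rewrite (_ : (i == k :> nat) = false) ?mul0r//.
by apply/negbTE; apply: contra ik => /eqP ik; apply/eqP/val_inj.
Qed.

Lemma qform_delta k : (k < D)%N -> qform D Sig (fun i => (i == k)%:R) = Sig k k.
Proof.
move=> kD; rewrite /qform (bigD1 (Ordinal kD))//= [X in _ + X]big1 ?addr0.
  rewrite (bigD1 (Ordinal kD))//= eqxx !mul1r big1 ?addr0// => i ik.
  rewrite (_ : (i == k :> nat) = false) ?mulr0 ?mul0r//.
  by apply/negbTE; apply: contra ik => /eqP ik; apply/eqP/val_inj.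
move=> i ik; rewrite big1// => j _.
rewrite (_ : (i == k :> nat) = false) ?mul0r ?mul0r//.
by apply/negbTE; apply: contra ik => /eqP ik; apply/eqP/val_inj.
Qed.

Lemma gaussian_coord_sqr k : (k < D)%N ->
  Q.-integrable setT (EFin \o (fun w => g k w ^+ 2)) /\
  \int[Q]_w (g k w ^+ 2) <= Sig k k.
Proof.
move=> kD; have := gaussian_sqr (fun i => (i == k)%:R).
rewrite qform_delta//.
have -> : (fun w => dotp D (fun i => (i == k)%:R) (gw w) ^+ 2) = (fun w => g k w ^+ 2).
  by apply/funext => w; rewrite dotp_delta.
by [].
Qed.

Lemma trig_measurable (c : nat -> R) (a : R) f : trig D f ->
  measurable_fun setT (fun w => f (fun k => g k w + a * c k)).
Proof.
elim=> [u b|f1 f2 _ H1 _ H2|r f1 _ H].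
- apply: (@measurableT_comp _ _ _ _ _ _ cos).
    by apply: continuous_measurable_fun; exact: continuous_cos.
  apply: measurable_funD => //.
  under eq_fun do rewrite dotpDr; apply: measurable_funD => //.
  exact: gaussian_measurable_dotp.
- exact: measurable_funD.
- exact: measurable_funM.
Qed.

Lemma trig_integrable (c : nat -> R) (a : R) f : trig D f ->
  Q.-integrable setT (EFin \o (fun w => f (fun k => g k w + a * c k))).
Proof.
move=> tf; have [M HM] := trig_bounded tf.
by apply: (@bounded_integrable _ _ _ Q _ M) => //; exact: trig_measurable.
Qed.

Section shift.
Variables e v : nat -> R.
Hypothesis ev : forall i, (i < D)%N -> e i = \sum_(j < D) Sig i j * v j.

(** The covariance of [Z] with the k-th coordinate is [e k], so the mean of [Z * f] is the
    derivative of the mean of [f] along the shift [e]. *)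
Let Z w := dotp D v (gw w).

Let mZ : measurable_fun setT Z. Proof. exact: gaussian_measurable_dotp. Qed.

Let iZ2 : Q.-integrable setT (EFin \o (fun w => Z w ^+ 2)).
Proof. exact: (gaussian_sqr v).1. Qed.

Let i1 : Q.-integrable setT (EFin \o (fun w : T => 1 : R)).
Proof. by apply: (@bounded_integrable _ _ _ Q _ 1) => // x; rewrite normr1. Qed.

Let normZ w : `|Z w| <= 1 + Z w ^+ 2.
Proof.
rewrite -(real_normK (num_real (Z w))).
by have := sqr_ge0 (`|Z w| - 1); rewrite sqrrB1; have := sqr_ge0 `|Z w|; lra.
Qed.

Let iZf (f : T -> R) (M : R) : measurable_fun setT f -> (forall x, `|f x| <= M) ->
  Q.-integrable setT (EFin \o (fun w => Z w * f w)).
Proof.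
move=> mf fM.
apply: (@le_integrable _ _ _ Q setT measurableT _ (EFin \o (fun w => M * (1 + Z w ^+ 2)))).
- by apply/measurable_EFinP; exact: measurable_funM.
- move=> w _ /=; rewrite lee_fin normrM mulrC.
  apply: le_trans (ler_norm _); apply: ler_pM => //.
- by apply: RintegrableZl; exact: RintegrableD.
Qed.

Lemma qform_line u t :
  qform D Sig (fun k => u k + t * v k) = qform D Sig u + 2 * t * dotp D u e + t ^+ 2 * qform D Sig v.
Proof.
have duE : dotp D u e = \sum_(i < D) \sum_(j < D) u i * v j * Sig i j.
  apply: eq_bigr => i _; rewrite ev// mulr_sumr.
  by apply: eq_bigr => j _; rewrite mulrAC mulrA.
have duE' : dotp D u e = \sum_(i < D) \sum_(j < D) u j * v i * Sig i j.
  rewrite duE exchange_big; apply: eq_bigr => i _; apply: eq_bigr => j _.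
  by rewrite symSig.
have -> : 2 * t * dotp D u e = t * dotp D u e + t * dotp D u e by ring.
rewrite {1}duE duE' /qform !mulr_sumr -!big_split; apply: eq_bigr => i _ /=.
rewrite !mulr_sumr -!big_split; apply: eq_bigr => j _ /=; ring.
Qed.

(** The function [F] is differentiated at 0 in two ways: on the explicit formula of [gaussian_cos],
    and under the integral. The phase pi / 2 turns the sine produced by differentiation back into
    the wanted cosine. *)
Lemma gaussian_stein_cos u b :
  \int[Q]_w (Z w * cos (dotp D u (gw w) + b)) =
  - dotp D u e * sin b * expR (- (qform D Sig u / 2)).
Proof.
pose F t := \int[Q]_w cos (dotp D (fun k => u k + t * v k) (gw w) + (b + pi / 2)).
have FE t : F t = - sin b *
    expR (- ((qform D Sig u + 2 * t * dotp D u e + t ^+ 2 * qform D Sig v) / 2)).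
  by rewrite /F gaussian_cos qform_line cosD cos_pihalf sin_pihalf mulr0 mulr1 add0r.
have d1 : is_derive (0 : R) 1 F (dotp D u e * sin b * expR (- (qform D Sig u / 2))).
  have -> : F = (fun t => - sin b *
    expR (- ((qform D Sig u + 2 * t * dotp D u e + t ^+ 2 * qform D Sig v) / 2))).
    by apply/funext => t; rewrite FE.
  apply: is_derive_eq; rewrite /GRing.scale/=.
  rewrite !(mulr0, addr0, mul0r, add0r, mulr1, mulrN, mulNr, opprK, expr1, expr0n, oppr0)/=.
  by field.
have d2 : is_derive (0 : R) 1 F (- \int[Q]_w (Z w * cos (dotp D u (gw w) + b))).
  apply: (@is_derive_quadratic_bound _ _ _ _ (2 * \int[Q]_w (Z w ^+ 2))) => t.
  have mc r : measurable_fun setT (fun w => cos (dotp D u (gw w) + r)).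
    apply: (@measurableT_comp _ _ _ _ _ _ cos).
      by apply: continuous_measurable_fun; exact: continuous_cos.
    by apply: measurable_funD => //; exact: gaussian_measurable_dotp.
  have b1 r : `|cos r| <= 1 :> R by rewrite ler_norml cos_geN1 cos_le1.
  have ic t' r : Q.-integrable setT (EFin \o
      (fun w => cos (dotp D (fun k => u k + t' * v k) (gw w) + r))).
    apply: (@bounded_integrable _ _ _ Q _ 1) => //.
    apply: (@measurableT_comp _ _ _ _ _ _ cos).
      by apply: continuous_measurable_fun; exact: continuous_cos.
    by apply: measurable_funD => //; exact: gaussian_measurable_dotp.
  have iZc : Q.-integrable setT (EFin \o (fun w => Z w * cos (dotp D u (gw w) + b))).
    exact: (@iZf _ 1).
  rewrite add0r mulrN opprK /F -RintegralZl// -RintegralB// -RintegralD//; last first.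
  - exact: RintegrableZl.
  - exact: RintegrableB.
  rewrite mulrAC -RintegralZl//.
  have iall : Q.-integrable setT (EFin \o (fun w =>
     cos (dotp D (fun k => u k + t * v k) (gw w) + (b + pi / 2)) -
     cos (dotp D (fun k => u k + 0 * v k) (gw w) + (b + pi / 2)) +
     t * (Z w * cos (dotp D u (gw w) + b)))).
    by apply: RintegrableD; [exact: RintegrableB|exact: RintegrableZl].
  apply: le_trans (le_normr_Rintegral _ _) _ => //.
  apply: le_Rintegral => //.
  - exact: Rintegrable_norm.
  - exact: RintegrableZl.
  - move=> w _; rewrite !dotpDl !dotpZl mul0r addr0 -/(Z w).
    set A := dotp D u (gw w).
    have -> : A + t * Z w + (b + pi / 2) = (A + b + pi / 2) + t * Z w by ring.
    have -> : A + (b + pi / 2) = A + b + pi / 2 by ring.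
    have <- : sin (A + b + pi / 2) = cos (A + b).
      by rewrite sinD cos_pihalf sin_pihalf mulr0 mulr1 add0r.
    rewrite mulrA; apply: le_trans (cos_taylor1_le _ _) _.
    by rewrite exprMn mulrA.
have := @derive_val _ _ _ _ _ _ _ d1; have := @derive_val _ _ _ _ _ _ _ d2.
by move=> -> e12; rewrite !mulNr -e12 opprK.
Qed.

Lemma trig_shift_derive f : trig D f -> forall x : R,
  is_derive x 1 (fun t => \int[Q]_w f (fun k => g k w + t * e k))
    (\int[Q]_w (Z w * f (fun k => g k w + x * e k))).
Proof.
move=> tf; elim: tf => [u b|f1 f2 t1 IH1 t2 IH2|c f1 t1 IH] x.
- have E t : \int[Q]_w cos (dotp D u (fun k => g k w + t * e k) + b) =
      cos (t * dotp D u e + b) * expR (- (qform D Sig u / 2)).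
    rewrite -gaussian_cos; apply: eq_Rintegral => w _.
    by rewrite dotpDr dotpZr addrA.
  have -> : (fun t => \int[Q]_w cos (dotp D u (fun k => g k w + t * e k) + b)) =
      (fun t => cos (t * dotp D u e + b) * expR (- (qform D Sig u / 2))).
    by apply/funext => t; exact: E.
  have -> : \int[Q]_w (Z w * cos (dotp D u (fun k => g k w + x * e k) + b)) =
     - dotp D u e * sin (x * dotp D u e + b) * expR (- (qform D Sig u / 2)).
    rewrite -gaussian_stein_cos; apply: eq_Rintegral => w _.
    by rewrite dotpDr dotpZr addrA.
  by apply: is_derive_eq; rewrite /GRing.scale/=; ring.
- have [M1 H1] := trig_bounded t1; have [M2 H2] := trig_bounded t2.
  have -> : (fun t => \int[Q]_w (f1 (fun k => g k w + t * e k) + f2 (fun k => g k w + t * e k))) =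
     (fun t => \int[Q]_w f1 (fun k => g k w + t * e k)) +
     (fun t => \int[Q]_w f2 (fun k => g k w + t * e k)).
    by apply/funext => t; rewrite /= RintegralD//; exact: trig_integrable.
  have -> : \int[Q]_w (Z w * (f1 (fun k => g k w + x * e k) + f2 (fun k => g k w + x * e k))) =
     \int[Q]_w (Z w * f1 (fun k => g k w + x * e k)) +
     \int[Q]_w (Z w * f2 (fun k => g k w + x * e k)).
    rewrite -RintegralD//; first by apply: eq_Rintegral => w _; rewrite mulrDr.
    - by apply: (@iZf _ M1) => //; exact: trig_measurable.
    - by apply: (@iZf _ M2) => //; exact: trig_measurable.
  exact: is_deriveD.
- have [M1 H1] := trig_bounded t1.
  have -> : (fun t => \int[Q]_w (c * f1 (fun k => g k w + t * e k))) =
     c \*: (fun t => \int[Q]_w f1 (fun k => g k w + t * e k)).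
    by apply/funext => t; rewrite /= RintegralZl//; exact: trig_integrable.
  have -> : \int[Q]_w (Z w * (c * f1 (fun k => g k w + x * e k))) =
     c *: \int[Q]_w (Z w * f1 (fun k => g k w + x * e k)).
    rewrite /GRing.scale/= -RintegralZl//; first by apply: eq_Rintegral => w _; rewrite mulrCA.
    by apply: (@iZf _ M1) => //; exact: trig_measurable.
  exact: is_deriveZ.
Qed.

(** The derivative in t is the mean of [Z * f], at most the mean of 1 + Z^2 in absolute value.
    Neither the degree nor the Lipschitz constant of [f] enters, so the smoothing scale does not
    spoil the bound. *)
Lemma trig_shift f (t : R) : trig D f -> (forall y, `|f y| <= 1) ->
  `|\int[Q]_w f (fun k => g k w + t * e k) - \int[Q]_w f (gw w)| <=
  (1 + qform D Sig v) * `|t|.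
Proof.
move=> tf f1.
have := mean_value_bound (trig_shift_derive tf).
have -> : \int[Q]_w f (gw w) = \int[Q]_w f (fun k => g k w + 0 * e k).
  apply: eq_Rintegral => w _; congr f; apply/funext => k.
  by rewrite mul0r addr0.
apply => y _.
have mf := trig_measurable e y tf.
have iZ : Q.-integrable setT (EFin \o (fun w => Z w * f (fun k => g k w + y * e k))).
  exact: (@iZf _ 1).
apply: le_trans (le_normr_Rintegral _ _) _ => //.
have -> : 1 + qform D Sig v = \int[Q]_w (1 : R) + qform D Sig v.
  by rewrite Rintegral_cst// [X in fine X]probability_setT mulr1.
apply: le_trans (_ : _ <= \int[Q]_w (1 : R) + \int[Q]_w (Z w ^+ 2)) _; last first.
  by rewrite lerD2l; exact: (gaussian_sqr v).2.
rewrite -RintegralD//; apply: le_Rintegral => //.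
- exact: Rintegrable_norm.
- exact: RintegrableD.
- move=> w _; rewrite normrM; apply: le_trans (normZ w).
  by rewrite ler_piMr.
Qed.

End shift.
End gaussian_vectors.

(** * Sums of independent variables and Bernstein approximation *)

Section iid_expectation.
Context {R : realType} {J : finType}.
Variable w : J -> R.

(** Expectation over n independent draws of law [w]. The argument [F] takes sequences, not tuples,
    so that [ExS] can condition on the first draw. *)
Definition Ex n (F : seq J -> R) : R :=
  \sum_(t : n.-tuple J) (\prod_(j <- t) w j) * F t.

Lemma Ex0 F : Ex 0 F = F [::].
Proof.
rewrite /Ex (bigD1 [tuple])//= big_nil mul1r big1 ?addr0// => t.
by move/negP; case; apply/eqP; exact: tuple0.
Qed.

Lemma ExS n F : Ex n.+1 F = \sum_j w j * Ex n (fun s => F (j :: s)).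
Proof.
rewrite /Ex.
under [RHS]eq_bigr do rewrite mulr_sumr.
rewrite pair_big/=.
rewrite (reindex (fun p : J * n.-tuple J => [tuple of p.1 :: p.2]))/=; last first.
  exists (fun t : n.+1.-tuple J => (thead t, [tuple of behead t])).
    by move=> [j t] _ /=; congr (_, _); exact: val_inj.
  by move=> t _; rewrite -tuple_eta.
by apply: eq_bigr => -[j t] _ /=; rewrite big_cons mulrA.
Qed.

Lemma eq_Ex n F G : (forall s, F s = G s) -> Ex n F = Ex n G.
Proof. by move=> FG; apply: eq_bigr => t _; rewrite FG. Qed.

Lemma ExD n F G : Ex n (fun s => F s + G s) = Ex n F + Ex n G.
Proof. by rewrite /Ex -big_split/=; apply: eq_bigr => t _; rewrite mulrDr. Qed.

Lemma ExZ n c F : Ex n (fun s => c * F s) = c * Ex n F.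
Proof. by rewrite /Ex mulr_sumr; apply: eq_bigr => t _; rewrite mulrCA. Qed.

Lemma Ex_sum n (I : Type) (r : seq I) (F : I -> seq J -> R) :
  Ex n (fun s => \sum_(i <- r) F i s) = \sum_(i <- r) Ex n (F i).
Proof.
rewrite /Ex exchange_big/=; apply: eq_bigr => t _.
by rewrite mulr_sumr.
Qed.

Hypothesis w0 : forall j, 0 <= w j.
Hypothesis w1 : \sum_j w j = 1.

Lemma Ex_weight_ge0 (s : seq J) : 0 <= \prod_(j <- s) w j.
Proof. by apply: prodr_ge0. Qed.

Lemma Ex_le n (F G : seq J -> R) :
  (forall t : n.-tuple J, F t <= G t) -> Ex n F <= Ex n G.
Proof.
by move=> FG; apply: ler_sum => t _; apply: ler_wpM2l => //; exact: Ex_weight_ge0.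
Qed.

Lemma Ex_cst n c : Ex n (fun=> c) = c.
Proof.
elim: n => [|n IH]; first exact: Ex0.
by rewrite ExS; under eq_bigr do rewrite IH; rewrite -mulr_suml w1 mul1r.
Qed.

Lemma Ex_affine n a b F : Ex n (fun s => a * F s + b) = a * Ex n F + b.
Proof. by rewrite (ExD n (fun s => a * F s) (fun=> b)) ExZ Ex_cst. Qed.

Lemma Ex_norm n F : `|Ex n F| <= Ex n (fun s => `|F s|).
Proof.
apply: le_trans (ler_norm_sum _ _ _) _; apply: ler_sum => t _.
by rewrite normrM ger0_norm// Ex_weight_ge0.
Qed.

Variable c : J -> R.
Hypothesis c0 : \sum_j w j * c j = 0.

(** The starting point [x] is what the induction on n moves; the cross terms vanish because [c] is
    centered. *)
Lemma Ex_sqr n x :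
  Ex n (fun s => (x + \sum_(j <- s) c j) ^+ 2) = x ^+ 2 + n%:R * \sum_j w j * c j ^+ 2.
Proof.
elim: n x => [|n IH] x; first by rewrite Ex0 big_nil addr0 mul0r addr0.
rewrite ExS.
under eq_bigr => j _.
  rewrite (@eq_Ex _ _ (fun s => ((x + c j) + \sum_(i <- s) c i) ^+ 2)); last first.
    by move=> s; rewrite big_cons addrA.
  rewrite IH.
  have -> : w j * ((x + c j) ^+ 2 + n%:R * \sum_j0 w j0 * c j0 ^+ 2) =
    (x ^+ 2 + n%:R * \sum_j0 w j0 * c j0 ^+ 2) * w j + (2 * x) * (w j * c j) + w j * c j ^+ 2
    by ring.
  over.
rewrite !big_split/= -!mulr_sumr w1 c0 mulr0 mulr1 addr0 -natr1; ring.
Qed.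

Let s2 := \sum_j w j * c j ^+ 2.
Let M3 := \sum_j w j * `|c j| ^+ 3.
Let M4 := \sum_j w j * c j ^+ 4.

Let s2_ge0 : 0 <= s2.
Proof. by apply: sumr_ge0 => j _; rewrite mulr_ge0// sqr_ge0. Qed.

(** The subtracted term is the mean of the cosine for a Gaussian step of variance s2 a^2. The first
    two moments agree, so only remainders of orders 3 and 4 in [a] survive. *)
Lemma cos_step (a b : R) : 0 <= a ->
  `|\sum_j w j * cos (b + a * c j) - expR (- (s2 * a ^+ 2 / 2)) * cos b| <=
  a ^+ 3 * (M3 / 2) + a ^+ 4 * (M4 / 2 + s2 ^+ 2 / 4).
Proof.
move=> a0; set th := expR _.
have -> : \sum_j w j * cos (b + a * c j) - th * cos b =
  \sum_j w j * (cos (b + a * c j) - cos b + (a * c j) * sin b + (a * c j) ^+ 2 / 2 * cos b)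
  - (th - 1 + s2 * a ^+ 2 / 2) * cos b.
  have -> : \sum_j w j * (cos (b + a * c j) - cos b + (a * c j) * sin b + (a * c j) ^+ 2 / 2 * cos b)
    = \sum_j (w j * cos (b + a * c j) + (- cos b) * w j + (a * sin b) * (w j * c j) +
       (a ^+ 2 / 2 * cos b) * (w j * c j ^+ 2)).
    by apply: eq_bigr => j _; ring.
  rewrite !big_split/= -!mulr_sumr w1 c0 -/s2; ring.
apply: le_trans (ler_normB _ _) _.
have cb : `|cos b| <= 1 by rewrite ler_norml cos_geN1 cos_le1.
have h1 : `|(th - 1 + s2 * a ^+ 2 / 2) * cos b| <= a ^+ 4 * (s2 ^+ 2 / 4).
  rewrite normrM; apply: le_trans (ler_pM _ _ (expRN_taylor1 _) cb) _ => //.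
    by rewrite divr_ge0// mulr_ge0// sqr_ge0.
  by rewrite le_eqVlt; apply/orP; left; apply/eqP; field.
have h2 : `|\sum_j w j * (cos (b + a * c j) - cos b + (a * c j) * sin b + (a * c j) ^+ 2 / 2 * cos b)|
   <= a ^+ 3 * (M3 / 2) + a ^+ 4 * (M4 / 2).
  apply: le_trans (ler_norm_sum _ _ _) _.
  have -> : a ^+ 3 * (M3 / 2) + a ^+ 4 * (M4 / 2) =
     \sum_j w j * (`|a * c j| ^+ 3 / 2 + (a * c j) ^+ 4 / 2).
    have -> : \sum_j w j * (`|a * c j| ^+ 3 / 2 + (a * c j) ^+ 4 / 2) =
      \sum_j ((a ^+ 3 / 2) * (w j * `|c j| ^+ 3) + (a ^+ 4 / 2) * (w j * c j ^+ 4)).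
      by apply: eq_bigr => j _; rewrite normrM (ger0_norm a0); ring.
    rewrite big_split/= -!mulr_sumr -/M3 -/M4; ring.
  apply: ler_sum => j _; rewrite normrM (ger0_norm (w0 j)) ler_wpM2l//.
  exact: cos_taylor2_le.
by apply: le_trans (lerD h2 h1) _; rewrite mulrDr addrA.
Qed.

(** Steps are replaced by Gaussian ones one at a time; the errors merely add up since the factor
    [th] is at most 1. *)
Lemma Ex_cos_step (a : R) n b : 0 <= a ->
  `|Ex n (fun s => cos (b + a * \sum_(j <- s) c j)) -
     expR (- (s2 * a ^+ 2 / 2)) ^+ n * cos b| <=
  n%:R * (a ^+ 3 * (M3 / 2) + a ^+ 4 * (M4 / 2 + s2 ^+ 2 / 4)).
Proof.
move=> a0; set th := expR _; set ka := (X in _ <= _ * X).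
have th0 : 0 <= th by exact: expR_ge0.
have th1 : th <= 1.
  by rewrite /th -expR0 ler_expR oppr_le0 divr_ge0// mulr_ge0// sqr_ge0.
elim: n b => [|n IH] b.
  by rewrite Ex0 big_nil mulr0 addr0 expr0 mul1r subrr normr0 mul0r.
rewrite ExS.
have -> : \sum_j w j * Ex n (fun s => cos (b + a * \sum_(i <- j :: s) c i)) -
    th ^+ n.+1 * cos b =
  \sum_j w j * (Ex n (fun s => cos (b + a * c j + a * \sum_(i <- s) c i)) -
       th ^+ n * cos (b + a * c j)) +
  th ^+ n * (\sum_j w j * cos (b + a * c j) - th * cos b).
  rewrite mulrBr mulr_sumr exprSr mulrA addrA; congr (_ - _).
  rewrite -big_split/=; apply: eq_bigr => j _.
  rewrite (@eq_Ex _ _ (fun s => cos (b + a * c j + a * \sum_(i <- s) c i))); last first.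
    by move=> s; rewrite big_cons mulrDr addrA.
  ring.
apply: le_trans (ler_normD _ _) _; rewrite -natr1 mulrDl mul1r; apply: lerD.
  apply: le_trans (ler_norm_sum _ _ _) _.
  apply: le_trans (_ : _ <= \sum_j w j * (n%:R * ka)) _; last by rewrite -mulr_suml w1 mul1r.
  by apply: ler_sum => j _; rewrite normrM (ger0_norm (w0 j)) ler_wpM2l.
rewrite normrM ger0_norm ?exprn_ge0//.
apply: le_trans (_ : _ <= 1 * ka) _; last by rewrite mul1r.
by apply: ler_pM; rewrite ?exprn_ge0 ?exprn_ile1//; exact: cos_step.
Qed.

(* Lindeberg's argument for the characteristic function, with an explicit rate. *)
Lemma Ex_cos_clt n b : (0 < n)%N ->
  `|Ex n (fun s => cos (b + (Num.sqrt n%:R)^-1 * \sum_(j <- s) c j)) -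
     cos b * expR (- (s2 / 2))| <=
  (M3 / 2 + M4 / 2 + s2 ^+ 2 / 4) / Num.sqrt n%:R.
Proof.
move=> n0; set r := Num.sqrt n%:R.
have nR : 0 < n%:R :> R by rewrite ltr0n.
have r0 : 0 < r by rewrite sqrtr_gt0.
have rn : r ^+ 2 = n%:R by rewrite sqr_sqrtr// ltW.
have r1 : 1 <= r.
  by rewrite -(@ler_pXn2r _ 2) ?nnegrE ?(ltW r0)// rn expr1n ler1n.
have := @Ex_cos_step r^-1 n b; rewrite invr_ge0 => /(_ (ltW r0)).
have -> : expR (- (s2 * r^-1 ^+ 2 / 2)) ^+ n = expR (- (s2 / 2)).
  rewrite -expRM_natl; congr expR; rewrite -rn; field; exact: lt0r_neq0.
rewrite [expR _ * _]mulrC; move=> H; apply: le_trans H _.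
have -> : n%:R * (r^-1 ^+ 3 * (M3 / 2) + r^-1 ^+ 4 * (M4 / 2 + s2 ^+ 2 / 4)) =
   (M3 / 2) / r + (M4 / 2 + s2 ^+ 2 / 4) * (r ^+ 2)^-1.
  rewrite -rn; field; exact: lt0r_neq0.
rewrite -addrA [in leRHS]mulrDl lerD2l; apply: ler_wpM2l.
  apply: addr_ge0; apply: divr_ge0 => //; last exact: sqr_ge0.
  apply: sumr_ge0 => j _; rewrite mulr_ge0// -[4%N]/(2 * 2)%N exprM sqr_ge0//.
by rewrite lef_pV2 ?posrE ?exprn_gt0// expr2 ler_peMl// ltW.
Qed.

End iid_expectation.

(** * Bernstein approximation in sine variables *)

Section bernstein_trig.
Context {R : realType}.
Variables (D N : nat) (a : R).
Hypothesis a0 : 0 < a.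
Hypothesis N0 : (0 < N)%N.

Definition sgb (b : bool) : R := if b then 1 else -1.
(** The law of a random sign with mean [sin x]. *)
Definition bitw (x : R) (b : bool) : R := (1 + sgb b * sin x) / 2.

Lemma bitw_ge0 x b : 0 <= bitw x b.
Proof.
rewrite /bitw /sgb; have := sin_geN1 x; have := sin_le1 x.
by case: b => h1 h2; rewrite divr_ge0//; lra.
Qed.

Lemma sum_bitw x : \sum_b bitw x b = 1.
Proof. by rewrite big_bool /bitw /sgb /=; field. Qed.

(** Probability of an outcome of independent signs, N for each coordinate k, with mean sin (a y_k).
    Recording all signs rather than their counts replaces binomial coefficients by plain
    products. *)
Definition gridw (y : nat -> R) (f : {ffun 'I_D -> N.-tuple bool}) : R :=
  \prod_(k < D) \prod_(b <- f k) bitw (a * y k) b.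

(** The average sign divided by [a], close to sin (a y_k) / a and so to y_k. It does not involve y:
    in [bern] the function enters only through coefficients of fixed trigonometric polynomials. *)
Definition gridpt (f : {ffun 'I_D -> N.-tuple bool}) (k : nat) : R :=
  if insub k is Some k' then (\sum_(b <- f k') sgb b) / (N%:R * a) else 0.

(* Bernstein polynomial of [phi] in the variables (1 + sin (a * y k)) / 2 *)
Definition bern (phi : (nat -> R) -> R) (y : nat -> R) : R :=
  \sum_f gridw y f * phi (gridpt f).

Lemma gridw_ge0 y f : 0 <= gridw y f.
Proof. by apply: prodr_ge0 => k _; apply: prodr_ge0 => b _; exact: bitw_ge0. Qed.

Lemma gridw_marginal y (k0 : 'I_D) (h : N.-tuple bool -> R) :
  \sum_f gridw y f * h (f k0) =
  \sum_(t : N.-tuple bool) (\prod_(b <- t) bitw (a * y k0) b) * h t.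
Proof.
pose F (k : 'I_D) (t : N.-tuple bool) : R :=
  (\prod_(b <- t) bitw (a * y k) b) * (if k == k0 then h t else 1).
transitivity (\sum_(f : {ffun 'I_D -> N.-tuple bool}) \prod_(k < D) F k (f k)).
  apply: eq_bigr => f _; rewrite /F big_split/=; congr (_ * _).
  rewrite (bigD1 k0)//= eqxx big1 ?mulr1// => i /negbTE ->//.
rewrite -bigA_distr_bigA (bigD1 k0)//= [X in _ * X]big1 ?mulr1.
  by apply: eq_bigr => t _; rewrite /F eqxx.
move=> k kk0; rewrite -[RHS](Ex_cst (sum_bitw (a * y k)) N 1).
by apply: eq_bigr => t _; rewrite /F (negbTE kk0).
Qed.

Lemma sum_gridw y : \sum_f gridw y f = 1.
Proof.
rewrite /gridw -(bigA_distr_bigA (fun (k : 'I_D) (t : N.-tuple bool) =>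
  \prod_(b <- t) bitw (a * y k) b)) big1// => k _.
rewrite -[RHS](Ex_cst (sum_bitw (a * y k)) N 1).
by apply: eq_bigr => t _; rewrite mulr1.
Qed.

Lemma trig_gridw f : trig D (gridw ^~ f).
Proof.
apply: trig_prod => k; apply: trig_prod => b.
rewrite (_ : (fun y => _) = (fun y : nat -> R => 2^-1 * (1 + sgb b * sin (a * y k)))).
  apply: trig_scale; apply: trig_add; first exact: trig_cst.
  by apply: trig_scale; exact: trig_sin_coord.
by apply/funext => y; rewrite /bitw mulrC.
Qed.

Lemma trig_bern phi : trig D (bern phi).
Proof.
apply: trig_sum => f; under eq_fun do rewrite mulrC.
by apply: trig_scale; exact: trig_gridw.
Qed.

Lemma bern_bounded phi : (forall y, `|phi y| <= 1) -> forall y, `|bern phi y| <= 1.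
Proof.
move=> phi1 y; apply: le_trans (ler_norm_sum _ _ _) _.
rewrite -[leRHS](sum_gridw y); apply: ler_sum => f _.
by rewrite normrM (ger0_norm (gridw_ge0 _ _)) ler_piMr// gridw_ge0.
Qed.

(** The first term is the bias of sin (a x) / a, the second the standard deviation of an average of
    N signs, divided by [a]. *)
Lemma grid_coord_dist (x : R) :
  Ex (bitw (a * x)) N (fun s => `|(\sum_(b <- s) sgb b) / (N%:R * a) - x|) <=
  a * x ^+ 2 + (a * Num.sqrt N%:R)^-1.
Proof.
set w := bitw (a * x); set s := sin (a * x); set r := Num.sqrt N%:R.
have NR : 0 < N%:R :> R by rewrite ltr0n.
have r0 : 0 < r by rewrite sqrtr_gt0.
have rN : r ^+ 2 = N%:R by rewrite sqr_sqrtr// ltW.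
have w0 := @bitw_ge0 (a * x); have w1 := sum_bitw (a * x).
have sE : `|s / a - x| <= a * x ^+ 2.
  have -> : s / a - x = (s - a * x) / a by field; exact: lt0r_neq0.
  rewrite normrM normfV (gtr0_norm a0) ler_pdivrMr//.
  by apply: le_trans (sin_sub_le2 _) _; rewrite exprMn; lra.
have c0 : \sum_b w b * (sgb b - s) = 0.
  by rewrite big_bool /w /bitw /sgb -/s /=; field.
have step : forall t : N.-tuple bool,
  `|(\sum_(b <- t) sgb b) / (N%:R * a) - x| <=
  (N%:R * a)^-1 * (2^-1 * r + (2 * r)^-1 * (0 + \sum_(b <- t) (sgb b - s)) ^+ 2) + a * x ^+ 2.
  move=> t; set X := \sum_(b <- t) (sgb b - s).
  have XE : \sum_(b <- t) sgb b = X + N%:R * s.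
    rewrite /X big_split/= sumrN big_const_seq count_predT size_tuple.
    by rewrite iter_addr_0 mulr_natl subrK.
  have -> : (\sum_(b <- t) sgb b) / (N%:R * a) - x = (N%:R * a)^-1 * X + (s / a - x).
    by rewrite XE; field; rewrite !lt0r_neq0.
  apply: le_trans (ler_normD _ _) _; apply: lerD => //.
  have Na : 0 <= (N%:R * a)^-1 by rewrite invr_ge0 mulr_ge0// ltW.
  rewrite normrM (ger0_norm Na) add0r ler_wpM2l//.
  (* Young's inequality |X| <= (r^2 + X^2) / (2 r) takes the place of Cauchy-Schwarz; r = sqrt N
     balances it, as X^2 has mean at most N. *)
  have -> : 2^-1 * r + (2 * r)^-1 * X ^+ 2 = (r ^+ 2 + `|X| ^+ 2) / (2 * r).
    by rewrite real_normK ?num_real//; field; exact: lt0r_neq0.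
  rewrite ler_pdivlMr ?mulr_gt0//.
  by have := sqr_ge0 (r - `|X|); rewrite sqrrB; lra.
apply: le_trans (@Ex_le _ _ _ w0 N _ (fun t => (N%:R * a)^-1 * (2^-1 * r +
  (2 * r)^-1 * (0 + \sum_(b <- t) (sgb b - s)) ^+ 2) + a * x ^+ 2) step) _.
rewrite (Ex_affine w1 N (N%:R * a)^-1 (a * x ^+ 2) (fun t => 2^-1 * r +
  (2 * r)^-1 * (0 + \sum_(b <- t) (sgb b - s)) ^+ 2)).
rewrite (@eq_Ex _ _ _ _ _ (fun t => (2 * r)^-1 * (0 + \sum_(b <- t) (sgb b - s)) ^+ 2 +
  2^-1 * r)); last by move=> t; rewrite addrC.
rewrite (Ex_affine w1 N (2 * r)^-1 (2^-1 * r)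
  (fun t => (0 + \sum_(b <- t) (sgb b - s)) ^+ 2)).
rewrite (@Ex_sqr _ _ _ w1 _ c0).
have -> : \sum_b w b * (sgb b - s) ^+ 2 = 1 - s ^+ 2.
  by rewrite big_bool /w /bitw /sgb -/s /=; field.
rewrite addrC lerD2l expr0n add0r [X in _ * X]addrC.
apply: le_trans (_ : _ <= (N%:R * a)^-1 * (2^-1 * r + (2 * r)^-1 * (N%:R * 1))) _.
  apply: ler_wpM2l; first by rewrite invr_ge0 mulr_ge0// ltW.
  rewrite lerD2l; apply: ler_wpM2l; first by rewrite invr_ge0 mulr_ge0// ltW.
  apply: ler_wpM2l; first exact: ltW.
  by rewrite lerBlDr lerDl sqr_ge0.
rewrite le_eqVlt; apply/orP; left; apply/eqP; rewrite -rN; field.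
by rewrite !lt0r_neq0.
Qed.

Lemma bern_approx (phi : (nat -> R) -> R) (L : R) : 0 <= L ->
  (forall y z : nat -> R, `|phi y - phi z| <= L * \sum_(k < D) `|y k - z k|) ->
  forall y : nat -> R, `|bern phi y - phi y| <=
    L * \sum_(k < D) (a * y k ^+ 2 + (a * Num.sqrt N%:R)^-1).
Proof.
move=> L0 Lphi y.
have -> : bern phi y - phi y = \sum_f gridw y f * (phi (gridpt f) - phi y).
  rewrite -[X in _ - X]mul1r -(sum_gridw y) mulr_suml -sumrB.
  by apply: eq_bigr => f _; rewrite mulrBr.
apply: le_trans (ler_norm_sum _ _ _) _.
apply: le_trans (_ : _ <= \sum_f gridw y f * (L * \sum_(k < D) `|gridpt f k - y k|)) _.
  apply: ler_sum => f _; rewrite normrM (ger0_norm (gridw_ge0 _ _)).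
  by rewrite ler_wpM2l// gridw_ge0.
under eq_bigr do rewrite mulrCA mulr_sumr.
rewrite -mulr_sumr ler_wpM2l// exchange_big/=; apply: ler_sum => k _.
rewrite (eq_bigr (fun f : {ffun 'I_D -> N.-tuple bool} => gridw y f *
   (fun t : N.-tuple bool => `|(\sum_(b <- t) sgb b) / (N%:R * a) - y k|) (f k))); last first.
  by move=> f _; rewrite /gridpt valK.
rewrite (gridw_marginal y k (fun t => `|(\sum_(b <- t) sgb b) / (N%:R * a) - y k|)).
exact: grid_coord_dist.
Qed.

End bernstein_trig.

(** * Distance to a cone of partially convex sequences *)

Section euclidean_norm.
Context {R : realType}.
Implicit Types (D : nat) (y z : nat -> R).

Definition sqn D y : R := \sum_(k < D) y k ^+ 2.
Definition nrm D y : R := Num.sqrt (sqn D y).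

Lemma sqn_ge0 D y : 0 <= sqn D y.
Proof. by apply: sumr_ge0 => k _; exact: sqr_ge0. Qed.

Lemma nrm_ge0 D y : 0 <= nrm D y.
Proof. exact: sqrtr_ge0. Qed.

Lemma nrmK D y : nrm D y ^+ 2 = sqn D y.
Proof. by rewrite sqr_sqrtr// sqn_ge0. Qed.

Lemma le_nrm D y (r : R) : 0 <= r -> sqn D y <= r ^+ 2 -> nrm D y <= r.
Proof.
by move=> r0 yr; rewrite -(@ler_pXn2r _ 2) ?nnegrE ?nrm_ge0// nrmK.
Qed.

Lemma dotp_sqr_le D y z : dotp D y z ^+ 2 <= sqn D y * sqn D z.
Proof.
have [z0|z0] := eqVneq (sqn D z) 0.
  have zk (k : 'I_D) : z k = 0.
    apply/eqP; rewrite -sqrf_eq0; move/eqP: z0; rewrite psumr_eq0//; last first.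
      by move=> i _; exact: sqr_ge0.
    by move=> /allP /(_ k (mem_index_enum _)).
  by rewrite /dotp big1 ?expr0n ?z0 ?mulr0// => k _; rewrite zk mulr0.
have zp : 0 < sqn D z by rewrite lt_neqAle eq_sym z0 sqn_ge0.
set t := dotp D y z / sqn D z.
have : 0 <= \sum_(k < D) (y k - t * z k) ^+ 2 by apply: sumr_ge0 => k _; exact: sqr_ge0.
have -> : \sum_(k < D) (y k - t * z k) ^+ 2 = sqn D y - 2 * t * dotp D y z + t ^+ 2 * sqn D z.
  rewrite /sqn /dotp !mulr_sumr -sumrB -big_split/=.
  by apply: eq_bigr => k _; ring.
have -> : sqn D y - 2 * t * dotp D y z + t ^+ 2 * sqn D z = sqn D y - dotp D y z ^+ 2 / sqn D z.
  by rewrite /t; field.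
by rewrite subr_ge0 ler_pdivrMr.
Qed.

Lemma nrmD D y z : nrm D (fun k => y k + z k) <= nrm D y + nrm D z.
Proof.
apply: le_nrm; first by rewrite addr_ge0 ?nrm_ge0.
have -> : sqn D (fun k => y k + z k) = sqn D y + 2 * dotp D y z + sqn D z.
  rewrite /sqn /dotp mulr_sumr -!big_split/=.
  by apply: eq_bigr => k _; ring.
rewrite sqrrD !nrmK.
have : dotp D y z <= nrm D y * nrm D z.
  apply: le_trans (ler_norm _) _.
  rewrite -(@ler_pXn2r _ 2) ?nnegrE ?mulr_ge0 ?nrm_ge0//.
  by rewrite real_normK ?num_real// exprMn !nrmK dotp_sqr_le.
rewrite -mulr_natl; lra.
Qed.

Lemma nrmZ D c y : nrm D (fun k => c * y k) = `|c| * nrm D y.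
Proof.
rewrite /nrm (_ : sqn _ _ = c ^+ 2 * sqn D y); last first.
  by rewrite /sqn mulr_sumr; apply: eq_bigr => k _; rewrite exprMn.
by rewrite sqrtrM ?sqr_ge0// sqrtr_sqr.
Qed.

Lemma eq_nrm D y z : (forall k, (k < D)%N -> y k = z k) -> nrm D y = nrm D z.
Proof. by move=> yz; congr Num.sqrt; apply: eq_bigr => k _; rewrite yz. Qed.

Lemma coord_le_nrm D y k : (k < D)%N -> `|y k| <= nrm D y.
Proof.
move=> kD; rewrite -sqrtr_sqr ler_sqrt ?sqn_ge0//.
rewrite /sqn (bigD1 (Ordinal kD))//= lerDl.
by apply: sumr_ge0 => i _; exact: sqr_ge0.
Qed.

Lemma nrm_le_sum D y : nrm D y <= \sum_(k < D) `|y k|.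
Proof.
apply: le_nrm; first by apply: sumr_ge0 => k _.
rewrite /sqn; elim: D => [|D IH]; first by rewrite !big_ord0 expr0n.
rewrite !big_ord_recr/=.
have s0 : 0 <= \sum_(k < D) `|y k| by apply: sumr_ge0.
rewrite sqrrD real_normK ?num_real// lerD2r.
by apply: le_trans IH _; rewrite lerDl mulrn_wge0// mulr_ge0.
Qed.

Lemma D2_norm_le D (y : nat -> R) x (c : R) : (1 <= x)%N -> (x.+1 < D)%N ->
  (forall k, (k < D)%N -> `|y k| <= c) -> `|D2 y x| <= 4 * c.
Proof.
move=> x1 xD H; rewrite /D2.
have h1 := H _ xD; have h2 := H _ (ltnW xD).
have h3 : `|y x.-1| <= c by apply: H; rewrite (leq_ltn_trans (leq_pred _))// ltnW.
apply: le_trans (ler_normD _ _) _; apply: le_trans (lerD (ler_normB _ _) (lexx _)) _.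
rewrite normrM ger0_norm//; lra.
Qed.

Lemma D2D (y z : nat -> R) x : D2 (fun k => y k + z k) x = D2 y x + D2 z x.
Proof. rewrite /D2; ring. Qed.

Lemma D2Z c (y : nat -> R) x : D2 (fun k => c * y k) x = c * D2 y x.
Proof. rewrite /D2; ring. Qed.

Lemma D2B (y z : nat -> R) x : D2 (fun k => y k - z k) x = D2 y x - D2 z x.
Proof. rewrite /D2; ring. Qed.

End euclidean_norm.

(** * Distance to the cone and smoothed indicators *)

Section cone_distance.
Context {R : realType}.
Variables (D : nat) (A : set nat).
Hypothesis AD : forall x, A x -> (1 <= x)%N /\ (x.+1 < D)%N.

Definition cone : set (nat -> R) := [set g | forall x, A x -> 0 <= D2 g x].
Definition cdist2 (y : nat -> R) : R := inf [set sqdist D g y | g in cone].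
Definition cdist (y : nat -> R) : R := Num.sqrt (cdist2 y).

Lemma cone0 : cone (fun=> 0).
Proof. by move=> x _; rewrite /D2 mulr0 subrr addr0. Qed.

Lemma cdist2_has_inf y : has_inf [set sqdist D g y | g in cone].
Proof.
split; first by exists (sqdist D (fun=> 0) y), (fun=> 0) => //; exact: cone0.
by exists 0 => _ [g _ <-]; apply: sumr_ge0 => k _; exact: sqr_ge0.
Qed.

Lemma cdist2_ge0 y : 0 <= cdist2 y.
Proof.
apply: lb_le_inf; first by case: (cdist2_has_inf y).
by move=> _ [g _ <-]; apply: sumr_ge0 => k _; exact: sqr_ge0.
Qed.

Lemma cdist2_le y g : cone g -> cdist2 y <= sqdist D g y.
Proof.
by move=> Kg; apply: ge_inf; [case: (cdist2_has_inf y)|exists g].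
Qed.

Lemma cdist_ge0 y : 0 <= cdist y. Proof. exact: sqrtr_ge0. Qed.

Lemma cdistK y : cdist y ^+ 2 = cdist2 y.
Proof. by rewrite sqr_sqrtr// cdist2_ge0. Qed.

Lemma cdist_le y g : cone g -> cdist y <= nrm D (fun k => g k - y k).
Proof.
move=> Kg; rewrite ler_sqrt ?sqn_ge0//; exact: cdist2_le.
Qed.

(** Near-minimizers stand in for the projection on the cone in all arguments below. *)
Lemma cdist_approx y (e : R) : 0 < e ->
  exists2 g, cone g & nrm D (fun k => g k - y k) < cdist y + e.
Proof.
move=> e0; have h0 := cdist_ge0 y.
have e2 : 0 < e ^+ 2 by rewrite exprn_gt0.
have [_ [g Kg <-] H] := inf_adherent e2 (cdist2_has_inf y).
exists g => //; rewrite -(@ltr_pXn2r _ 2) ?nnegrE ?nrm_ge0//; last by lra.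
rewrite nrmK; apply: lt_le_trans H _.
rewrite -/(cdist2 y) -cdistK sqrrD lerD2r lerDl mulrn_wge0// mulr_ge0//; exact: ltW.
Qed.

Lemma cdist_lip1 y z : cdist y <= cdist z + nrm D (fun k => y k - z k).
Proof.
apply/ler_addgt0Pr => e e0; have [g Kg Hg] := cdist_approx z e0.
apply: le_trans (cdist_le y Kg) _.
have -> : nrm D (fun k => g k - y k) = nrm D (fun k => (g k - z k) + (-1) * (y k - z k)).
  by apply: eq_nrm => k _; ring.
apply: le_trans (nrmD _ _ _) _; rewrite nrmZ normrN normr1 mul1r; lra.
Qed.

Lemma cdist_lip y z : `|cdist y - cdist z| <= \sum_(k < D) `|y k - z k|.
Proof.
apply: le_trans (_ : _ <= nrm D (fun k => y k - z k)) _; last exact: nrm_le_sum.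
have h1 := cdist_lip1 y z; have h2 := cdist_lip1 z y.
have e : nrm D (fun k => z k - y k) = nrm D (fun k => y k - z k).
  rewrite (@eq_nrm _ _ (fun k => z k - y k) (fun k => (-1) * (y k - z k))).
    by rewrite nrmZ normrN normr1 mul1r.
  by move=> k _; ring.
rewrite ler_norml; apply/andP; split; lra.
Qed.

Lemma cone_comb (l : R) g g' : 0 <= l <= 1 -> cone g -> cone g' ->
  cone (fun k => (1 - l) * g k + l * g' k).
Proof.
move=> /andP[l0 l1] Kg Kg' x Ax; rewrite D2D !D2Z.
by rewrite addr_ge0// mulr_ge0// ?Kg ?Kg'// subr_ge0.
Qed.

Variable e : nat -> R.
Hypothesis e2 : forall x, A x -> D2 e x = 2.

(* Moving in the direction [e], interior to the cone, decreases a positive distance linearly. *)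
Lemma cdist_shift y (t : R) : 0 <= t ->
  cdist (fun k => y k + t * e k) <= Num.max 0 (cdist y - t / 2).
Proof.
move=> t0; apply/ler_addgt0Pr => eps eps0.
have [g Kg Hg] := cdist_approx y eps0.
set r := nrm D (fun k => g k - y k) in Hg.
have r0 : 0 <= r by exact: nrm_ge0.
have Dy x : A x -> - (4 * r) <= D2 y x.
  move=> Ax; have [x1 xD] := AD Ax.
  have := @D2_norm_le _ D (fun k => g k - y k) x r x1 xD (fun k kD => coord_le_nrm (fun k => g k - y k) kD).
  rewrite D2B => /(le_trans (ler_norm _)); have := Kg x Ax; lra.
(* As [y] is within r of the cone, its second differences at the points of [A] are at least - 4 r,
   and each unit of [e] adds 2. *)
have Kline s : 2 * r <= s -> cone (fun k => y k + s * e k).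
  move=> rs x Ax; rewrite D2D D2Z e2//; have := Dy x Ax; lra.
have [rt|tr] := leP (2 * r) t.
  apply: le_trans (cdist_le _ (Kline _ rt)) _.
  rewrite (@eq_nrm _ _ _ (fun k => 0 * y k)); last by move=> k _; rewrite subrr mul0r.
  rewrite nrmZ normr0 mul0r addr_ge0 ?(ltW eps0)// le_max lexx//.
have rp : 0 < r by lra.
(* This weight makes the combination of [g] and [y + 2 r e], both in the cone, differ from [y + t e]
   by exactly (1 - l) (g - y). *)
pose l := t / (2 * r).
have l01 : 0 <= l <= 1.
  rewrite divr_ge0 ?mulr_ge0//= ler_pdivrMr ?mulr_gt0// mul1r; exact: ltW.
apply: le_trans (cdist_le _ (cone_comb l01 Kg (Kline _ (lexx _)))) _.
rewrite (@eq_nrm _ _ _ (fun k => (1 - l) * (g k - y k))); last first.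
  by move=> k _; rewrite /l; field; exact: lt0r_neq0.
rewrite nrmZ -/r ger0_norm; last by case/andP: l01 => _; rewrite subr_ge0.
have -> : (1 - l) * r = r - t / 2 by rewrite /l; field; exact: lt0r_neq0.
apply: le_trans (_ : _ <= cdist y - t / 2 + eps) _; first lra.
by rewrite lerD2r le_max lexx orbT.
Qed.

Definition clip (x : R) : R := Num.min 1 (Num.max 0 x).

Lemma clip_lip x z : `|clip x - clip z| <= `|x - z|.
Proof.
wlog xz : x z / z <= x.
  move=> H; have [zx|xz] := leP z x; first exact: H.
  by rewrite distrC [leRHS]distrC; apply: H; exact: ltW.
rewrite (@ger0_norm _ (x - z)) ?subr_ge0//.
rewrite /clip; case: (leP 0 x) => x0; case: (leP 0 z) => z0;
 [case: (leP 1 x) => x1; case: (leP 1 z) => z1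
 |case: (leP 1 x) => x1; case: (leP 1 0) => z1
 |case: (leP 1 0) => x1; case: (leP 1 z) => z1
 |case: (leP 1 0) => x1];
 rewrite ler_norml; apply/andP; split; lra.
Qed.

Lemma clip_ge0 x : 0 <= clip x.
Proof. by rewrite /clip le_min ler01 le_max lexx. Qed.

Lemma clip_le1 x : clip x <= 1.
Proof. by rewrite /clip ge_min lexx. Qed.

(** A ramp in the distance, evaluated at the point moved back by [t e]. It already equals 1 where
    the distance of [y] exceeds r, and after a shift of its argument by [t e] it vanishes where that
    distance is at most r. So it dominates the indicator, while its shift is dominated by the same
    indicator. *)
Definition smooth_ind (t r : R) (y : nat -> R) : R :=
  clip ((cdist (fun k => y k - t * e k) - r) / (t / 2)).

Variables t r : R.
Hypothesis t0 : 0 < t.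
Hypothesis r0 : 0 <= r.

Lemma smooth_ind_bounded y : `|smooth_ind t r y| <= 1.
Proof. by rewrite ger0_norm ?clip_ge0// clip_le1. Qed.

Lemma smooth_ind_lip y z :
  `|smooth_ind t r y - smooth_ind t r z| <= (2 / t) * \sum_(k < D) `|y k - z k|.
Proof.
apply: le_trans (clip_lip _ _) _.
have -> : (cdist (fun k => y k - t * e k) - r) / (t / 2) -
  (cdist (fun k => z k - t * e k) - r) / (t / 2) =
  (2 / t) * (cdist (fun k => y k - t * e k) - cdist (fun k => z k - t * e k)).
  by field; exact: lt0r_neq0.
have t2 : 0 <= 2 / t by rewrite divr_ge0// ltW.
rewrite normrM (ger0_norm t2) ler_wpM2l//.
apply: le_trans (cdist_lip _ _) _.
by rewrite le_eqVlt; apply/orP; left; apply/eqP; apply: eq_bigr => k _; congr `|_|; ring.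
Qed.

Lemma smooth_ind_ge y : r < cdist y -> smooth_ind t r y = 1.
Proof.
move=> ry; have := cdist_shift (fun k => y k - t * e k) (ltW t0).
rewrite (_ : (fun k => _) = y); last by apply/funext => k; ring.
(* The branch where the maximum is 0 is excluded by 0 <= r < dist: only positive distances are
   lowered. *)
rewrite le_max => /orP[h|h].
  by have := lt_le_trans (le_lt_trans r0 ry) h; rewrite ltxx.
have : 1 <= (cdist (fun k => y k - t * e k) - r) / (t / 2).
  by rewrite ler_pdivlMr ?divr_gt0//; lra.
rewrite /smooth_ind /clip; set q := _ / (t / 2) => q1.
by rewrite (max_idPr _) ?(min_idPl _)//; lra.
Qed.

Lemma smooth_ind_shift y : cdist y <= r ->
  smooth_ind t r (fun k => y k + t * e k) = 0.
Proof.
move=> yr; rewrite /smooth_ind (_ : (fun k => _) = y); last by apply/funext => k; ring.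
have : (cdist y - r) / (t / 2) <= 0.
  by rewrite ler_pdivrMr ?divr_gt0// mul0r subr_le0.
rewrite /clip; set q := _ / (t / 2) => q1.
by rewrite (max_idPl _) ?(min_idPr _)//; lra.
Qed.

End cone_distance.

(** * The convex least squares estimator *)

Section squared_norm.
Context {R : realType}.
Implicit Types q : nat -> R.

Lemma sqnorm_le q (c : R) : (forall N, \sum_(0 <= j < N) q j ^+ 2 <= c) ->
  (sqnorm q <= c%:E)%E.
Proof.
move=> H; rewrite /sqnorm; apply: lime_le.
  by apply: is_cvg_ereal_nneg_natsum => n _; rewrite lee_fin sqr_ge0.
by apply: nearW => N; rewrite sumEFin lee_fin.
Qed.

Lemma sqnorm_ge q N : ((\sum_(0 <= j < N) q j ^+ 2)%:E <= sqnorm q)%E.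
Proof.
rewrite -sumEFin; apply: nneseries_lim_ge => k _ _.
by rewrite lee_fin sqr_ge0.
Qed.

Lemma sqnorm_leE q (c : R) : (sqnorm q <= c%:E)%E -> forall N, \sum_(0 <= j < N) q j ^+ 2 <= c.
Proof. by move=> H N; rewrite -lee_fin; apply: le_trans H; exact: sqnorm_ge. Qed.

Lemma sqnorm_ge0 q : (0 <= sqnorm q)%E.
Proof. by apply: nneseries_ge0 => n _ _; rewrite lee_fin sqr_ge0. Qed.

Lemma sum_nat_split q M N : (M <= N)%N -> (forall j, (M <= j)%N -> q j = 0) ->
  \sum_(0 <= j < N) q j = \sum_(0 <= j < M) q j.
Proof.
move=> MN q0; rewrite (@big_cat_nat _ _ _ M 0%N N)//= [X in _ + X]big_nat_cond [X in _ + X]big1 ?addr0//.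
by move=> j /andP[/andP[Mj _] _]; exact: q0.
Qed.

Lemma sum_nat_coord q N j : (forall i, 0 <= q i) -> (j < N)%N -> q j <= \sum_(0 <= i < N) q i.
Proof.
move=> q0 jN; rewrite (bigD1_seq j) ?iota_uniq//=; last by rewrite mem_index_iota.
by rewrite lerDl sumr_ge0.
Qed.

Lemma pmf_sum_le1 q N : is_pmf q -> \sum_(0 <= k < N) q k <= 1.
Proof.
move=> [q0 q1]; have nd : {homo (fun N => \sum_(0 <= k < N) q k) : n m / (n <= m)%N >-> n <= m}.
  move=> n m nm; rewrite (@big_cat_nat _ _ _ n 0%N m)//= lerDl.
  by apply: sumr_ge0.
have <- := cvg_lim (@Rhausdorff R) q1.
apply: nondecreasing_cvgn_le => //.
by apply/cvg_ex; exists 1.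
Qed.

End squared_norm.

Section empirical_pmf.
Context {R : realType}.
Variable s : seq nat.
Hypothesis s0 : (0 < size s)%N.
Local Notation e := (@emp R s).

Let sR : 0 < (size s)%:R :> R. Proof. by rewrite ltr0n. Qed.

Lemma emp_ge0 j : 0 <= e j.
Proof. by rewrite divr_ge0. Qed.

Lemma leq_smax i : i \in s -> (i <= smax s)%N.
Proof. by move=> is_; apply: (@leq_bigmax_seq _ _ xpredT (fun i => i)). Qed.

Lemma emp_gt_smax j : (smax s < j)%N -> e j = 0.
Proof.
move=> sj; rewrite /emp (_ : count_mem j s = 0%N) ?mul0r//.
apply/count_memPn; apply/negP => js.
by move: sj; rewrite ltnNge leq_smax.
Qed.

Lemma sum_count_mem (t : seq nat) N : all (fun i => i < N)%N t ->
  (\sum_(0 <= j < N) count_mem j t)%N = size t.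
Proof.
elim: t => [|i t IH] /=; first by rewrite big1.
move=> /andP[iN /IH IHt]; rewrite big_split/= IHt.
rewrite (bigD1_seq i) ?iota_uniq ?mem_index_iota//= eqxx big1 ?add1n// => j ji.
by rewrite eq_sym (negbTE ji).
Qed.

Lemma emp_sum N : (smax s < N)%N -> \sum_(0 <= j < N) e j = 1.
Proof.
move=> sN; rewrite /emp -mulr_suml -natr_sum sum_count_mem ?divff ?lt0r_neq0//.
by apply/allP => i is_; apply: leq_ltn_trans sN; exact: leq_smax.
Qed.

Lemma emp_sum_le1 N : \sum_(0 <= j < N) e j <= 1.
Proof.
have [Ns|sN] := leqP N (smax s); last by rewrite emp_sum.
rewrite -(emp_sum (ltnSn (smax s))) (@big_cat_nat _ _ _ N 0%N (smax s).+1)//=; last exact: leqW.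
by rewrite lerDl sumr_ge0// => j _; exact: emp_ge0.
Qed.

Lemma emp_le1 j : e j <= 1.
Proof. by apply: le_trans (emp_sum_le1 j.+1); apply: sum_nat_coord => // i; exact: emp_ge0. Qed.

End empirical_pmf.

(** * Existence of the convex least squares estimator *)

Section lse_existence.
Context {R : realType}.
Variable s : seq nat.
Hypothesis s0 : (0 < size s)%N.
Local Notation e := (@emp R s).
Local Notation L := (smax s).

Let dev (q : nat -> R) N := \sum_(0 <= j < N) (e j - q j) ^+ 2.

Let dev_nd q M N : (M <= N)%N -> dev q M <= dev q N.
Proof.
move=> MN; rewrite /dev (@big_cat_nat _ _ _ M 0%N N)//= lerDl.
by apply: sumr_ge0 => j _; exact: sqr_ge0.
Qed.

(** Real bounds valid for all partial sums replace the values of the series, which keeps the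
    minimization in the reals. *)
Let V : set R := [set c | exists2 q, convex_pmf q & forall N, dev q N <= c].

Let dev_le2 q N : is_pmf q -> dev q N <= 2.
Proof.
move=> pq; have [q0 _] := pq.
have q1 j : q j <= 1.
  by apply: le_trans (pmf_sum_le1 j.+1 pq); exact: sum_nat_coord.
apply: le_trans (_ : _ <= \sum_(0 <= j < N) (e j + q j)) _.
  apply: ler_sum => j _.
  have := emp_ge0 (R := R) s j; have := emp_le1 (R := R) s0 j; have := q0 j; have := q1 j; move: (e j) (q j) => a b.
  move=> b1 b0 a1 a0; have := mulr_ge0 a0 b0; have := ler_wpM2l a0 a1; have := ler_wpM2l b0 b1.
  by rewrite sqrrB !expr2; lra.
rewrite big_split/=; have := emp_sum_le1 (R := R) s0 N; have := pmf_sum_le1 N pq; lra.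
Qed.

Lemma convex_pmf_dirac0 : convex_pmf (fun j => (j == 0%N)%:R : R).
Proof.
split; last by move=> [|[|k]] //= _; rewrite /D2 /= mulr0 subrr add0r.
split=> //; apply: cvg_near_cst; exists 1%N => // N /= N1.
rewrite (@big_cat_nat _ _ _ 1 0%N N)//= big_nat1 eqxx big_nat_cond big1 ?addr0//.
by move=> [|j].
Qed.

Let hasV : has_inf V.
Proof.
split; last by exists 0 => c [q _ /(_ 0%N)]; apply: le_trans; rewrite /dev big_nil.
exists 2, (fun j => (j == 0%N)%:R); first exact: convex_pmf_dirac0.
by move=> N; apply: dev_le2; case: convex_pmf_dirac0.
Qed.

Let I0 := inf V.

Let inf_le q (c : R) : convex_pmf q -> (forall N, dev q N <= c) -> I0 <= c.
Proof. by move=> cq H; apply: ge_inf; [case: hasV|exists q]. Qed.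

Let dev_gt q (eps : R) : convex_pmf q -> 0 < eps -> exists N, I0 - eps < dev q N.
Proof.
move=> cq e0; apply: contrapT => H.
have : I0 <= I0 - eps.
  apply: inf_le cq _ => N; rewrite leNgt; apply/negP => h; apply: H; by exists N.
lra.
Qed.

Let convex_pmf_mid (q q' : nat -> R) : convex_pmf q -> convex_pmf q' ->
  convex_pmf (fun j => 2^-1 * (q j + q' j)).
Proof.
move=> [[q0 q1] cq] [[q0' q1'] cq']; split; last first.
  by move=> k k0; rewrite D2Z D2D mulr_ge0// addr_ge0// ?cq ?cq'.
split; first by move=> j; rewrite mulr_ge0// addr_ge0.
under eq_fun do rewrite -mulr_sumr big_split/=.
have h : 2^-1 * (\sum_(0 <= i < N) q i + \sum_(0 <= i < N) q' i) @[N --> \oo] -->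
    (2^-1 * (1 + 1) : R).
  by apply: cvgMr; apply: cvgD.
have e1 : 2^-1 * (1 + 1) = 1 :> R by field.
by rewrite e1 in h.
Qed.

(** Parallelogram identity: the midpoint is again a convex pmf, so its deviation cannot fall below
    the infimum. *)
Lemma minimizing_cauchy q q' (a b : R) : convex_pmf q -> convex_pmf q' ->
  (forall N, dev q N <= I0 + a) -> (forall N, dev q' N <= I0 + b) ->
  forall j, (q j - q' j) ^+ 2 <= 2 * a + 2 * b.
Proof.
move=> cq cq' ha hb j; apply/ler_addgt0Pr => eps eps0.
have eps4 : 0 < eps / 4 by rewrite divr_gt0.
have [N0 HN0] := dev_gt (convex_pmf_mid cq cq') eps4.
pose N := maxn N0 j.+1.
have HN : I0 - eps / 4 < dev (fun j => 2^-1 * (q j + q' j)) N.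
  by apply: lt_le_trans HN0 _; apply: dev_nd; rewrite leq_maxl.
have par : \sum_(0 <= i < N) (q i - q' i) ^+ 2 =
   2 * dev q N + 2 * dev q' N - 4 * dev (fun j => 2^-1 * (q j + q' j)) N.
  rewrite /dev !mulr_sumr -big_split -sumrB/=.
  by apply: eq_bigr => i _; field.
apply: le_trans (_ : _ <= \sum_(0 <= i < N) (q i - q' i) ^+ 2) _.
  apply: (@sum_nat_coord _ (fun i => (q i - q' i) ^+ 2)); first by move=> i; exact: sqr_ge0.
  by rewrite leq_maxr.
have := ha N; have := hb N; rewrite par; lra.
Qed.

Let approx n : exists q, convex_pmf q /\ forall N, dev q N <= I0 + n.+1%:R^-1.
Proof.
have n0 : 0 < n.+1%:R^-1 :> R by rewrite invr_gt0.
have [c [q cq qc] cI] := inf_adherent n0 hasV.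
exists q; split=> // N; apply: le_trans (qc N) _; exact: ltW.
Qed.

Let qs n := sval (cid (approx n)).
Let qsP n : convex_pmf (qs n) /\ forall N, dev (qs n) N <= I0 + n.+1%:R^-1.
Proof. exact: svalP (cid (approx n)). Qed.

(** Pointwise limit of a minimizing sequence. Positivity, convexity and the bound on the deviation
    pass to the limit; mass might escape to infinity, which [p_mass] rules out. *)
Let p j := lim (qs n j @[n --> \oo]).

Let qs_cvg j : qs n j @[n --> \oo] --> p j.
Proof.
apply: cauchy_cvg; apply/cauchy_ballP => eps eps0.
have e20 : 0 < eps ^+ 2 by rewrite exprn_gt0.
have : \forall n \near \oo, 4 * n.+1%:R^-1 < eps ^+ 2.
  have h : 4 * n.+1%:R^-1 @[n --> \oo] --> (0 : R).
    by rewrite -[X in _ --> X](mulr0 (4 : R)); apply: cvgMr; exact: cvg_harmonic.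
  by apply: (cvgr_lt _ h).
move=> [N _ HN].
exists ([set x | exists2 n, (N <= n)%N & x = qs n j], [set x | exists2 n, (N <= n)%N & x = qs n j]).
  by split; exists N => // n /= Nn; exists n.
move=> [x y] /= [[n Nn ->] [m Nm ->]]; rewrite /ball/=.
rewrite -(@ltr_pXn2r _ 2) ?nnegrE//; last exact: ltW.
rewrite real_normK ?num_real//.
apply: le_lt_trans (minimizing_cauchy (qsP n).1 (qsP m).1 (qsP n).2 (qsP m).2 j) _.
have := HN n Nn; have := HN m Nm; rewrite /=.
by move: (n.+1%:R^-1) (m.+1%:R^-1) => a b; lra.
Qed.

Let p_ge0 j : 0 <= p j.
Proof.
rewrite -(cvg_lim (@Rhausdorff R) (@qs_cvg j)); apply: limr_ge.
  by apply/cvg_ex; exists (p j); exact: qs_cvg.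
by apply: nearW => n; case: (qsP n) => -[[]].
Qed.

Let p_convex k : (0 < k)%N -> 0 <= D2 p k.
Proof.
move=> k0; have h : D2 (qs n) k @[n --> \oo] --> D2 p k.
  by apply: cvgD; [apply: cvgB; [|apply: cvgMr]|]; exact: qs_cvg.
rewrite -(cvg_lim (@Rhausdorff R) h); apply: limr_ge; first by apply/cvg_ex; exists (D2 p k).
by apply: nearW => n; case: (qsP n) => -[_ H] _; exact: H.
Qed.

Let cvg_sum_nat (f : nat -> nat -> R) (g : nat -> R) N :
  (forall j, f n j @[n --> \oo] --> g j) ->
  \sum_(0 <= j < N) f n j @[n --> \oo] --> \sum_(0 <= j < N) g j.
Proof.
move=> fg; elim: N => [|N IH].
  by under eq_fun do rewrite big_nil; rewrite big_nil; exact: cvg_cst.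
by under eq_fun do rewrite big_nat_recr//=; rewrite big_nat_recr//=; exact: cvgD.
Qed.

Let p_sum_le1 N : \sum_(0 <= j < N) p j <= 1.
Proof.
have h := @cvg_sum_nat qs p N qs_cvg.
rewrite -(cvg_lim (@Rhausdorff R) h); apply: limr_le; first by apply/cvg_ex; eexists; exact: h.
by apply: nearW => n; apply: pmf_sum_le1; case: (qsP n) => -[].
Qed.

Let p_dev N : dev p N <= I0.
Proof.
have h : dev (qs n) N @[n --> \oo] --> dev p N.
  apply: cvg_sum_nat => j; apply: (@cvg_comp _ _ _ (fun n => e j - qs n j) (fun x => x ^+ 2)).
    by apply: cvgB; [exact: cvg_cst|exact: qs_cvg].
  exact: exprn_continuous.
have h2 : I0 + n.+1%:R^-1 @[n --> \oo] --> I0.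
  by rewrite -[X in _ --> X]addr0; apply: cvgD; [exact: cvg_cst|exact: cvg_harmonic].
apply: (ler_cvg_to h h2); apply: nearW => n; exact: (qsP n).2.
Qed.

Let p_cvg : exists2 m : R, m <= 1 /\ (forall N, \sum_(0 <= j < N) p j <= m) &
  \sum_(0 <= j < N) p j @[N --> \oo] --> m.
Proof.
have nd : {homo (fun N => \sum_(0 <= k < N) p k) : n m / (n <= m)%N >-> n <= m}.
  move=> n m nm; rewrite (@big_cat_nat _ _ _ n 0%N m)//= lerDl.
  by apply: sumr_ge0.
have cv : cvgn (fun N => \sum_(0 <= j < N) p j).
  by apply: nondecreasing_is_cvgn => //; exists 1 => _ [N _ <-].
exists (limn (fun N => \sum_(0 <= j < N) p j)) => //; split.
  by apply: limr_le => //; apply: nearW.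
by move=> N; exact: nondecreasing_cvgn_le.
Qed.

(** The subtraction is the truncated one of the naturals, whence a convex sequence of finite
    support. *)
Let tent M j : R := (M - j)%:R.

Let tent_convex M k : (0 < k)%N -> 0 <= D2 (tent M) k.
Proof.
case: k => // k _; rewrite /D2 /tent /= addrAC subr_ge0 -natrD -natrM ler_nat; lia.
Qed.

(* Mass missing from [p] could be redistributed on a wide tent function, decreasing the deviation. *)
Let p_mass : \sum_(0 <= j < N) p j @[N --> \oo] --> (1 : R).
Proof.
have [m [m1 pm] pc] := p_cvg.
suff -> : (1 : R) = m by [].
apply/eqP; rewrite eq_le m1 andbT leNgt; apply/negP => m_lt.
pose c := 1 - m; have c0 : 0 < c by rewrite subr_gt0.
(* The estimates below give 2 (M c - L) <= c M, that is M c <= 2 L, which this choice of M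
   contradicts. *)
have [M0 HM0] : exists M0 : nat, 2 * L%:R / c < M0%:R.
  by exists (Num.truncn (2 * L%:R / c)).+1; exact: truncnS_gt.
pose M := maxn M0 L.+1.
have MM0 : (M0 <= M)%N by rewrite leq_maxl.
have ML : (L < M)%N by rewrite leq_maxr.
pose tot := \sum_(0 <= j < M) tent M j.
have tent0 j : (M <= j)%N -> tent M j = 0 by rewrite /tent => Mj; rewrite (eqP Mj : M - j = 0)%N.
have totN N : (M <= N)%N -> \sum_(0 <= j < N) tent M j = tot.
  by move=> MN; exact: sum_nat_split.
have tot0 : 0 < tot.
  apply: lt_le_trans (_ : tent M 0%N <= _); first by rewrite /tent subn0 ltr0n (leq_trans _ ML).
  by apply: sum_nat_coord => //; rewrite (leq_trans _ ML).
pose ka := c / tot; have ka0 : 0 < ka by rewrite divr_gt0.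
pose q j := p j + ka * tent M j.
have cq : convex_pmf q.
  split; last first.
    by move=> k k0; rewrite D2D D2Z addr_ge0 ?p_convex// mulr_ge0 ?tent_convex// ltW.
  split; first by move=> j; rewrite addr_ge0 ?p_ge0// mulr_ge0// ltW.
  under eq_fun do rewrite big_split/= -mulr_sumr.
  have -> : (1 : R) = m + ka * tot by rewrite /ka /c; field; exact: lt0r_neq0.
  apply: cvgD => //; apply: cvgMr; apply: cvg_near_cst.
  by exists M => // N /= MN; exact: totN.
pose A := \sum_(0 <= j < M) (e j - p j) * tent M j.
pose B := \sum_(0 <= j < M) tent M j ^+ 2.
(* The pmf [q] cannot beat the infimum, which [p] does not exceed: the first order gain is at most
   the second order loss. *)
have key : 2 * ka * A <= ka ^+ 2 * B.
  apply/ler_addgt0Pr => eps eps0.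
  have [N0 HN0] := dev_gt cq eps0.
  pose N := maxn N0 M.
  have MN : (M <= N)%N by rewrite leq_maxr.
  have HN : I0 - eps < dev q N by apply: lt_le_trans HN0 _; apply: dev_nd; rewrite leq_maxl.
  have dE : dev q N = dev p N - 2 * ka * A + ka ^+ 2 * B.
    rewrite /A /B -(@sum_nat_split _ (fun j => (e j - p j) * tent M j) M N)//; last first.
      by move=> j /tent0 ->; rewrite mulr0.
    rewrite -(@sum_nat_split _ (fun j => tent M j ^+ 2) M N)//; last first.
      by move=> j /tent0 ->; rewrite expr0n.
    rewrite /dev !mulr_sumr -sumrB -big_split/=.
    by apply: eq_bigr => j _; rewrite /q; ring.
  by have := p_dev N; lra.
have tentM j : tent M j <= M%:R by rewrite ler_nat leq_subr.
have BM : B <= M%:R * tot.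
  rewrite /B /tot mulr_sumr; apply: ler_sum => j _.
  by rewrite expr2 ler_wpM2r.
(* The empirical mass 1 sits on 0, ..., L, where the tent is at least M - L, while [p] has mass m =
   1 - c and the tent is at most M. *)
have AM : M%:R * c - L%:R <= A.
  have h1 : M%:R - L%:R <= \sum_(0 <= j < M) e j * tent M j.
    have -> : M%:R - L%:R = \sum_(0 <= j < M) e j * (M%:R - L%:R).
      by rewrite -mulr_suml emp_sum// mul1r.
    apply: ler_sum => j _.
    have [jL|Lj] := leqP j L.
      apply: ler_wpM2l; first exact: emp_ge0.
      by rewrite -natrB ?(ltnW ML)// ler_nat leq_sub2l.
    by rewrite emp_gt_smax// !mul0r.
  have h2 : \sum_(0 <= j < M) p j * tent M j <= M%:R * m.
    apply: le_trans (_ : _ <= \sum_(0 <= j < M) M%:R * p j) _.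
      by apply: ler_sum => j _; rewrite mulrC ler_wpM2r.
    by rewrite -mulr_sumr ler_wpM2l.
  rewrite /A; under eq_bigr do rewrite mulrBl.
  by rewrite sumrB /c mulrBr mulr1; lra.
have : 2 * (M%:R * c - L%:R) <= c * M%:R.
  have : 2 * A <= ka * B.
    by rewrite -(@ler_pM2l _ ka)// mulrCA mulrA (mulrA ka ka) -expr2.
  have : ka * B <= c * M%:R.
    apply: le_trans (ler_wpM2l (ltW ka0) BM) _.
    by rewrite /ka le_eqVlt; apply/orP; left; apply/eqP; field; exact: lt0r_neq0.
  lra.
have : 2 * L%:R < M%:R * c.
  by rewrite -ltr_pdivrMr//; apply: lt_le_trans HM0 _; rewrite ler_nat.
lra.
Qed.

Lemma convex_lse_exists : exists q : nat -> R, is_convex_lse s q.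
Proof.
exists p; split; first by split; [split; [exact: p_ge0|exact: p_mass]|exact: p_convex].
move=> q cq; apply: le_trans (sqnorm_le p_dev) _.
case E : (sqnorm (fun j => e j - q j)) => [c| |].
- rewrite lee_fin; apply: inf_le cq _ => N; apply: sqnorm_leE.
  by rewrite E.
- by rewrite leey.
- by have := sqnorm_ge0 (fun j => e j - q j); rewrite E.
Qed.

Lemma phat_lse : is_convex_lse s (@phat R s).
Proof. by have [q hq] := convex_lse_exists; rewrite /phat; apply: xgetPex; exists q. Qed.

Lemma lse_dist q (c : R) : convex_pmf q -> (forall N, dev q N <= c) ->
  (sqnorm (fun j => (e j - @phat R s j)%R) <= c%:E)%E.
Proof.
move=> cq qc; have [_ H] := phat_lse.
by apply: le_trans (H _ cq) _; exact: sqnorm_le.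
Qed.

Lemma phat_close q (r : R) : convex_pmf q -> 0 <= r -> (forall N, dev q N <= r ^+ 2) ->
  forall j, `|@phat R s j - q j| <= 2 * r.
Proof.
move=> cq r0 qr j.
have h1 : `|e j - q j| <= r.
  rewrite -(@ler_pXn2r _ 2) ?nnegrE// real_normK ?num_real//.
  apply: le_trans (qr j.+1).
  by apply: (@sum_nat_coord _ (fun j => (e j - q j) ^+ 2)) => // i; exact: sqr_ge0.
have h2 : `|e j - phat s j| <= r.
  rewrite -(@ler_pXn2r _ 2) ?nnegrE// real_normK ?num_real//.
  apply: le_trans (sqnorm_leE (lse_dist cq qr) j.+1).
  by apply: (@sum_nat_coord _ (fun j => (e j - phat s j) ^+ 2)) => // i; exact: sqr_ge0.
have -> : phat s j - q j = (e j - q j) - (e j - phat s j) by ring.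
apply: le_trans (ler_normB _ _) _; lra.
Qed.

End lse_existence.

(** * Convex sequences of finite support and recentering *)

Section convex_sequences.
Context {R : realType}.
Implicit Types q : nat -> R.

(** Induction downwards from the tail: increments are nondecreasing by convexity, and eventually
    0. *)
Lemma convex_nonincreasing q M : (forall k, (0 < k)%N -> 0 <= D2 q k) ->
  (forall j, (M <= j)%N -> q j = 0) -> forall j, q j.+1 <= q j.
Proof.
move=> cq q0.
have H i j : (M <= i + j)%N -> q j.+1 <= q j.
  elim: i j => [|i IH] j Mj.
    by rewrite !q0// ltnW// ltnS.
  have := IH j.+1; rewrite addnS -addSn => /(_ Mj).
  by have := cq j.+1 isT; rewrite /D2 /=; lra.
by move=> j; apply: (H M); rewrite leq_addr.
Qed.

Lemma convex_nonincreasing_le q M : (forall k, (0 < k)%N -> 0 <= D2 q k) ->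
  (forall j, (M <= j)%N -> q j = 0) -> forall i j, (i <= j)%N -> q j <= q i.
Proof.
move=> cq q0 i j ij; rewrite -(subnK ij); elim: (j - i)%N => // k IH.
by rewrite addSn; apply: le_trans IH; exact: convex_nonincreasing cq q0 _.
Qed.

(** Yields the positivity of a perturbed pmf from its convexity alone. *)
Lemma convex_zero_ge0 q M : (forall k, (0 < k)%N -> 0 <= D2 q k) ->
  (forall j, (M <= j)%N -> q j = 0) -> forall j, 0 <= q j.
Proof.
move=> cq q0 j; rewrite -(q0 (maxn M j)) ?leq_maxl//.
by apply: convex_nonincreasing_le cq q0 _ _ _; rewrite leq_maxr.
Qed.

(* Projection of a residual on the polar of the cone spanned by the constants
   and the indicator of the last coordinate. *)
Lemma recenter_residual m (r : nat -> R) : exists c b : R,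
  [/\ 0 <= b, \sum_(i < m.+2) (r i - (c + b * (i == m.+1 :> nat)%:R)) = 0,
      r m.+1 - (c + b) <= 0 &
      \sum_(i < m.+2) (r i - (c + b * (i == m.+1 :> nat)%:R)) ^+ 2 <=
      \sum_(i < m.+2) r i ^+ 2].
Proof.
pose mu' := (\sum_(i < m.+1) r i) / m.+1%:R.
have m1 : (m.+1%:R : R) != 0 by rewrite pnatr_eq0.
have m2 : (m.+2%:R : R) != 0 by rewrite pnatr_eq0.
have sumsq N (c : R) : \sum_(i < N) (r i - c) ^+ 2 =
    \sum_(i < N) r i ^+ 2 - 2 * c * (\sum_(i < N) r i) + N%:R * c ^+ 2.
  rewrite mulr_sumr -sumrB.
  have -> : N%:R * c ^+ 2 = \sum_(i < N) c ^+ 2 by rewrite sumr_const card_ord mulr_natl.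
  by rewrite -big_split/=; apply: eq_bigr => i _; ring.
have sumc N (c : R) : \sum_(i < N) (r i - c) = \sum_(i < N) r i - N%:R * c.
  by rewrite sumrB sumr_const card_ord mulr_natl.
have lastF (i : 'I_m.+1) : (widen_ord (leqnSn m.+1) i == m.+1 :> nat) = false.
  by rewrite ltn_eqF//= ltn_ord.
(* If the last entry is at most the mean of the others, the constraint on [b] binds and only the
   overall mean is removed. Otherwise the last residual is cancelled and the others are centered
   separately. *)
have [h|h] := leP (r m.+1) mu'.
  exists ((\sum_(i < m.+2) r i) / m.+2%:R), 0; split=> //.
  - under eq_bigr do rewrite mul0r addr0.
    by rewrite sumc mulrCA divff// mulr1 subrr.
  - rewrite addr0 subr_le0 ler_pdivlMr ?ltr0Sn// big_ord_recr/=.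
    move: h; rewrite /mu' ler_pdivlMr ?ltr0Sn// -(natr1 m.+1) mulrDr mulr1; lra.
  - under eq_bigr do rewrite mul0r addr0.
    rewrite sumsq; set s := \sum_(i < m.+2) r i.
    have -> : \sum_(i < m.+2) r i ^+ 2 - 2 * (s / m.+2%:R) * s + m.+2%:R * (s / m.+2%:R) ^+ 2 =
      \sum_(i < m.+2) r i ^+ 2 - s ^+ 2 / m.+2%:R.
      by move: (m.+2%:R : R) m2 => k k0; field.
    by rewrite lerBlDr lerDl divr_ge0// sqr_ge0.
exists mu', (r m.+1 - mu'); split.
- by rewrite subr_ge0 ltW.
- rewrite big_ord_recr/= eqxx mulr1.
  under eq_bigr do rewrite lastF mulr0 addr0.
  by rewrite sumc /mu' mulrCA divff// mulr1; ring.
- by rewrite [mu' + _]addrC subrK subrr.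
- rewrite big_ord_recr [X in _ <= X]big_ord_recr/= eqxx mulr1.
  under eq_bigr do rewrite lastF mulr0 addr0.
  rewrite [mu' + _]addrC subrK subrr expr0n addr0 sumsq; set s := \sum_(i < m.+1) r i.
  have -> : \sum_(i < m.+1) r i ^+ 2 - 2 * mu' * s + m.+1%:R * mu' ^+ 2 =
      \sum_(i < m.+1) r i ^+ 2 - s ^+ 2 / m.+1%:R.
    by rewrite /mu' -/s; move: (m.+1%:R : R) m1 => k k0; field.
  have : 0 <= s ^+ 2 / m.+1%:R by rewrite divr_ge0// sqr_ge0.
  by move: (s ^+ 2 / m.+1%:R) (sqr_ge0 (r m.+1)) => z h1 z0; lra.
Qed.

End convex_sequences.

(** * Bounds on a good sample *)

Section deterministic_bounds.
Context {R : realType}.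
Variables (p0 : nat -> R) (m : nat).
Hypothesis cp0 : convex_pmf p0.
Hypothesis p0m : 0 < p0 m.
Hypothesis p0z : forall j, (m < j)%N -> p0 j = 0.

Definition flat : set nat := [set x | (1 <= x <= m)%N /\ D2 p0 x = 0].

Lemma flatD x : flat x -> (1 <= x)%N /\ (x.+1 < m.+2)%N.
Proof. by case=> /andP[x1 xm] _. Qed.

Lemma p0_gt0 j : (j <= m)%N -> 0 < p0 j.
Proof.
move=> jm; apply: lt_le_trans p0m _; case: cp0 => _ c.
exact: (@convex_nonincreasing_le _ p0 m.+1).
Qed.

Lemma p0_sum N : (m < N)%N -> \sum_(0 <= j < N) p0 j = 1.
Proof.
move=> mN; rewrite (@sum_nat_split _ p0 m.+1 N)//.
case: cp0 => -[_ h] _.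
have h2 : \sum_(0 <= k < N) p0 k @[N --> \oo] --> \sum_(0 <= k < m.+1) p0 k.
  apply: cvg_near_cst; exists m.+1 => // N' /= mN'.
  exact: sum_nat_split.
exact: (cvg_unique _ h2 h).
Qed.

(** The range includes m + 1, where the second difference is p0 m, because perturbations of p0 reach
    that index. *)
Lemma D2_p0_gap : exists2 k0 : R, 0 < k0 &
  forall x, (1 <= x <= m.+1)%N -> D2 p0 x != 0 -> k0 <= D2 p0 x.
Proof.
have H N : exists2 k0 : R, 0 < k0 & forall x, (1 <= x <= N)%N -> D2 p0 x != 0 -> k0 <= D2 p0 x.
  elim: N => [|N [k0 k0p IH]]; first by exists 1 => // x; case: x.
  have [e|ne] := eqVneq (D2 p0 N.+1) 0.
    exists k0 => // x /andP[x1]; rewrite leq_eqVlt => /orP[/eqP ->|xN]; first by rewrite e eqxx.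
    by apply: IH; rewrite x1.
  have pos : 0 < D2 p0 N.+1.
    by rewrite lt_neqAle eq_sym ne /=; case: cp0 => _; exact.
  exists (Num.min k0 (D2 p0 N.+1)); first by rewrite lt_min k0p.
  move=> x /andP[x1]; rewrite leq_eqVlt => /orP[/eqP -> _|xN xne].
    by rewrite ge_min lexx orbT.
  by rewrite ge_min IH// x1.
exact: H.
Qed.

Variables (k0 : R).
Hypothesis k0P : forall x, (1 <= x <= m.+1)%N -> D2 p0 x != 0 -> k0 <= D2 p0 x.

Variable s : seq nat.
Hypothesis s0 : (0 < size s)%N.
Hypothesis sm : smax s = m.
Local Notation e := (@emp R s).
Local Notation n := (size s).
Local Notation sn := (Num.sqrt (size s)%:R).

Definition scaled_dev (k : nat) : R := sn * (e k - p0 k).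
Local Notation y := scaled_dev.

Variable rho : R.
Hypothesis rho0 : 0 <= rho.
Hypothesis hrho : sqn m.+2 (fun k => e k - p0 k) <= rho ^+ 2.

Let nR : 0 < (n%:R : R). Proof. by rewrite ltr0n. Qed.
Let sn0 : 0 < sn :> R. Proof. by rewrite sqrtr_gt0. Qed.
Let snK : sn ^+ 2 = n%:R :> R. Proof. by rewrite sqr_sqrtr// ltW. Qed.

Let sum_dev (q : nat -> R) N : (forall j, (m.+1 < j)%N -> q j = 0) ->
  \sum_(0 <= j < N) (e j - q j) ^+ 2 <= sqn m.+2 (fun k => e k - q k).
Proof.
move=> q0; have -> : sqn m.+2 (fun k => e k - q k) = \sum_(0 <= j < m.+2) (e j - q j) ^+ 2.
  by rewrite big_mkord.
have [Nm|mN] := leqP N m.+2.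
  rewrite (@big_cat_nat _ _ _ N 0%N m.+2)//= lerDl.
  by apply: sumr_ge0 => j _; exact: sqr_ge0.
rewrite (@sum_nat_split _ (fun j => (e j - q j) ^+ 2) m.+2 N) ?(ltnW mN)//.
move=> j mj; rewrite q0// emp_gt_smax ?subr0 ?expr0n//.
by rewrite sm ltnW.
Qed.

Lemma sum_dev_p0 N : \sum_(0 <= j < N) (e j - p0 j) ^+ 2 <= rho ^+ 2.
Proof. by apply: le_trans hrho; apply: sum_dev => j mj; rewrite p0z// ltnW. Qed.

Lemma phat_p0 j : `|@phat R s j - p0 j| <= 2 * rho.
Proof. exact: (phat_close s0 cp0 rho0 sum_dev_p0). Qed.

(** Where the second difference of p0 vanishes, that of the estimator is at most 4 times the bound 2
    rho of [phat_p0], so the point is among those constrained by [Kcone]. *)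
Lemma Kcone_sub (v : R) : 8 * rho <= v -> Kcone v s `<=` cone flat.
Proof.
move=> rv g Kg x fx; have [/andP[x1 xm] xe] := fx; apply: Kg; first by rewrite x1 sm.
have := @D2_norm_le _ m.+2 (fun k => phat s k - p0 k) x (2 * rho) x1 xm
  (fun k _ => phat_p0 k).
by rewrite D2B xe subr0 => /(le_trans (ler_norm _)); lra.
Qed.

Lemma sqn_y : sqn m.+2 y = n%:R * sqn m.+2 (fun k => e k - p0 k).
Proof. by rewrite /sqn mulr_sumr; apply: eq_bigr => k _; rewrite exprMn snK. Qed.

Let y_last : y m.+1 = 0.
Proof. by rewrite /scaled_dev p0z// emp_gt_smax ?sm// subrr mulr0. Qed.

Let sum_y : \sum_(i < m.+2) y i = 0.
Proof.
rewrite -mulr_sumr -(big_mkord xpredT (fun i => e i - p0 i)) sumrB emp_sum ?sm//.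
by rewrite p0_sum// subrr mulr0.
Qed.

Hypothesis rk0 : 8 * rho <= k0.

(** The competitor is p0 + g' / sqrt n, where g' is [g] recentered by [recenter_residual]. The added
    constant leaves second differences unchanged, and b >= 0 only raises the one at m. As [g] is no
    farther from [y] than 0 is, g' / sqrt n is at most 2 rho, too small to destroy strict convexity
    of p0. *)
Lemma lse_dist_cone g : cone flat g -> sqdist m.+2 g y <= sqn m.+2 y ->
  (sqnorm (fun j => (e j - @phat R s j)%R) <= (sqdist m.+2 g y / n%:R)%:E)%E.
Proof.
move=> Kg gy.
have [c [b [b0 sum0 last0 sqle]]] := recenter_residual m (fun i => y i - g i).
pose g' i := g i + (c + b * (i == m.+1)%:R).
have rE (i : nat) : y i - g i - (c + b * (i == m.+1)%:R) = y i - g' i by rewrite /g'; ring.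
have {}sum0 : \sum_(i < m.+2) (y i - g' i) = 0.
  by apply: etrans sum0; apply: eq_bigr => i _; rewrite rE.
have sqE : \sum_(i < m.+2) (y i - g i) ^+ 2 = sqdist m.+2 g y.
  by apply: eq_bigr => i _; rewrite -sqrrN opprB.
have {}sqle : sqn m.+2 (fun i => y i - g' i) <= sqdist m.+2 g y.
  by rewrite -sqE; apply: le_trans sqle; apply: ler_sum => i _; rewrite rE.
have g'last : 0 <= g' m.+1.
  by move: last0; rewrite y_last /g' eqxx mulr1; lra.
have g'sum : \sum_(i < m.+2) g' i = 0.
  by apply/eqP; rewrite -oppr_eq0 -[X in X == _]add0r -{1}sum_y -sumrB; apply/eqP.
have Kg' : cone flat g'.
  move=> x fx; have [x1 xm] := flatD fx.
  have -> : D2 g' x = D2 g x + b * (x == m)%:R.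
    have xm' : (x < m.+1)%N by [].
    rewrite /D2 /g' eqSS (ltn_eqF xm') (ltn_eqF (_ : x.-1 < m.+1)%N); last first.
      by rewrite (leq_ltn_trans (leq_pred _)).
    by rewrite !mulr0; ring.
  by rewrite addr_ge0 ?Kg// mulr_ge0.
have nrmy : nrm m.+2 y <= sn * rho.
  apply: le_nrm; first by rewrite mulr_ge0// ltW.
  by rewrite sqn_y exprMn snK ler_wpM2l// ltW.
have g'le k : (k < m.+2)%N -> `|g' k| <= sn * (2 * rho).
  move=> km; apply: le_trans (coord_le_nrm g' km) _.
  rewrite (@eq_nrm _ _ g' (fun k => y k + (-1) * (y k - g' k))); last by move=> i _; ring.
  apply: le_trans (nrmD m.+2 y (fun k => (-1) * (y k - g' k))) _.
  rewrite [X in _ + X]nrmZ normrN normr1 mul1r.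
  have h : nrm m.+2 (fun k => y k - g' k) <= nrm m.+2 y.
    apply: le_nrm; first exact: nrm_ge0.
    by rewrite nrmK; apply: le_trans sqle gy.
  lra.
pose ka i := if (i < m.+2)%N then g' i else 0.
pose q i := p0 i + sn^-1 * ka i.
have q0 j : (m.+1 < j)%N -> q j = 0.
  by move=> mj; rewrite /q /ka ltnNge mj/= mulr0 addr0 p0z// ltnW.
have kale k : `|sn^-1 * ka k| <= 2 * rho.
  rewrite /ka; case: ifP => [km|_]; last by rewrite mulr0 normr0 mulr_ge0.
  rewrite normrM normfV (gtr0_norm sn0) mulrC ler_pdivrMr// mulrC; exact: g'le.
have cq k : (0 < k)%N -> 0 <= D2 q k.
  move=> k1; have [km|mk] := leqP k m.+1; last first.
    rewrite /D2 (q0 k mk) (q0 k.+1 (leqW mk)) mulr0 subrr add0r.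
    move: mk; rewrite leq_eqVlt => /orP[/eqP <-|mk].
      (* At k = m + 2 the second difference is the value at m + 1, that is g' (m + 1) / sqrt n: this
         is why the recentering makes the last residual nonpositive. *)
      rewrite /q /ka /= ltnSn p0z// add0r mulr_ge0// invr_ge0 ltW//.
    by rewrite q0//; case: k k1 mk.
  have [d0|d0] := eqVneq (D2 p0 k) 0.
    (* The index m + 1 is excluded, for there the second difference of p0 is p0 m > 0. *)
    have km' : (k <= m)%N.
      move: km; rewrite leq_eqVlt => /orP[/eqP ek|//].
      have e1 : p0 m.+1 = 0 by exact: p0z.
      have e2 : p0 m.+2 = 0 by apply: p0z; rewrite ltnW.
      move: d0; rewrite ek /D2 /= e1 e2 mulr0 subrr add0r => e0.
      by move: p0m; rewrite e0 ltxx.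
    rewrite D2D d0 add0r D2Z mulr_ge0 ?invr_ge0 ?(ltW sn0)//.
    have -> : D2 ka k = D2 g' k.
      rewrite /D2 /ka ltnS ltnS km' ltnS km (_ : (k.-1 < m.+2)%N)//.
      by rewrite (leq_ltn_trans (leq_pred _))// ltnS.
    by apply: Kg'; split=> //; rewrite k1.
  have := k0P (_ : (1 <= k <= m.+1)%N) d0; rewrite k1 km => /(_ isT) h1.
  have := @D2_norm_le _ k.+2 (fun i => sn^-1 * ka i) k (2 * rho) k1 (ltnSn _) (fun i _ => kale i).
  have -> : D2 q k = D2 p0 k + D2 (fun i => sn^-1 * ka i) k by exact: D2D.
  by rewrite ler_norml => /andP[h2 _]; have := rk0; lra.
have cpq : convex_pmf q.
  split=> //; split; first exact: (convex_zero_ge0 cq q0).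
  apply: cvg_near_cst; exists m.+2 => // N /= mN.
  rewrite (sum_nat_split mN q0) big_split/= p0_sum//.
  rewrite -mulr_sumr big_mkord (eq_bigr (fun i : 'I_m.+2 => g' i)); last first.
    by move=> i _; rewrite /ka ltn_ord.
  by rewrite g'sum mulr0 addr0.
apply: (lse_dist s0 cpq) => N; apply: le_trans (sum_dev N q0) _.
have -> : sqn m.+2 (fun k => e k - q k) = sqn m.+2 (fun i => y i - g' i) / n%:R.
  rewrite /sqn mulr_suml; apply: eq_bigr => i _.
  rewrite /q /ka ltn_ord /scaled_dev -[X in _ / X]snK.
  by move: (sn : R) sn0 => a a0; field; exact: lt0r_neq0.
by rewrite ler_wpM2r// invr_ge0 ltW.
Qed.

(** A cone point farther from [y] than the origin is traded for the origin, to which [lse_dist_cone]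
    applies. *)
Lemma stat_le_cdist2 :
  ((n%:R : R)%:E * sqnorm (fun j => (e j - @phat R s j)%R) <= (cdist2 m.+2 flat y)%:E)%E.
Proof.
have fin : (sqnorm (fun j => (e j - @phat R s j)%R) <= (rho ^+ 2)%:E)%E.
  exact: (lse_dist s0 cp0 sum_dev_p0).
case E : (sqnorm (fun j => e j - @phat R s j)) fin => [c| |] // _; last first.
  by have := sqnorm_ge0 (fun j => e j - @phat R s j); rewrite E.
rewrite -EFinM lee_fin; apply: lb_le_inf; first by case: (cdist2_has_inf m.+2 flat y).
move=> _ [g Kg <-].
have cone00 : cone flat (fun=> 0 : R) by exact: cone0.
have y0 : sqdist m.+2 (fun=> 0) y = sqn m.+2 y.
  by apply: eq_bigr => i _; rewrite sub0r sqrrN.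
have [gy|gy] := leP (sqdist m.+2 g y) (sqn m.+2 y).
  have := lse_dist_cone Kg gy; rewrite E lee_fin ler_pdivlMr//.
  by rewrite mulrC.
have := lse_dist_cone cone00; rewrite y0 => /(_ (lexx _)).
rewrite E lee_fin ler_pdivlMr// mulrC => h.
by apply: le_trans h (ltW gy).
Qed.

End deterministic_bounds.

(** * Law of the sample and conditional quantiles *)

Section sample_law.
Context {R : realType} {d : measure_display} {T : measurableType d}.
Variables (P : probability T R) (X : nat -> T -> nat) (p0 : nat -> R) (m : nat).
Hypothesis mX : forall i j, measurable [set w | X i w = j].
Hypothesis lawX : forall (n : nat) (j : nat -> nat),
  P [set w | forall i, (i < n)%N -> X i w = j i] = (\prod_(i < n) p0 (j i))%:E.

Definition p0w (j : 'I_m.+1) : R := p0 j.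

Lemma sample_eqE n (s : seq nat) : size s = n ->
  [set w | sample X n w = s] = [set w | forall i, (i < n)%N -> X i w = nth 0%N s i].
Proof.
move=> sn; apply/seteqP; split=> w /=.
  by move=> <- i ni; rewrite (nth_map 0%N) ?size_iota// nth_iota.
move=> H; apply: (@eq_from_nth _ 0%N); first by rewrite size_map size_iota.
move=> i; rewrite size_map size_iota => ni.
by rewrite (nth_map 0%N) ?size_iota// nth_iota// H.
Qed.

Lemma sample_eq_measurable n (s : seq nat) : measurable [set w | sample X n w = s].
Proof.
have [sn|sn] := eqVneq (size s) n; last first.
  rewrite (_ : [set w | _] = set0)//; apply/seteqP; split=> w //= H.
  by move: sn; rewrite -H size_map size_iota eqxx.
rewrite (sample_eqE sn) (_ : [set w | _] =
  \bigcap_i (if (i < n)%N then [set w | X i w = nth 0%N s i] else setT)).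
  by apply: bigcapT_measurable => i; case: ifP.
apply/seteqP; split=> w /=.
  by move=> H i _; case: ifP => // /H.
by move=> H i ni; have := H i I; rewrite ni.
Qed.

Lemma sample_measurable n (B : seq nat -> Prop) : measurable [set w | B (sample X n w)].
Proof.
rewrite (_ : [set w | _] = \bigcup_(s : seq nat)
   (if `[< B s >] then [set w | sample X n w = s] else set0)).
  apply: countable_bigcupT_measurable => // s.
  by case: ifP => // _; exact: sample_eq_measurable.
apply/seteqP; split=> w /=.
  by move=> Bw; exists (sample X n w) => //; rewrite asboolT.
by move=> [s _]; case: ifP => //= /asboolP Bs ->.
Qed.

Hypothesis p0_sum1 : \sum_(j < m.+1) p0 j = 1.

(** Samples with values beyond m are handled through the complement: it contains the disjoint
    cylinders of the tuples failing [B], and all tuples together have mass 1. *)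
Lemma sample_prob n (B : seq nat -> Prop) :
  (P [set w | B (sample X n w)] <=
   (Ex p0w n (fun t => (`[< B (map val t) >])%:R))%:E)%E.
Proof.
pose cyl (t : n.-tuple 'I_m.+1) := [set w | sample X n w = map val t].
have mcyl t : measurable (cyl t) by exact: sample_eq_measurable.
have Pcyl t : P (cyl t) = (\prod_(j <- t) p0w j)%:E.
  rewrite /cyl sample_eqE ?size_map ?size_tuple// lawX; congr EFin.
  rewrite big_tuple; apply: eq_bigr => i _; congr p0.
  by rewrite (nth_map ord0) ?size_tuple// (tnth_nth ord0).
pose r := [seq t <- enum {: n.-tuple 'I_m.+1} | ~~ `[< B (map val (tval t)) >] ].
have ur : uniq r by rewrite filter_uniq// enum_uniq.
pose E := [set w | B (sample X n w)].
have mE : measurable E by exact: sample_measurable.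
have mC : measurable (~` E) by exact: measurableC.
have sub : \bigcup_(t in [set` r]) cyl t `<=` ~` E.
  move=> w [t /=]; rewrite mem_filter => /andP[/asboolPn nB _].
  by rewrite /cyl /= => e; rewrite /E /= e.
have Pr : P (\bigcup_(t in [set` r]) cyl t) =
    (\sum_(t <- r) \prod_(j <- t) p0w j)%:E.
  rewrite measure_fin_bigcup//.
  - rewrite -fsbig_seq//= -sumEFin; apply: eq_bigr => t _; exact: Pcyl.
  - by move=> t t' _ _ [w [/= h1 h2]]; apply: val_inj; apply: (inj_map val_inj); rewrite -h1.
have mr : measurable (\bigcup_(t in [set` r]) cyl t).
  by apply: fin_bigcup_measurable => //; exact: finite_seq.
have h1 : ((\sum_(t <- r) \prod_(j <- t) p0w j)%:E <= P (~` E))%E.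
  by rewrite -Pr; apply: le_measure => //; rewrite inE.
have PE : P E = (1 - P (~` E))%E.
  by rewrite -(probability_setC P mC) setCK.
rewrite -/E PE.
have -> : Ex p0w n (fun t => (`[< B (map val t) >])%:R) = 1 - \sum_(t <- r) \prod_(j <- t) p0w j.
  have tot : \sum_(t : n.-tuple 'I_m.+1) \prod_(j <- t) p0w j = 1.
    transitivity (Ex p0w n (fun=> 1)); last exact: Ex_cst.
    by apply: eq_bigr => t _; rewrite mulr1.
  have sp : Ex p0w n (fun t => (`[< B (map val t) >])%:R) +
      \sum_(t <- r) \prod_(j <- t) p0w j = 1.
    apply: etrans tot; rewrite /r big_filter big_enum_cond/= /Ex.
    rewrite [RHS](bigID (fun t : n.-tuple 'I_m.+1 => `[< B (map val (tval t)) >]))/=.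
    congr (_ + _); rewrite [RHS]big_mkcond/=; apply: eq_bigr => t _.
    by case: ifP; rewrite ?mulr1 ?mulr0.
  by apply/eqP; rewrite eq_sym subr_eq sp.
by rewrite EFinB; apply: leeB.
Qed.

End sample_law.

(** * Quantiles *)

Section quantile_bounds.
Context {R : realType} {d : measure_display} {T : measurableType d}.
Variables (Q : probability T R) (Y : T -> R) (alpha : R).
Hypothesis mY : measurable_fun setT Y.
Hypothesis Y0 : forall w, 0 <= Y w.
Hypothesis al : 0 < alpha < 1.
Local Notation t := (quantile Q Y (1 - alpha)).

Let A := [set x : R | ((1 - alpha)%:E <= Q [set w | (Y w <= x)%R])%E].

Let Yv : {RV Q >-> R} := HB.pack Y (isMeasurableFun.Build _ _ _ _ Y mY).

Let cdfE x : cdf Yv x = Q [set w | Y w <= x].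
Proof.
rewrite /cdf /distribution /pushforward; congr (Q _).
Qed.

Let A_ge0 x : A x -> 0 <= x.
Proof.
rewrite /A /= => H; rewrite leNgt; apply/negP => x0; move: H.
rewrite (_ : [set w | Y w <= x] = set0); last first.
  by apply/seteqP; split=> w //=; have := Y0 w; lra.
by rewrite measure0 lee_fin; case/andP: al; lra.
Qed.

Let A_neq0 : A !=set0.
Proof.
apply: contrapT => nA.
have cv := cvg_cdfy1 Yv.
have : (lim (cdf Yv x @[x --> +oo%R]) <= (1 - alpha)%:E)%E.
  apply: lime_le; first by apply/cvg_ex; exists 1%E.
  apply: nearW => x; rewrite leNgt; apply/negP => h; apply: nA.
  by exists x; rewrite /A /= -cdfE ltW.
rewrite (cvg_lim (@ereal_hausdorff R) cv) lee_fin.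
by case/andP: al; lra.
Qed.

Lemma quantile_ge0 : 0 <= t.
Proof. by apply: lb_le_inf; [exact: A_neq0|exact: A_ge0]. Qed.

Let hasA : has_inf A.
Proof. by split; [exact: A_neq0|exists 0; exact: A_ge0]. Qed.

Lemma quantile_tail : (Q [set w | (t < Y w)%R] <= alpha%:E)%E.
Proof.
have mS x : measurable [set w | Y w <= x].
  rewrite (_ : [set w | _] = Y @^-1` `]-oo, x]); last first.
    by apply/seteqP; split=> w /=; rewrite in_itv.
  by rewrite -[X in measurable X]setTI; exact: mY.
(* The infimum defining the quantile is attained, by right continuity of the distribution
   function. *)
have key : ((1 - alpha)%:E <= cdf Yv t)%E.
  have rc := @cdf_right_continuous _ _ _ _ Yv t.
  rewrite -(cvg_lim (@ereal_hausdorff R) rc); apply: lime_ge.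
    by apply/cvg_ex; exists (cdf Yv t); exact: rc.
  near=> x.
  have tx : 0 < x - t by rewrite subr_gt0; near: x; exact: nbhs_right_gt.
  have [y Ay yx] := inf_adherent tx hasA.
  apply: le_trans Ay _; rewrite cdfE; apply: le_measure; rewrite ?inE//.
  move=> w /= /le_trans; apply.
  by move: yx; rewrite -[inf A]/t; lra.
rewrite (_ : [set w | t < Y w] = ~` [set w | Y w <= t]); last first.
  by apply/seteqP; split=> w /=; rewrite ltNge => /negP.
rewrite probability_setC//.
rewrite leeBlDr// -?cdfE; last by rewrite cdfE fin_num_measure.
apply: le_trans (_ : _ <= alpha%:E + (1 - alpha)%:E)%E _.
  by rewrite -EFinD lee_fin; lra.
by rewrite leeD2l.
Unshelve. all: by end_near.
Qed.

End quantile_bounds.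

Section lipschitz_measurable.
Context {R : realType} {d : measure_display} {T : measurableType d}.
Variables (Q : probability T R) (D : nat) (g : nat -> T -> R) (Sig : nat -> nat -> R).
Hypothesis gv : gaussian_vector Q D g Sig.

(** Lipschitz functions are pointwise limits of their Bernstein polynomials, whose measurability
    reduces to that of linear forms. *)
Lemma lipschitz_measurable (F : (nat -> R) -> R) (L : R) : 0 <= L ->
  (forall y z, `|F y - F z| <= L * \sum_(k < D) `|y k - z k|) ->
  measurable_fun setT (fun w => F (g ^~ w)).
Proof.
move=> L0 LF.
(* With a = 1 / (n + 1) and N = (n + 1)^4, both a and 1 / (a sqrt N) equal 1 / (n + 1). *)
pose a n : R := n.+1%:R^-1.
pose h n (w : T) := bern D (n.+1 ^ 4) (a n) F (g ^~ w).
apply: (@measurable_fun_cvg _ _ _ setT h).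
  move=> n; have := trig_measurable gv (fun=> 0) 0 (trig_bern D (n.+1 ^ 4) (a n) F).
  rewrite (_ : (fun w => _) = h n)//; apply/funext => w; rewrite /h; congr bern.
  by apply/funext => k; rewrite mul0r addr0.
move=> w _; apply/cvgrPdist_le => /= e e0.
pose C := L * \sum_(k < D) (g k w ^+ 2 + 1).
have C0 : 0 <= C.
  by rewrite mulr_ge0// sumr_ge0// => k _; rewrite addr_ge0// sqr_ge0.
have : C * n.+1%:R^-1 @[n --> \oo] --> (0 : R).
  by rewrite -[X in _ --> X](mulr0 C); apply: cvgMr; exact: cvg_harmonic.
move/cvgrPdist_le => /(_ _ e0); apply: filterS => n /=.
rewrite sub0r normrN => /(le_trans (ler_norm _)); apply: le_trans.
have n0 : 0 < n.+1%:R :> R by rewrite ltr0Sn.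
have a0 : 0 < a n by rewrite invr_gt0.
have N0 : (0 < n.+1 ^ 4)%N by rewrite expn_gt0.
have H := bern_approx a0 N0 L0 LF (g ^~ w).
rewrite distrC; apply: (le_trans H).
rewrite /C -mulrA ler_wpM2l// mulr_suml; apply: ler_sum => k _.
have -> : Num.sqrt ((n.+1 ^ 4)%:R) = n.+1%:R ^+ 2 :> R.
  by rewrite natrX -[4%N]/(2 * 2)%N exprM sqrtr_sqr ger0_norm// exprn_ge0// ltW.
rewrite mulrDl [_ * n.+1%:R^-1]mulrC lerD2l mul1r /a.
by rewrite le_eqVlt; apply/orP; left; apply/eqP; move: (n.+1%:R : R) n0 => x x0; field; exact: lt0r_neq0.
Qed.

End lipschitz_measurable.

(** * Comparison of the empirical and Gaussian laws *)

Section variance_forms.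
Context {R : realType}.

(** Variance of [u] under the weights [p]; at the empirical pmf it is the quadratic form of the
    covariance. *)
Definition vform (D : nat) (p u : nat -> R) : R :=
  \sum_(k < D) p k * u k ^+ 2 - (\sum_(k < D) p k * u k) ^+ 2.

Lemma vform_centered D (p u : nat -> R) : \sum_(k < D) p k = 1 ->
  \sum_(k < D) p k * (u k - \sum_(k < D) p k * u k) ^+ 2 = vform D p u.
Proof.
move=> p1; rewrite /vform; set ub := \sum_(k < D) p k * u k.
transitivity (\sum_(k < D) (p k * u k ^+ 2 - (2 * ub) * (p k * u k) + ub ^+ 2 * p k)).
  by apply: eq_bigr => k _; ring.
by rewrite big_split/= sumrB -!mulr_sumr p1 -/ub; ring.
Qed.

Lemma vform_close D (p p' u : nat -> R) (r : R) :
  (forall k, (k < D)%N -> `|p k| <= 1) -> (forall k, (k < D)%N -> `|p' k| <= 1) ->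
  (forall k, (k < D)%N -> `|p k - p' k| <= r) ->
  `|vform D p u - vform D p' u| <=
  r * (\sum_(k < D) u k ^+ 2 + 2 * (\sum_(k < D) `|u k|) ^+ 2).
Proof.
move=> p1 p1' pr.
have su0 : 0 <= \sum_(k < D) `|u k| by apply: sumr_ge0.
have su (q : nat -> R) : (forall k, (k < D)%N -> `|q k| <= 1) ->
    `|\sum_(k < D) q k * u k| <= \sum_(k < D) `|u k|.
  move=> q1; apply: le_trans (ler_norm_sum _ _ _) _; apply: ler_sum => k _.
  by rewrite normrM ler_piMl// q1.
have hd : `|\sum_(k < D) (p k - p' k) * u k| <= r * \sum_(k < D) `|u k|.
  apply: le_trans (ler_norm_sum _ _ _) _; rewrite mulr_sumr; apply: ler_sum => k _.
  by rewrite normrM ler_wpM2r// pr.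
have hd2 : `|\sum_(k < D) (p k - p' k) * u k ^+ 2| <= r * \sum_(k < D) u k ^+ 2.
  apply: le_trans (ler_norm_sum _ _ _) _; rewrite mulr_sumr; apply: ler_sum => k _.
  by rewrite normrM (ger0_norm (sqr_ge0 _)) ler_wpM2r ?sqr_ge0// pr.
have -> : vform D p u - vform D p' u =
  \sum_(k < D) (p k - p' k) * u k ^+ 2 -
  (\sum_(k < D) (p k - p' k) * u k) * (\sum_(k < D) p k * u k + \sum_(k < D) p' k * u k).
  have -> : \sum_(k < D) (p k - p' k) * u k ^+ 2 =
     \sum_(k < D) p k * u k ^+ 2 - \sum_(k < D) p' k * u k ^+ 2.
    by rewrite -sumrB; apply: eq_bigr => k _; rewrite mulrBl.
  have -> : \sum_(k < D) (p k - p' k) * u k =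
     \sum_(k < D) p k * u k - \sum_(k < D) p' k * u k.
    by rewrite -sumrB; apply: eq_bigr => k _; rewrite mulrBl.
  rewrite /vform; ring.
apply: le_trans (ler_normB _ _) _; rewrite [leRHS]mulrDr; apply: lerD => //.
rewrite normrM.
have h2 : `|\sum_(k < D) p k * u k + \sum_(k < D) p' k * u k| <= 2 * \sum_(k < D) `|u k|.
  by apply: le_trans (ler_normD _ _) _; rewrite mulr_natl mulr2n; apply: lerD; exact: su.
apply: le_trans (ler_pM (normr_ge0 _) (normr_ge0 _) hd h2) _.
by rewrite le_eqVlt; apply/orP; left; apply/eqP; ring.
Qed.

Lemma expRN_lip (x y : R) : 0 <= x -> 0 <= y -> `|expR (- x) - expR (- y)| <= `|x - y|.
Proof.
wlog xy : x y / x <= y.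
  move=> H x0 y0; have [xy|yx] := leP x y; first exact: H.
  by rewrite distrC [leRHS]distrC; apply: H => //; exact: ltW.
move=> x0 y0.
have e1 : expR (- x) <= 1 by rewrite -expR0 ler_expR oppr_le0.
have e2 : expR (- y) = expR (- x) * expR (- (y - x)) by rewrite -expRD; congr expR; ring.
have h := expR_ge1Dx (- (y - x)).
have e3 : expR (- y) <= expR (- x) by rewrite ler_expR lerN2.
rewrite ger0_norm ?subr_ge0// ler0_norm ?subr_le0//.
have := ler_wpM2l (expR_ge0 (- x)) h; rewrite -e2 => h'.
have xy' : 0 <= y - x by rewrite subr_ge0.
have := ler_wpM2r xy' e1; lra.
Qed.

End variance_forms.

Section sigma_form.
Context {R : realType}.
Variables (s : seq nat) (m : nat).
Hypothesis s0 : (0 < size s)%N.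
Hypothesis sm : smax s = m.
Local Notation e := (@emp R s).
Local Notation D := m.+2.

Lemma emp_sum_ord : \sum_(k < D) e k = 1.
Proof. by rewrite -(big_mkord xpredT e) emp_sum// sm. Qed.

Let Sigma_row (i : 'I_D) (v : nat -> R) :
  \sum_(j < D) Sigma s i j * v j = e i * v i - e i * \sum_(j < D) e j * v j.
Proof.
rewrite /Sigma; under eq_bigr do rewrite mulrBl.
rewrite sumrB (bigD1 i)//= eqxx mul1r big1 ?addr0; last first.
  by move=> j ji; rewrite eq_sym (_ : (j == i :> nat) = false) ?mul0r// ?mul0r//; exact/negbTE.
by rewrite mulr_sumr; congr (_ - _); apply: eq_bigr => j _; rewrite mulrA.
Qed.

Lemma Sigma_qform (u : nat -> R) : qform D (Sigma s) u = vform D e u.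
Proof.
rewrite /qform.
transitivity (\sum_(i < D) u i * (\sum_(j < D) Sigma s i j * u j)).
  by apply: eq_bigr => i _; rewrite mulr_sumr; apply: eq_bigr => j _; ring.
under eq_bigr do rewrite Sigma_row.
rewrite /vform expr2 mulr_suml -sumrB; apply: eq_bigr => i _; ring.
Qed.

Lemma Sigma_psd (u : nat -> R) : 0 <= qform D (Sigma s) u.
Proof.
rewrite Sigma_qform -vform_centered ?emp_sum_ord//.
by apply: sumr_ge0 => k _; rewrite mulr_ge0 ?sqr_ge0// emp_ge0.
Qed.

Lemma Sigma_sym i j : Sigma s i j = Sigma s j i :> R.
Proof. by rewrite /Sigma eq_sym; case: eqVneq => [->//|_]; rewrite !mul0r mulrC. Qed.

Variable dir : nat -> R.
Hypothesis dir0 : \sum_(k < D) dir k = 0.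
Hypothesis dire : forall k, (k < D)%N -> e k = 0 -> dir k = 0.

Let emp_div k : (k < D)%N -> e k * (dir k / e k) = dir k.
Proof.
move=> kD; have [e0|e0] := eqVneq (e k) 0; first by rewrite dire// !mul0r mulr0.
by rewrite mulrCA divff// mulr1.
Qed.

(** The covariance sends v to e (v - mean of v under e). For v = dir / e that mean is the sum of
    [dir], which is 0. *)
Lemma Sigma_range i : (i < D)%N -> dir i = \sum_(j < D) Sigma s i j * (dir j / e j).
Proof.
move=> iD; rewrite (Sigma_row (Ordinal iD) (fun j => dir j / e j))/= emp_div//.
by under eq_bigr do rewrite emp_div//; rewrite dir0 mulr0 subr0.
Qed.

Lemma Sigma_range_qform :
  qform D (Sigma s) (fun k => dir k / e k) = \sum_(k < D) dir k ^+ 2 / e k.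
Proof.
rewrite /qform.
transitivity (\sum_(i < D) dir i / e i * (\sum_(j < D) Sigma s i j * (dir j / e j))).
  by apply: eq_bigr => i _; rewrite mulr_sumr; apply: eq_bigr => j _; ring.
by apply: eq_bigr => i _; rewrite -Sigma_range// mulrAC -expr2.
Qed.

End sigma_form.

Section direction.
Context {R : realType}.
Variable m : nat.

Let wt (k : nat) : R := m.+1%:R - k%:R.
(** The mean of k under the weights m + 1 - k, the one root for which [dirv] sums to 0. *)
Let shift : R := (\sum_(k < m.+1) k%:R * wt k) / (\sum_(k < m.+1) wt k).

(* Quadratic, hence interior to the cone; it vanishes at [m + 1] and has zero sum,
   hence it lies in the range of the covariance. *)
Definition dirv (k : nat) : R := (k%:R - m.+1%:R) * (k%:R - shift).

Lemma dirv_last : dirv m.+1 = 0.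
Proof. by rewrite /dirv subrr mul0r. Qed.

Lemma dirv_sum : \sum_(k < m.+2) dirv k = 0.
Proof.
rewrite big_ord_recr/= dirv_last addr0.
have w0 : \sum_(k < m.+1) wt k != 0.
  rewrite lt0r_neq0//; apply: lt_le_trans (_ : wt 0%N <= _); first by rewrite /wt subr0 ltr0Sn.
  rewrite big_ord_recl/= lerDl; apply: sumr_ge0 => i _.
  by rewrite /wt subr_ge0 ler_nat /bump /= add1n ltnS ltnW// ltnS ltn_ord.
transitivity (shift * (\sum_(k < m.+1) wt k) - \sum_(k < m.+1) k%:R * wt k).
  rewrite mulr_sumr -sumrB; apply: eq_bigr => k _; rewrite /dirv /wt; ring.
by rewrite /shift divfK// subrr.
Qed.

Lemma dirv_D2 x : (1 <= x)%N -> D2 dirv x = 2.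
Proof.
case: x => // x _; rewrite /D2 /dirv /= -(natr1 x.+1) -(natr1 x).
move: (m.+1%:R) shift (x%:R : R) => a b c; ring.
Qed.

End direction.

(** * Means of trigonometric and Bernstein polynomials *)

Section gaussian_comparison.
Context {R : realType} {d' : measure_display} {T' : measurableType d'}.
Variables (Q : probability T' R) (G : seq nat -> nat -> T' -> R).
Hypothesis gG : forall s : seq nat, gaussian_vector Q (gdim s) (G s) (Sigma s).
Variables (p0 : nat -> R) (m : nat).
Hypothesis cp0 : convex_pmf p0.
Hypothesis p0z : forall j, (m < j)%N -> p0 j = 0.
Local Notation D := m.+2.
Local Notation w := (@p0w R p0 m).
Local Notation ydev t := (scaled_dev p0 (map val (t : seq 'I_m.+1))).

Definition good_sample (r : R) (s : seq nat) :=
  [/\ (0 < size s)%N, smax s = m & sqn D (fun k => @emp R s k - p0 k) <= r ^+ 2].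

Let p0_ge0 j : 0 <= p0 j. Proof. by case: cp0 => -[]. Qed.

Let p0_sumD : \sum_(k < D) p0 k = 1.
Proof. by rewrite -(big_mkord xpredT p0) (p0_sum cp0 p0z). Qed.

Let p0_le1 k : `|p0 k| <= 1.
Proof.
rewrite ger0_norm//; apply: le_trans (@pmf_sum_le1 R p0 k.+1 _); last by case: cp0.
exact: sum_nat_coord.
Qed.

Lemma p0w_ge0 j : 0 <= w j. Proof. exact: p0_ge0. Qed.

Lemma p0w_sum : \sum_j w j = 1.
Proof. by move: p0_sumD; rewrite big_ord_recr/= (p0z (ltnSn m)) addr0. Qed.

Let p0_dotE (u : nat -> R) : \sum_(k < D) p0 k * u k = \sum_(j < m.+1) p0 j * u j.
Proof. by rewrite big_ord_recr/= (p0z (ltnSn m)) mul0r addr0. Qed.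

Let c_ (u : nat -> R) (j : 'I_m.+1) : R := u j - \sum_(k < D) p0 k * u k.

Let c_sum u : \sum_j w j * c_ u j = 0.
Proof.
rewrite /c_; under eq_bigr do rewrite mulrBr.
by rewrite sumrB -mulr_suml p0w_sum mul1r p0_dotE subrr.
Qed.

Let c_sqr u : \sum_j w j * c_ u j ^+ 2 = vform D p0 u.
Proof.
rewrite -vform_centered ?p0_sumD// [RHS]big_ord_recr/= (p0z (ltnSn m)) mul0r addr0.
by apply: eq_bigr => j _.
Qed.

Let sum_count (u : nat -> R) (s : seq nat) : all (fun i => i < D)%N s ->
  \sum_(k < D) u k * (count_mem (k : nat) s)%:R = \sum_(j <- s) u j.
Proof.
elim: s => [_|i s IH /= /andP[iD /IH IHs]].
  by rewrite big_nil big1// => k _; rewrite mulr0.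
rewrite big_cons -IHs; under eq_bigr do rewrite natrD mulrDr.
rewrite big_split/=; congr (_ + _).
rewrite (bigD1 (Ordinal iD))//= eqxx mulr1 big1 ?addr0// => k ki.
rewrite (_ : (i == k :> nat) = false) ?mulr0//.
by apply/negbTE; apply: contra ki => /eqP ki; apply/eqP/val_inj.
Qed.

Lemma dotp_ydev (u : nat -> R) n (t : n.-tuple 'I_m.+1) : (0 < n)%N ->
  dotp D u (ydev t) = (Num.sqrt n%:R)^-1 * \sum_(j <- t) c_ u j.
Proof.
move=> n0.
have nR : 0 < n%:R :> R by rewrite ltr0n.
set sn := Num.sqrt n%:R.
have sn0 : 0 < sn by rewrite sqrtr_gt0.
have snK : n%:R = sn ^+ 2 by rewrite sqr_sqrtr// ltW.
have szE : size (map val t) = n by rewrite size_map size_tuple.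
transitivity (sn * ((\sum_(j <- t) u (val j)) / n%:R - \sum_(k < D) p0 k * u k)).
  rewrite /dotp /scaled_dev szE -/sn.
  transitivity (sn * (\sum_(k < D) u k * @emp R (map val t) k - \sum_(k < D) p0 k * u k)).
    by rewrite -sumrB mulr_sumr; apply: eq_bigr => k _; ring.
  congr (_ * (_ - _)); rewrite /emp szE.
  under eq_bigr do rewrite mulrA.
  rewrite -mulr_suml sum_count ?big_map//.
  by apply/allP => _ /mapP[j _ ->]; exact: ltn_trans (ltn_ord j) (ltnSn _).
rewrite /c_ sumrB big_const_seq count_predT size_tuple iter_addr_0.
rewrite -[(\sum_(k < D) _) *+ n]mulr_natl; move: snK sn0; clearbody sn => -> s0.
by move: (\sum_(j <- t) _) (\sum_(k < D) _) => a b; field; exact: lt0r_neq0.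
Qed.

Lemma Ex_ydev_sqr n k : (0 < n)%N -> (k < D)%N ->
  Ex w n (fun t => ydev t k ^+ 2) <= 1.
Proof.
move=> n0 kD.
have nR : 0 < n%:R :> R by rewrite ltr0n.
pose u := fun i : nat => (i == k)%:R : R.
have -> : Ex w n (fun t => ydev t k ^+ 2) =
    n%:R^-1 * Ex w n (fun t => (0 + \sum_(j <- t) c_ u j) ^+ 2).
  rewrite -ExZ; apply: eq_bigr => t _; congr (_ * _).
  have := dotp_ydev u t n0; rewrite dotp_delta// => ->.
  by rewrite exprMn exprVn sqr_sqrtr ?add0r// ltW.
rewrite (Ex_sqr p0w_sum (c_sum u)) expr0n add0r mulrA mulVf ?mul1r ?lt0r_neq0// c_sqr.
rewrite /vform lerBlDr.
apply: le_trans (_ : _ <= \sum_(k < D) p0 k) _; last by rewrite p0_sumD lerDl sqr_ge0.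
apply: ler_sum => i _; rewrite ler_piMr// /u.
by case: eqP => _; rewrite ?expr1n ?expr0n.
Qed.

Lemma good_coord r s k : 0 <= r -> good_sample r s -> (k < D)%N -> `|@emp R s k - p0 k| <= r.
Proof.
move=> r0 [_ _ h] kD; apply: le_trans (coord_le_nrm (fun k => @emp R s k - p0 k) kD) _.
exact: le_nrm.
Qed.

Section good.
Variables (s : seq nat) (r : R).
Hypothesis gs : good_sample r s.

Let sz : (0 < size s)%N. Proof. by case: gs. Qed.
Let sm : smax s = m. Proof. by case: gs. Qed.

Lemma good_gaussian : gaussian_vector Q D (G s) (Sigma s).
Proof. by have := gG s; rewrite /gdim sm. Qed.

Lemma good_psd (u : nat -> R) : 0 <= qform D (Sigma s) u.
Proof. exact: Sigma_psd. Qed.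

End good.

(** The tuple that is averaged over and the sample [s] that fixes the Gaussian law are unrelated, so
    [s] may later be the one of smallest quantile. *)
Definition mean_close (f : (nat -> R) -> R) := forall eps : R, 0 < eps ->
  exists N0 : nat, exists2 r : R, 0 < r & forall n s, (N0 <= n)%N -> good_sample r s ->
  `|Ex w n (fun t => f (ydev t)) - \int[Q]_x f (G s ^~ x)| <= eps.

(** Half of eps pays for the passage to a Gaussian with the variance under p0 ([N0]), the other half
    for replacing p0 by the empirical pmf of [s] in that variance ([r]). *)
Lemma mean_close_cos u b : mean_close (fun y => cos (dotp D u y + b)).
Proof.
move=> eps eps0.
pose C1 := (\sum_j w j * `|c_ u j| ^+ 3) / 2 + (\sum_j w j * c_ u j ^+ 4) / 2 + vform D p0 u ^+ 2 / 4.
pose C2 := \sum_(k < D) u k ^+ 2 + 2 * (\sum_(k < D) `|u k|) ^+ 2.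
have v0 : 0 <= vform D p0 u.
  by rewrite -c_sqr; apply: sumr_ge0 => j _; rewrite mulr_ge0 ?p0w_ge0 ?sqr_ge0.
have C20 : 0 <= C2.
  apply: addr_ge0; first by apply: sumr_ge0 => k _; exact: sqr_ge0.
  by apply: mulr_ge0 => //; exact: sqr_ge0.
have C10 : 0 <= C1.
  apply: addr_ge0; last by rewrite divr_ge0// sqr_ge0.
  apply: addr_ge0; rewrite divr_ge0//; apply: sumr_ge0 => j _.
    by apply: mulr_ge0; [exact: p0w_ge0|exact: exprn_ge0].
  apply: mulr_ge0; first exact: p0w_ge0.
  by rewrite -[4%N]/(2 * 2)%N exprM sqr_ge0.
have [N1 HN1] : exists N1 : nat, 2 * C1 / eps < N1%:R.
  by exists (Num.truncn (2 * C1 / eps)).+1; exact: truncnS_gt.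
exists (maxn 1 (N1 ^ 2)), (eps / (C2 + 1)).
  by rewrite divr_gt0//; lra.
set r := eps / (C2 + 1).
have r0 : 0 <= r by rewrite divr_ge0 ?(ltW eps0)//; lra.
move=> n s; rewrite geq_max => /andP[n1 nN] gs.
have [sz sm hs] := gs.
rewrite (gaussian_cos (good_gaussian gs) (good_psd gs)) Sigma_qform//.
have -> : Ex w n (fun t => cos (dotp D u (ydev t) + b)) =
   Ex w n (fun t => cos (b + (Num.sqrt n%:R)^-1 * \sum_(j <- t) c_ u j)).
  by apply: eq_bigr => t _; rewrite dotp_ydev// addrC.
have H1 := @Ex_cos_clt R _ w p0w_ge0 p0w_sum (c_ u) (c_sum u) n b n1.
rewrite c_sqr -/C1 in H1.
have sn : N1%:R <= Num.sqrt n%:R :> R.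
  rewrite -[leLHS]ger0_norm// -sqrtr_sqr ler_sqrt// -natrX ler_nat//.
have sn0 : 0 < Num.sqrt n%:R :> R by rewrite sqrtr_gt0 ltr0n.
have H2 : C1 / Num.sqrt n%:R <= eps / 2.
  rewrite ler_pdivrMr//; apply: le_trans (_ : _ <= eps / 2 * N1%:R) _; last first.
    by apply: ler_wpM2l => //; lra.
  by move: HN1; rewrite ltr_pdivrMr//; lra.
have es1 k : (k < D)%N -> `|@emp R s k| <= 1.
  by move=> _; rewrite ger0_norm ?emp_ge0// emp_le1.
have H3 := @vform_close R D (@emp R s) p0 u r es1 (fun k _ => p0_le1 k)
  (fun k kD => good_coord r0 gs kD).
have ev0 : 0 <= vform D (@emp R s) u by rewrite -Sigma_qform//; exact: (good_psd gs).
have H4 : `|cos b * expR (- (vform D p0 u / 2)) - cos b * expR (- (vform D (emp s) u / 2))| <= eps / 2.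
  rewrite -mulrBr normrM.
  have cb : `|cos b| <= 1 by rewrite ler_norml cos_geN1 cos_le1.
  have h := @expRN_lip R (vform D p0 u / 2) (vform D (emp s) u / 2)
     (divr_ge0 v0 (ler0n _ _)) (divr_ge0 ev0 (ler0n _ _)).
  apply: le_trans (ler_pM (normr_ge0 _) (normr_ge0 _) cb h) _.
  rewrite mul1r -mulrBl normrM distrC (ger0_norm (_ : 0 <= 2^-1))//.
  apply: ler_wpM2r => //; apply: le_trans H3 _.
  rewrite -/C2 /r mulrAC ler_pdivrMr; last by lra.
  by apply: ler_wpM2l; lra.
have -> : Ex w n (fun t => cos (b + (Num.sqrt n%:R)^-1 * \sum_(j <- t) c_ u j)) -
    cos b * expR (- (vform D (emp s) u / 2)) =
  (Ex w n (fun t => cos (b + (Num.sqrt n%:R)^-1 * \sum_(j <- t) c_ u j)) -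
    cos b * expR (- (vform D p0 u / 2))) +
  (cos b * expR (- (vform D p0 u / 2)) - cos b * expR (- (vform D (emp s) u / 2))) by ring.
apply: le_trans (ler_normD _ _) _; lra.
Qed.

Lemma good_sample_le r r' s : 0 <= r -> r <= r' -> good_sample r s -> good_sample r' s.
Proof.
move=> r0 rr [h1 h2 h3]; split=> //; apply: le_trans h3 _.
by rewrite ler_sqr ?nnegrE//; apply: le_trans rr.
Qed.

Lemma trig_integrable0 r s f : good_sample r s -> trig D f ->
  Q.-integrable setT (EFin \o (fun x => f (G s ^~ x))).
Proof.
move=> gs tf; have := trig_integrable (good_gaussian gs) (fun=> 0) 0 tf.
rewrite (_ : (fun x => _) = (fun x => f (G s ^~ x)))//.
by apply/funext => x; congr f; apply/funext => k; rewrite mul0r addr0.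
Qed.

Lemma trig_mean_close f : trig D f -> mean_close f.
Proof.
elim=> [u b|f1 f2 t1 H1 t2 H2|c f1 t1 H1].
- exact: mean_close_cos.
- move=> eps eps0; have e2 : 0 < eps / 2 by rewrite divr_gt0.
  have [N1 [r1 r10 h1]] := H1 _ e2; have [N2 [r2 r20 h2]] := H2 _ e2.
  exists (maxn N1 N2), (Num.min r1 r2); first by rewrite lt_min r10.
  move=> n s; rewrite geq_max => /andP[n1 n2] gs.
  have m0 : 0 <= Num.min r1 r2 by rewrite le_min !ltW.
  have g1 : good_sample r1 s by apply: good_sample_le gs => //; rewrite ge_min lexx.
  have g2 : good_sample r2 s by apply: good_sample_le gs => //; rewrite ge_min lexx orbT.
  rewrite (ExD w n (fun t => f1 (ydev t)) (fun t => f2 (ydev t))) RintegralD//;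
    [|exact: trig_integrable0 g1 t1|exact: trig_integrable0 g1 t2].
  rewrite opprD addrACA; apply: le_trans (ler_normD _ _) _.
  have := h1 n s n1 g1; have := h2 n s n2 g2; lra.
- move=> eps eps0; have c0 : 0 < `|c| + 1 by have := normr_ge0 c; lra.
  have e2 : 0 < eps / (`|c| + 1) by rewrite divr_gt0.
  have [N1 [r1 r10 h1]] := H1 _ e2; exists N1, r1 => // n s n1 g1.
  rewrite (ExZ w n c (fun t => f1 (ydev t))) RintegralZl//; last exact: trig_integrable0 g1 t1.
  rewrite -mulrBr normrM; apply: le_trans (ler_wpM2l (normr_ge0 c) (h1 n s n1 g1)) _.
  rewrite mulrA ler_pdivrMr// mulrC ler_wpM2l// ?(ltW eps0)//; lra.
Qed.

Lemma trig_family_close (I : eqType) (F : I -> (nat -> R) -> R) (l : seq I) :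
  (forall i, trig D (F i)) -> forall eps : R, 0 < eps ->
  exists N0 : nat, exists2 r : R, 0 < r & forall n s, (N0 <= n)%N -> good_sample r s ->
  forall i, i \in l -> `|Ex w n (fun t => F i (ydev t)) - \int[Q]_x F i (G s ^~ x)| <= eps.
Proof.
move=> tF eps eps0; elim: l => [|i l [N1 [r1 r10 h1]]]; first by exists 0%N, 1.
have [N2 [r2 r20 h2]] := trig_mean_close (tF i) eps0.
exists (maxn N1 N2), (Num.min r1 r2); first by rewrite lt_min r10.
move=> n s; rewrite geq_max => /andP[n1 n2] gs.
have m0 : 0 <= Num.min r1 r2 by rewrite le_min !ltW.
have g1 : good_sample r1 s by apply: good_sample_le gs => //; rewrite ge_min lexx.
have g2 : good_sample r2 s by apply: good_sample_le gs => //; rewrite ge_min lexx orbT.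
move=> j; rewrite inE => /orP[/eqP ->|jl]; first exact: h2.
exact: h1.
Qed.

(** Uniform in [phi]: only finitely many polynomials [gridw] are compared, and [phi] contributes
    coefficients bounded by 1. *)
Lemma bern_mean_close N (a : R) (eps : R) : 0 < eps ->
  exists N0 : nat, exists2 r : R, 0 < r & forall n s, (N0 <= n)%N -> good_sample r s ->
  forall phi, (forall y, `|phi y| <= 1) ->
  `|Ex w n (fun t => bern D N a phi (ydev t)) - \int[Q]_x bern D N a phi (G s ^~ x)| <= eps.
Proof.
move=> eps0; pose I := {ffun 'I_D -> N.-tuple bool}.
pose K : R := #|{: I}|%:R + 1.
have K0 : 0 < K by rewrite /K; have := ler0n R #|{: I}|; lra.
have eK : 0 < eps / K by rewrite divr_gt0.
have [N0 [r r0 h]] := trig_family_close (index_enum I) (fun f => trig_gridw a f) eK.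
exists N0, r => // n s nN gs phi phi1.
rewrite /bern (Ex_sum w n (index_enum I) (fun f t => @gridw R D N a (ydev t) f * phi (@gridpt R D N a f))).
have ig (f : I) : Q.-integrable setT (EFin \o (fun x => @gridw R D N a (G s ^~ x) f)).
  exact: (trig_integrable0 gs (trig_gridw a f)).
have -> : \int[Q]_x (\sum_(f : I) @gridw R D N a (G s ^~ x) f * phi (@gridpt R D N a f)) =
   \sum_(f : I) (\int[Q]_x @gridw R D N a (G s ^~ x) f) * phi (@gridpt R D N a f).
  rewrite Rintegral_sum; last by move=> f; under eq_fun do rewrite mulrC; exact: RintegrableZl.
  by apply: eq_bigr => f _; rewrite RintegralZr.
rewrite -sumrB; apply: le_trans (ler_norm_sum _ _ _) _.
apply: le_trans (_ : _ <= \sum_(f : I) eps / K) _.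
  apply: ler_sum => f _.
  have -> : Ex w n (fun t => @gridw R D N a (ydev t) f * phi (@gridpt R D N a f)) =
     Ex w n (fun t => @gridw R D N a (ydev t) f) * phi (@gridpt R D N a f).
    by rewrite mulrC -ExZ; apply: eq_Ex => t; rewrite mulrC.
  rewrite -mulrBl normrM; apply: le_trans (ler_pM (normr_ge0 _) (normr_ge0 _) (h n s nN gs f _) (phi1 _)) _.
    by rewrite mem_index_enum.
  by rewrite mulr1.
rewrite sumr_const -mulr_natl mulrCA; apply: ler_piMr; first exact: ltW.
by rewrite ler_pdivrMr// mul1r /K lerDl.
Qed.

End gaussian_comparison.

Section smoothing.
Context {R : realType} {d' : measure_display} {T' : measurableType d'}.
Variables (Q : probability T' R) (G : seq nat -> nat -> T' -> R).
Hypothesis gG : forall s : seq nat, gaussian_vector Q (gdim s) (G s) (Sigma s).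
Variables (p0 : nat -> R) (m : nat).
Hypothesis cp0 : convex_pmf p0.
Hypothesis p0m : 0 < p0 m.
Hypothesis p0z : forall j, (m < j)%N -> p0 j = 0.
Local Notation D := m.+2.
Local Notation w := (@p0w R p0 m).
Local Notation ydev t := (scaled_dev p0 (map val (t : seq 'I_m.+1))).
Local Notation good := (good_sample p0 m).
Local Notation cd := (cdist D (flat p0 m)).

Let w0 (j : 'I_m.+1) : 0 <= w j := p0w_ge0 cp0 j.
Let w1 := p0w_sum cp0 p0z.

Lemma bern_error_small (c : nat -> R) (L eps : R) : 0 <= L -> 0 < eps ->
  (forall k, 0 <= c k) -> exists a : R, exists N : nat,
  [/\ 0 < a, (0 < N)%N &
      L * \sum_(k < D) (a * c k + (a * Num.sqrt N%:R)^-1) <= eps].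
Proof.
move=> L0 e0 c0.
pose A := L * \sum_(k < D) c k.
have A0 : 0 <= A by rewrite mulr_ge0// sumr_ge0.
(* The scale a settles the bias; N is chosen afterwards, because a small a inflates the other
   term. *)
pose a := eps / (2 * (A + 1)).
have a0 : 0 < a by rewrite divr_gt0//; lra.
pose B := L * D%:R / a.
have B0 : 0 <= B by apply: divr_ge0; [exact: mulr_ge0|exact: ltW].
pose K := (Num.truncn (2 * B / eps)).+1.
have HK : 2 * B / eps < K%:R by exact: truncnS_gt.
exists a, (K ^ 2)%N; split=> //.
rewrite natrX sqrtr_sqr (ger0_norm (ler0n _ K)).
have K0 : 0 < K%:R :> R by rewrite ltr0Sn.
rewrite big_split/= -mulr_sumr sumr_const card_ord.
rewrite -[(a * K%:R)^-1 *+ D]mulr_natl mulrDr mulrCA -/A.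
have -> : L * (D%:R * (a * K%:R)^-1) = B / K%:R by rewrite invfM /B !mulrA.
have h1 : a * A <= eps / 2.
  rewrite /a -mulrA invfM -!mulrA; apply: ler_wpM2l; first exact: ltW.
  by rewrite ler_piMr// mulrC ler_pdivrMr; lra.
have h2 : B / K%:R <= eps / 2.
  rewrite ler_pdivrMr//; move: HK; rewrite ltr_pdivrMr//; lra.
lra.
Qed.

Lemma Ex_bern_approx n (a : R) N (phi : (nat -> R) -> R) (L : R) :
  0 < a -> (0 < N)%N -> (0 < n)%N -> 0 <= L ->
  (forall y z, `|phi y - phi z| <= L * \sum_(k < D) `|y k - z k|) ->
  `|Ex w n (fun t => bern D N a phi (ydev t)) - Ex w n (fun t => phi (ydev t))|
  <= L * \sum_(k < D) (a + (a * Num.sqrt N%:R)^-1).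
Proof.
move=> a0 N0 n0 L0 Lphi.
have -> : Ex w n (fun t => bern D N a phi (ydev t)) - Ex w n (fun t => phi (ydev t)) =
    Ex w n (fun t => bern D N a phi (ydev t) - phi (ydev t)).
  rewrite (ExD w n (fun t => bern D N a phi (ydev t)) (fun t => - phi (ydev t))).
  congr (_ + _); rewrite -mulN1r -ExZ; apply: eq_Ex => t; rewrite mulN1r//.
apply: le_trans (Ex_norm w0 _ _) _.
set b := (a * Num.sqrt N%:R)^-1.
apply: le_trans (_ : _ <= Ex w n (fun t => L * \sum_(k < D) (a * ydev t k ^+ 2 + b))) _.
  by apply: (Ex_le w0) => t; exact: bern_approx.
rewrite ExZ (Ex_sum w n _ (fun (k : 'I_D) t => a * ydev t k ^+ 2 + b)).
apply: ler_wpM2l => //; apply: ler_sum => k _.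
rewrite (Ex_affine w1 n a b (fun t => ydev t k ^+ 2)) lerD2r ler_piMr//; first exact: ltW.
exact: Ex_ydev_sqr.
Qed.

Section fixed_sample.
Variables (s : seq nat) (r : R).
Hypothesis gs : good r s.
Let sz : (0 < size s)%N. Proof. by case: gs. Qed.
Let sm : smax s = m. Proof. by case: gs. Qed.
Let gv : gaussian_vector Q D (G s) (Sigma s) := good_gaussian gG gs.

Let lip_shift (phi : (nat -> R) -> R) (L : R) (e : nat -> R) (t : R) :
  (forall y z, `|phi y - phi z| <= L * \sum_(k < D) `|y k - z k|) ->
  forall y z : nat -> R, `|phi (fun k => y k + t * e k) - phi (fun k => z k + t * e k)| <=
    L * \sum_(k < D) `|y k - z k|.
Proof.
move=> Lphi y z; apply: le_trans (Lphi _ _) _.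
rewrite le_eqVlt; apply/orP; left; apply/eqP; congr (_ * _).
by apply: eq_bigr => k _; congr `|_|; ring.
Qed.

Lemma lip_integrable (phi : (nat -> R) -> R) (L : R) (e : nat -> R) (t : R) :
  0 <= L -> (forall y, `|phi y| <= 1) ->
  (forall y z, `|phi y - phi z| <= L * \sum_(k < D) `|y k - z k|) ->
  Q.-integrable setT (EFin \o (fun x => phi (fun k => G s k x + t * e k))).
Proof.
move=> L0 phi1 Lphi.
apply: (@bounded_integrable _ _ _ Q _ 1) => //.
exact: (lipschitz_measurable gv L0 (lip_shift e t Lphi)).
Qed.

Lemma int_bern_approx (a : R) N (phi : (nat -> R) -> R) (L : R) (e : nat -> R) (t : R) :
  0 < a -> (0 < N)%N -> 0 <= L -> (forall y, `|phi y| <= 1) ->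
  (forall y z, `|phi y - phi z| <= L * \sum_(k < D) `|y k - z k|) ->
  `|\int[Q]_x bern D N a phi (fun k => G s k x + t * e k) -
    \int[Q]_x phi (fun k => G s k x + t * e k)|
  <= L * \sum_(k < D) (a * (2 + 2 * (t * e k) ^+ 2) + (a * Num.sqrt N%:R)^-1).
Proof.
move=> a0 N0 L0 phi1 Lphi; set b := (a * Num.sqrt N%:R)^-1.
(* From (g + t e)^2 <= 2 g^2 + 2 (t e)^2; a coordinate of the Gaussian vector has second moment at
   most 1. *)
pose h (k : 'I_D) x : R := (a * 2) * G s k x ^+ 2 + (a * (2 * (t * e k) ^+ 2) + b).
have ic (c : R) : Q.-integrable setT (EFin \o (fun=> c)).
  by apply: (@bounded_integrable _ _ _ Q _ `|c|).
have csq (k : 'I_D) := gaussian_coord_sqr gv (good_psd gs) (Sigma_sym s) (ltn_ord k).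
have ih k : Q.-integrable setT (EFin \o h k).
  by apply: RintegrableD => //; apply: RintegrableZl; case: (csq k).
have iH : Q.-integrable setT (EFin \o (fun x => \sum_(k < D) h k x)) by exact: Rintegrable_sum.
apply: le_trans (_ : _ <= \int[Q]_x (L * \sum_(k < D) h k x)) _.
  apply: Rintegral_dist.
  - exact: (trig_integrable gv e t (trig_bern D N a phi)).
  - exact: lip_integrable L0 phi1 Lphi.
  - exact: RintegrableZl.
  move=> x; apply: le_trans (bern_approx a0 N0 L0 Lphi _) _.
  apply: ler_wpM2l => //; apply: ler_sum => k _; rewrite /h addrA lerD2r -mulrA -mulrDr.
  apply: ler_wpM2l; first exact: ltW.
  by have := sqr_ge0 (G s k x - t * e k); rewrite !expr2; lra.
rewrite RintegralZl//; apply: ler_wpM2l => //.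
rewrite Rintegral_sum//; apply: ler_sum => k _.
have [ik sk] := csq k.
rewrite /h RintegralD//; last exact: RintegrableZl.
rewrite RintegralZl// Rintegral_cst// [X in fine X]probability_setT mulr1 (mulrDr a 2) -[leRHS]addrA lerD2r.
rewrite ler_piMr//; first by have := a0; lra.
apply: le_trans sk _; rewrite /Sigma eqxx mul1r lerBlDr.
apply: le_trans (emp_le1 sz k) _; by rewrite lerDl mulr_ge0// emp_ge0.
Qed.

(** Bounds the constant of [trig_shift] for all good samples at once: the factor 2 comes from emp >=
    p0 / 2 on 0, ..., m. The term at m + 1 is 0, as [dirv] vanishes there. *)
Definition shift_cst : R := 1 + \sum_(k < D) 2 * dirv m k ^+ 2 / p0 k.

Lemma gaussian_shift_le (t : R) (f : (nat -> R) -> R) : 0 <= r -> r <= p0 m / 2 ->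
  0 <= t -> trig D f -> (forall y, `|f y| <= 1) ->
  `|\int[Q]_x f (fun k => G s k x + t * dirv m k) - \int[Q]_x f (G s ^~ x)| <= shift_cst * t.
Proof.
move=> r0 rm t0 tf f1.
have half k : (k <= m)%N -> p0 k / 2 <= @emp R s k.
  move=> km; have kD : (k < D)%N by rewrite ltnS leqW.
  have := good_coord r0 gs kD; rewrite ler_distl => /andP[h _].
  have pk : p0 m <= p0 k.
    by case: cp0 => _ cv; exact: (@convex_nonincreasing_le _ p0 m.+1 cv p0z).
  by move: h; have := rm; lra.
have dire k : (k < D)%N -> @emp R s k = 0 -> dirv m k = 0 :> R.
  rewrite ltnS leq_eqVlt => /orP[/eqP -> _|km e0]; first exact: dirv_last.
  by have := half k km; rewrite e0 => h; have := p0_gt0 cp0 p0m p0z km; lra.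
have dir0 := @dirv_sum R m.
have := trig_shift (v := fun k => dirv m k / emp s k) gv (good_psd gs) (Sigma_sym s) (Sigma_range dir0 dire) t tf f1.
move/le_trans; apply; rewrite (ger0_norm t0); apply: ler_wpM2r => //.
rewrite (Sigma_range_qform dir0 dire) lerD2l; apply: ler_sum => k _.
have [km|] := leqP k m; last first.
  move=> mk; have -> : k = m.+1 :> nat by apply/eqP; rewrite eqn_leq mk andbT -ltnS ltn_ord.
  by rewrite dirv_last expr0n mul0r mulr0 mul0r.
have pk := p0_gt0 cp0 p0m p0z km; have hk := half _ km.
have ek : 0 < @emp R s k by lra.
move: (sqr_ge0 (dirv m k : R)); move: (dirv m k ^+ 2) => q q0.
rewrite [2 * q]mulrC -[leRHS]mulrA; apply: ler_wpM2l => //.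
by rewrite ler_pdivlMr// mulrC ler_pdivrMr//; lra.
Qed.

End fixed_sample.

(** The indicator is at most [phi]; the passages to its Bernstein polynomial, to the Gaussian law,
    and back to [phi] cost eps / 3 each. In between, the Gaussian is shifted by [delta e], at the
    level of the Bernstein polynomial since [trig_shift] concerns those. The shifted [phi] is below
    the indicator. Only [delta] and [eps] determine a and N, whence the uniformity in the
    threshold. *)
Lemma cone_prob_bound (delta eps : R) : 0 < delta -> 0 < eps ->
  exists N0 : nat, exists2 eta : R, 0 < eta & forall n s (alpha r : R),
  (N0 <= n)%N -> good eta s -> 0 <= r ->
  (Q [set x | (r < cd (G s ^~ x))%R] <= alpha%:E)%E ->
  Ex w n (fun t => (r < cd (ydev t))%R%:R) <= alpha + shift_cst * delta + eps.
Proof.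
move=> d0 e0; pose L := 2 / delta; have L0 : 0 <= L by rewrite divr_ge0// ltW.
(* One choice of a and N serves both laws: [c] bounds the second moments of the shifted Gaussian,
   and, being at least 1, those of the empirical deviations. *)
pose e := @dirv R m; pose c k := 2 + 2 * (delta * e k) ^+ 2.
have c1 k : 1 <= c k by have := sqr_ge0 (delta * e k); rewrite /c; lra.
have c0 k : 0 <= c k by apply: le_trans (c1 k).
have e3 : 0 < eps / 3 by rewrite divr_gt0.
have [a [N [a0 N0 err]]] := bern_error_small L0 e3 c0.
have [N1 [r1 r10 close]] := bern_mean_close gG cp0 p0z N a e3.
exists (maxn 1 N1), (Num.min r1 (p0 m / 2)); first by rewrite lt_min r10 divr_gt0.
move=> n s alpha r; rewrite geq_max => /andP[n0 nN] gs r0 Qr.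
have min0 : 0 <= Num.min r1 (p0 m / 2) by rewrite le_min !ltW// divr_gt0.
have gs1 : good r1 s by apply: good_sample_le gs => //; rewrite ge_min lexx.
pose phi := smooth_ind D (flat p0 m) e delta r.
have phi1 y : `|phi y| <= 1 by exact: smooth_ind_bounded.
have phi0 y : 0 <= phi y by exact: clip_ge0.
have Lphi y z : `|phi y - phi z| <= L * \sum_(k < D) `|y k - z k| by exact: smooth_ind_lip.
have AD x : flat p0 m x -> (1 <= x)%N /\ (x.+1 < D)%N by exact: flatD.
have e2 x : flat p0 m x -> D2 e x = 2 by move=> /AD[x1 _]; exact: dirv_D2.
have h1 : Ex w n (fun t => (r < cd (ydev t))%R%:R) <= Ex w n (fun t => phi (ydev t)).
  apply: (Ex_le w0) => t; case: (boolP (r < cd (ydev t))) => [ry|_]; last exact: phi0.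
  by rewrite /phi (smooth_ind_ge AD e2 d0 r0 ry).
have h2 := Ex_bern_approx a0 N0 n0 L0 Lphi.
have h2' : L * \sum_(k < D) (a + (a * Num.sqrt N%:R)^-1) <= eps / 3.
  apply: le_trans err; apply: ler_wpM2l => //; apply: ler_sum => k _.
  by rewrite lerD2r; apply: ler_peMr => //; exact: ltW.
have h3 := close n s nN gs1 phi phi1.
have h4 := gaussian_shift_le gs min0 _ (ltW d0) (trig_bern D N a phi) (bern_bounded D N a phi1).
have {}h4 : `|\int[Q]_x bern D N a phi (fun k => G s k x + delta * e k) -
    \int[Q]_x bern D N a phi (G s ^~ x)| <= shift_cst * delta.
  by apply: h4; rewrite ge_min lexx orbT.
have h5 := int_bern_approx gs e delta a0 N0 L0 phi1 Lphi.
have {}h5 := le_trans h5 err.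
pose A := [set x | r < cd (G s ^~ x)].
have mcd : measurable_fun setT (fun x => cd (G s ^~ x)).
  by apply: (lipschitz_measurable (good_gaussian gG gs) ler01) => y z; rewrite mul1r; exact: cdist_lip.
have mA : measurable A.
  rewrite (_ : A = (fun x => cd (G s ^~ x)) @^-1` `]r, +oo[).
    by rewrite -[X in measurable X]setTI; exact: mcd.
  by apply/seteqP; split=> x /=; rewrite in_itv /= andbT.
have h6 : \int[Q]_x phi (fun k => G s k x + delta * e k) <= alpha.
  apply: le_trans (_ : _ <= \int[Q]_x \1_A x) _.
    apply: le_Rintegral => //.
    - exact: (lip_integrable gs e delta L0 phi1 Lphi).
    - apply: (@bounded_integrable _ _ _ Q _ 1) => //.
      by move=> x; rewrite indicE; case: (_ \in _); rewrite ?normr0 ?normr1.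
    move=> x _; rewrite indicE; case: (boolP (x \in A)) => [_|].
      by apply: le_trans (ler_norm _) (phi1 _).
    move/negP => nA; rewrite /phi smooth_ind_shift//.
    by rewrite leNgt; apply/negP => h; apply: nA; rewrite inE.
  rewrite /Rintegral integral_indic// setIT.
  by rewrite -lee_fin fineK//; exact: fin_num_measure.
move: h2 h3 h4 h5; rewrite !ler_norml => /andP[h2 _] /andP[_ h3] /andP[h4 _] /andP[_ h5].
lra.
Qed.

End smoothing.

(** * Rejection probability *)

Section rejection_bound.
Context {R : realType} {d' : measure_display} {T' : measurableType d'}.
Variables (Q : probability T' R) (G : seq nat -> nat -> T' -> R).
Hypothesis gG : forall s : seq nat, gaussian_vector Q (gdim s) (G s) (Sigma s).
Variable alpha : R.
Hypothesis al : 0 < alpha < 1.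

Lemma That_cdist2 (v : R) (s : seq nat) (y : nat -> R) : That v s y =
  cdist2 (gdim s) [set x | (1 <= x <= smax s)%N /\ D2 (phat s) x <= v] y.
Proof.
congr (inf (_ @` _)); apply/seteqP; split=> g Kg x; first by case; exact: Kg.
by move=> xs xv; exact: Kg.
Qed.

Lemma That_ge0 (v : R) s y : 0 <= That v s y.
Proof. by rewrite That_cdist2; exact: cdist2_ge0. Qed.

Lemma That_measurable (v : R) s :
  measurable_fun setT (fun x => That v s (G s ^~ x)).
Proof.
under eq_fun do rewrite That_cdist2 -cdistK expr2.
have mc : measurable_fun setT (fun x => cdist (gdim s)
    [set x | (1 <= x <= smax s)%N /\ D2 (phat s) x <= v] (G s ^~ x)).
  by apply: (lipschitz_measurable (gG s) ler01) => y z; rewrite mul1r; exact: cdist_lip.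
exact: measurable_funM.
Qed.

Local Notation tq v s := (quantile Q (fun x => That v s (G s ^~ x)) (1 - alpha)).

Let tq_ge0 v s : 0 <= tq v s.
Proof.
by apply: quantile_ge0 => //; [exact: That_measurable|move=> x; exact: That_ge0].
Qed.

Variables (p0 : nat -> R) (m : nat).
Hypothesis cp0 : convex_pmf p0.
Hypothesis p0m : 0 < p0 m.
Hypothesis p0z : forall j, (m < j)%N -> p0 j = 0.
Local Notation D := m.+2.
Local Notation w := (@p0w R p0 m).
Local Notation vals t := (map val (t : seq 'I_m.+1)).
Local Notation ydev t := (scaled_dev p0 (vals t)).
Local Notation good := (good_sample p0 m).
Local Notation cd := (cdist D (flat p0 m)).
Local Notation dev s := (sqn D (fun k => @emp R s k - p0 k)).

Let w0 (j : 'I_m.+1) : 0 <= w j := p0w_ge0 cp0 j.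
Let w1 := p0w_sum cp0 p0z.

Lemma quantile_cone_tail (v rho : R) s : 0 <= rho -> 8 * rho <= v -> good rho s ->
  (Q [set x | (Num.sqrt (tq v s) < cd (G s ^~ x))%R] <= alpha%:E)%E.
Proof.
move=> r0 rv gs; have [sz sm hs] := gs.
have mT := That_measurable v s.
have qt := quantile_tail Q mT (fun x => That_ge0 v s (G s ^~ x)) al.
apply: le_trans qt.
have mcd : measurable_fun setT (fun x => cd (G s ^~ x)).
  by apply: (lipschitz_measurable (good_gaussian gG gs) ler01) => y z; rewrite mul1r; exact: cdist_lip.
apply: le_measure; rewrite ?inE.
- rewrite (_ : [set _ | _] = (fun x => cd (G s ^~ x)) @^-1` `]Num.sqrt (tq v s), +oo[).
    by rewrite -[X in measurable X]setTI; exact: mcd.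
  by apply/seteqP; split=> x /=; rewrite in_itv /= andbT.
- rewrite (_ : [set _ | _] = (fun x => That v s (G s ^~ x)) @^-1` `]tq v s, +oo[).
    by rewrite -[X in measurable X]setTI; exact: mT.
  by apply/seteqP; split=> x /=; rewrite in_itv /= andbT.
move=> x /= h.
have : tq v s < cd (G s ^~ x) ^+ 2.
  by rewrite -[ltLHS]sqr_sqrtr// ltr_sqr ?nnegrE ?sqrtr_ge0// cdist_ge0.
move/lt_le_trans; apply; rewrite cdistK; apply: lb_le_inf.
  by exists (sqdist (gdim s) (fun=> 0) (G s ^~ x)), (fun=> 0) => // z _ _; rewrite /D2; lra.
move=> _ [g Kg <-]; rewrite /gdim sm; apply: cdist2_le.
exact: (Kcone_sub cp0 p0z sz sm r0 hs rv Kg).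
Qed.

Lemma deviation_prob n (rho : R) : (0 < n)%N -> 0 < rho ->
  Ex w n (fun t => (rho ^+ 2 < dev (vals t))%R%:R) <= D%:R / (n%:R * rho ^+ 2).
Proof.
move=> n0 r0; have nR : 0 < n%:R :> R by rewrite ltr0n.
have q0 : 0 < n%:R * rho ^+ 2 by rewrite mulr_gt0// exprn_gt0.
rewrite ler_pdivlMr// mulrC -ExZ.
apply: le_trans (_ : _ <= Ex w n (fun t => \sum_(k < D) ydev t k ^+ 2)) _.
  apply: (Ex_le w0) => t.
  have -> : \sum_(k < D) ydev t k ^+ 2 = n%:R * dev (vals t).
    by have := sqn_y p0 m (vals t); rewrite size_map size_tuple.
  rewrite -mulrA; apply: ler_wpM2l; first exact: ltW.
  case: (boolP (rho ^+ 2 < dev (vals t))) => [/ltW|_]; first by rewrite mulr1.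
  by rewrite mulr0 sqn_ge0.
rewrite (Ex_sum w n _ (fun (k : 'I_D) t => ydev t k ^+ 2)).
apply: le_trans (_ : _ <= \sum_(k < D) 1) _; last by rewrite sumr_const card_ord.
by apply: ler_sum => k _; exact: Ex_ydev_sqr.
Qed.

(** A sample that misses m deviates from p0 by p0 m at that point, which a deviation below p0 m
    forbids. *)
Lemma tuple_good n (rho : R) (t : n.-tuple 'I_m.+1) : (0 < n)%N -> 0 <= rho ->
  rho < p0 m -> dev (vals t) <= rho ^+ 2 -> good rho (vals t).
Proof.
move=> n0 r0 rm h; have sz : (0 < size (vals t))%N by rewrite size_map size_tuple.
split=> //; apply/eqP; rewrite eqn_leq; apply/andP; split.
  by apply/bigmax_leqP_seq => _ /mapP[j _ ->] _; rewrite -ltnS; exact: ltn_ord.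
rewrite leqNgt; apply/negP => sm.
have := coord_le_nrm (fun k => @emp R (vals t) k - p0 k) (ltnW (ltnSn m.+1)).
rewrite emp_gt_smax// sub0r normrN ger0_norm ?(ltW p0m)// leNgt => /negP; apply.
exact: le_lt_trans (le_nrm r0 h) rm.
Qed.

Lemma rejection_prob (k0 : R) :
  (forall x, (1 <= x <= m.+1)%N -> D2 p0 x != 0 -> k0 <= D2 p0 x) ->
  forall eta : R, 0 < eta -> exists N0 : nat, exists2 r : R, 0 < r &
  forall n (v : R), (N0 <= n)%N -> (0 < n)%N -> 0 < v -> v / 8 <= r -> v <= k0 -> v / 8 < p0 m ->
  Ex w n (fun t => `[< ((tq v (vals t))%:E <
      (n%:R : R)%:E * sqnorm (fun j => (@emp R (vals t) j - phat (vals t) j)%R))%E >]%:R)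
  <= D%:R / (n%:R * (v / 8) ^+ 2) + (alpha + eta).
Proof.
move=> k0P eta eta0.
have M1 : 1 <= shift_cst p0 m.
  rewrite /shift_cst lerDl; apply: sumr_ge0 => k _; rewrite divr_ge0//.
    by rewrite mulr_ge0// sqr_ge0.
  by case: cp0 => -[].
have M0 : 0 < shift_cst p0 m by exact: lt_le_trans M1.
pose delta := eta / 2 / shift_cst p0 m.
have d0 : 0 < delta by rewrite !divr_gt0.
have e2 : 0 < eta / 2 by rewrite divr_gt0.
have [N0 [r r0 H]] := cone_prob_bound gG cp0 p0m p0z d0 e2.
exists N0, r => // n v nN n0 v0 vr vk vm.
set rho := v / 8; have rho0 : 0 < rho by rewrite divr_gt0.
have rv : 8 * rho <= v by rewrite /rho; lra.
have rk : 8 * rho <= k0 by apply: le_trans vk.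
have bad := deviation_prob n0 rho0.
pose B (t : seq 'I_m.+1) := ((tq v (vals t))%:E <
      (n%:R : R)%:E * sqnorm (fun j => (@emp R (vals t) j - phat (vals t) j)%R))%E.
(* The minimum below needs a good tuple; if there is none, every tuple is in the event bounded by
   Chebyshev's inequality. *)
have [[t0 gt0]|nog] := pselect (exists t : n.-tuple 'I_m.+1, good rho (vals t)); last first.
  apply: le_trans (_ : _ <= D%:R / (n%:R * rho ^+ 2)) _; last first.
    by rewrite lerDl; case/andP: al => a0 _; lra.
  apply: le_trans bad; apply: (Ex_le w0) => t.
  have -> : rho ^+ 2 < dev (vals t).
    by rewrite ltNge; apply/negP => h; apply: nog; exists t; apply: tuple_good => //; exact: ltW.
  by case: `[< _ >].
pose gb := [pred t : n.-tuple 'I_m.+1 | `[< good rho (vals t) >]].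
have gbt0 : gb t0 by apply/asboolP.
case: (@arg_minP _ R _ t0 gb (fun t => tq v (vals t)) gbt0) => ts /asboolP gts mints.
pose rs := Num.sqrt (tq v (vals ts)).
have gts' : good r (vals ts) by apply: good_sample_le gts => //; exact: ltW.
have := H n (vals ts) alpha rs nN gts' (sqrtr_ge0 _) (quantile_cone_tail (ltW rho0) rv gts).
have -> : alpha + shift_cst p0 m * delta + eta / 2 = alpha + eta.
  by rewrite /delta mulrC divfK ?lt0r_neq0// -addrA; congr (_ + _); lra.
move=> main; apply: le_trans (lerD bad main).
rewrite -(ExD w n (fun t => (rho ^+ 2 < dev (vals t))%R%:R) (fun t => (rs < cd (ydev t))%R%:R)).
apply: (Ex_le w0) => t; case: asboolP => [Bt|_]; last by rewrite addr_ge0.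
case: (ltP (rho ^+ 2) (dev (vals t))) => [_|h]; first by rewrite lerDl.
have gt := tuple_good n0 (ltW rho0) vm h.
suff -> : rs < cd (ydev t) by rewrite add0r.
have [sz sm _] := gt.
have := stat_le_cdist2 cp0 p0m p0z k0P sz sm (ltW rho0) h rk.
rewrite size_map size_tuple => st; have := lt_le_trans Bt st; rewrite lte_fin => q1.
have q2 : tq v (vals ts) < cdist2 D (flat p0 m) (ydev t).
  by apply: le_lt_trans q1; apply: mints; apply/asboolP.
by rewrite /rs /cdist ltr_sqrt// (le_lt_trans _ q2).
Qed.

End rejection_bound.

Lemma convex_pmf_last {R : realType} (p0 : nat -> R) (S : nat) : convex_pmf p0 ->
  (forall j, (S < j)%N -> p0 j = 0) ->
  exists2 m : nat, 0 < p0 m & forall j, (m < j)%N -> p0 j = 0.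
Proof.
move=> [[p0_ge0 sum1] _] p0S.
have ex : exists j, 0 < p0 j.
  apply: contrapT => nex.
  have z j : p0 j = 0.
    by apply/eqP; rewrite eq_le p0_ge0 andbT leNgt; apply/negP => h; apply: nex; exists j.
  have : (fun N => \sum_(0 <= k < N) p0 k) @ \oo --> (0 : R).
    rewrite (_ : (fun N => _) = (fun=> 0)); first exact: cvg_cst.
    by apply/funext => N; rewrite big1.
  move=> /(cvg_unique (@Rhausdorff R) sum1) /eqP; by rewrite oner_eq0.
have ub j : 0 < p0 j -> (j <= S)%N.
  by move=> pj; rewrite leqNgt; apply/negP => /p0S p; rewrite p ltxx in pj.
case: (ex_maxnP ex ub) => m pm mmax; exists m => // j mj.
apply/eqP; rewrite eq_le p0_ge0 andbT leNgt; apply/negP => /mmax.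
by rewrite leqNgt mj.
Qed.

Theorem theorem3 (R : realType)
  (d : measure_display) (T : measurableType d) (P : probability T R)
  (X : nat -> T -> nat) (p0 : nat -> R) (S : nat)
  (d' : measure_display) (T' : measurableType d') (Q : probability T' R)
  (G : seq nat -> nat -> T' -> R)
  (v : nat -> R) (alpha : R) :
  convex_pmf p0 -> (0 < S)%N -> (forall j, (S < j)%N -> p0 j = 0) ->
  (forall i j, measurable [set w | X i w = j]) ->
  (forall (n : nat) (j : nat -> nat),
      P [set w | forall i, (i < n)%N -> X i w = j i] = (\prod_(i < n) p0 (j i))%:E) ->
  (forall n, 0 < v n) -> v @ \oo --> (0 : R) ->
  (fun n => Num.sqrt (n%:R : R) * v n) @ \oo --> +oo ->
  0 < alpha < 1 ->
  (forall s : seq nat, gaussian_vector Q (gdim s) (G s) (Sigma s)) ->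
  (limn_esup (fun n : nat =>
     P [set w | let s := sample X n w in
        ((quantile Q (fun w' => That (v n) s (G s ^~ w')) (1 - alpha)%R)%:E
          < (n%:R : R)%:E * sqnorm (fun j => (emp s j - phat s j)%R))%E])
   <= alpha%:E)%E.
Proof.
move=> cp0 _ p0S mX lawX v0 vcvg vinf al gG.
have [m p0m p0z] := convex_pmf_last cp0 p0S.
have [k0 k00 k0P] := D2_p0_gap m cp0.
have sum1 : \sum_(j < m.+1) p0 j = 1.
  by rewrite -(big_mkord xpredT p0) (p0_sum cp0 p0z).
apply/lee_addgt0Pr => eta eta0.
have e2 : 0 < eta / 2 by rewrite divr_gt0.
have [N0 [r r0 H]] := rejection_prob gG al cp0 p0m p0z k0P e2.
pose b := Num.min r (Num.min k0 (p0 m)).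
have b0 : 0 < b by rewrite !lt_min r0 k00.
(* With x = sqrt n v_n the Chebyshev term is 64 (m + 2) / x^2, to be at most eta / 2; the summand 1
   gives x >= 1, hence x^2 >= x >= A. *)
pose A := 1 + 128 * m.+2%:R / eta.
have A1 : 1 <= A by rewrite lerDl divr_ge0 ?mulr_ge0// ltW.
apply: limn_esup_le; near=> n.
have n0 : (0 < n)%N by near: n; exists 1%N.
have nN : (N0 <= n)%N by near: n; exists N0.
have vb : v n < b.
  apply: le_lt_trans (ler_norm _) _; rewrite -[v n]subr0 distrC; near: n.
  by move/cvgrPdist_lt : vcvg => /(_ _ b0).
have vA : A <= Num.sqrt (n%:R : R) * v n.
  by near: n; move/cvgryPge : vinf; exact.
move: vb; rewrite !lt_min => /and3P[vr vk vm].
have vn0 := v0 n.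
have h := H n (v n) nN n0 vn0 _ (ltW vk) _.
have {}h := h ltac:(lra) ltac:(lra).
apply: le_trans (sample_prob mX lawX sum1 n (fun s =>
  ((quantile Q (fun w' => That (v n) s (G s ^~ w')) (1 - alpha)%R)%:E
          < (n%:R : R)%:E * sqnorm (fun j => (emp s j - phat s j)%R))%E)) _.
rewrite -EFinD lee_fin; apply: le_trans h _.
suff : m.+2%:R / (n%:R * (v n / 8) ^+ 2) <= eta / 2 by lra.
have nR : 0 < n%:R :> R by rewrite ltr0n.
have snK : n%:R = Num.sqrt n%:R ^+ 2 :> R by rewrite sqr_sqrtr// ltW.
have -> : n%:R * (v n / 8) ^+ 2 = (Num.sqrt n%:R * v n) ^+ 2 / 64.
  by rewrite [in LHS]snK !exprMn; lra.
move: vA; move: (Num.sqrt n%:R * v n) => x Ax.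
have x1 : 1 <= x by exact: le_trans Ax.
have xx : x <= x ^+ 2 by rewrite expr2 ler_peMr//; lra.
rewrite ler_pdivrMr; last by lra.
have := le_trans Ax xx; rewrite /A.
rewrite -lerBrDl ler_pdivrMr//; move: (m.+2%:R : R) => q hq.
lra.
Unshelve. all: by end_near.
Qed.
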